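(* Let $q\ge 1$ be an integer and $\chi$ a Dirichlet character modulo $q$, and for primes $p\nmid q$ write $\chi(p)=e^{i\theta_p}$ with $\theta_p\in\mathbb{R}$. Let $p_1<p_2<\cdots$ be the primes in increasing order. Fix a positive integer $M$, let $m_1,m_2,\dots$ be independent random variables, each uniformly distributed on $\{0,1,\dots,M\}$, and set $p'_n=p_n+m_n q$ (so $p'_n\equiv p_n \pmod q$ and $\theta_{p'_n}:=\theta_{p_n}$). For real $t$ define $$B'_N(t)=\sum_{\substack{n=1\\ p_n\nmid q}}^{N}\cos\bigl(t\log p'_n-\theta_{p'_n}\bigr).$$ If for every $\epsilon>0$ and every $t\in\mathbb{R}$, with probability equal to $1$ one has $B'_N(t)=O(N^{1/2+\epsilon})$ as $N\to\infty$, then the Riemann Hypothesis holds for the Dirichlet $L$-function $L(s,\chi)=\sum_{m\ge1}\chi(m)m^{-s}$, i.e. all its non-trivial zeros lie on the line $\Re(s)=\tfrac12$.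
   Context: The random sequence $(p'_n)$ is called a state of the ''random-prime ensemble''; the actual primes correspond to the state with all $m_n=0$. Here $O(N^{1/2+\epsilon})$ may be relaxed by logarithmic factors such as powers of $\log N$ or $\log\log N$. Non-trivial zeros of $L(s,\chi)$ are those in the critical strip $0<\Re(s)<1$. *)

(* Defs.v *)
From HB Require Import structures.
From mathcomp Require Import all_boot all_order all_algebra.
From mathcomp Require Import all_classical all_reals all_analysis.
From mathcomp Require Import complex.

Set Implicit Arguments.
Unset Strict Implicit.
Unset Printing Implicit Defensive.

Import Order.TTheory GRing.Theory Num.Theory.
Local Open Scope classical_set_scope.
Local Open Scope ring_scope.

Lemma exists_prime_above (m : nat) : exists p, (m < p)%N && prime p.
Proof. by case: (prime_above m) => p H1 H2; exists p; rewrite H1 H2. Qed.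

Definition next_prime (m : nat) : nat := ex_minn (exists_prime_above m).

(** [nth_prime n] is p_n for n >= 1 : p_1 = 2 < p_2 = 3 < ... ;
    the value at n = 0 (= 1) is a dummy and is never used. *)
Fixpoint nth_prime (n : nat) : nat :=
  match n with
  | 0 => 1
  | k.+1 => next_prime (nth_prime k)
  end.

Definition is_dirichlet_character (R : rcfType) (q : nat) (chi : nat -> R[i])
  : Prop :=
  [/\ chi 1%N = 1,
      (forall m n : nat, chi (m * n)%N = chi m * chi n),
      (forall n : nat, chi (n + q)%N = chi n) &
      (forall n : nat, chi n = 0 <-> ~~ coprime n q)].

Definition principal_character (R : rcfType) (q : nat) (chi : nat -> R[i])
  : Prop := forall n : nat, coprime n q -> chi n = 1.

Section cpow.
Variable R : realType.

Definition cpowR (x : R) (w : R[i]) : R[i] :=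
  Complex (expR (complex.Re w * ln x) * cos (complex.Im w * ln x))
          (expR (complex.Re w * ln x) * sin (complex.Im w * ln x)).

(** Analytic continuation of L(s, chi) to Re s > 0 (s <> 1), via
    L(s,chi) = lim_{N -> oo} ( sum_{n=1}^N chi(n) n^{-s}
                               - c_chi N^{1-s} / (1 - s) ),
    with c_chi = phi(q)/q if chi is principal and 0 otherwise.
    This is the N-th term of that sequence. *)
Definition L_approx (q : nat) (chi : nat -> R[i]) (s : R[i]) (N : nat) : R[i] :=
  let c : R[i] := if `[< principal_character q chi >]
                  then ((totient q)%:R / q%:R) else 0 in
  \sum_(1 <= n < N.+1) chi n * cpowR n%:R (- s)
  - c * cpowR N%:R (1 - s) / (1 - s).

Definition L_zero (q : nat) (chi : nat -> R[i]) (s : R[i]) : Prop :=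
  (fun N => complex.Re (L_approx q chi s N)) @ \oo --> 0 /\
  (fun N => complex.Im (L_approx q chi s N)) @ \oo --> 0.

Definition GRH_for (q : nat) (chi : nat -> R[i]) : Prop :=
  forall s : R[i], 0 < complex.Re s < 1 -> L_zero q chi s -> complex.Re s = 1 / 2.

Definition Bprime (q : nat) (theta : nat -> R) (m : nat -> nat) (N : nat)
  (t : R) : R :=
  \sum_(1 <= n < N.+1 | ~~ (nth_prime n %| q)%N)
     cos (t * ln ((nth_prime n + m n * q)%N)%:R - theta (nth_prime n)).

End cpow.

Definition independent_nat_rvs d (T : measurableType d) (R : realType)
  (P : probability T R) (X : nat -> T -> nat) : Prop :=
  forall (I : seq nat) (A : nat -> set nat), uniq I ->
    fine (P (\bigcap_(i in [set j | j \in I]) (X i @^-1` A i))) =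
    \prod_(i <- I) fine (P (X i @^-1` A i)).

Definition uniform_0_M d (T : measurableType d) (R : realType)
  (P : probability T R) (M : nat) (X : T -> nat) : Prop :=
  (forall k : nat, measurable (X @^-1` [set k])) /\
  (forall k : nat, P (X @^-1` [set k]) =
                   (if (k <= M)%N then (M.+1%:R)^-1 else 0)%:E).

(* Main.v *)
(* One sample point is enough for each zero, so independence plays no role: outside
   a null set all m_n <= M, and then B'_N(t) differs from the same sum over the
   primes p_n by O(sum_{n <= N} 1/n). At t = 0 this rules out a principal
   character, so both Re sum chi(p_n) p_n^{-it} over primes and the full sums of
   chi(n) n^{-it} are O(N^{1/2 + eps}).

   Zeros with Re s > 1/2. Fix Im s = t and put Re s = 2 - h. By Abel summation
   A = Re L, B = Im L and D = Re sum_p chi(p) p^{-s} are absolutely convergent power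
   series in h on [0, 3/2 - eps), as is the contribution E of the higher prime powers
   to 2 log |L|. The Euler product gives A^2 + B^2 = exp(2D + E) for h < 1, hence on
   the whole interval, so A and B do not vanish together.

   Zeros with Re s < 1/2. No functional equation is needed, only the transfer of a
   zero of L(w, conj chi) to a zero of L(1 - w, chi). Put s = 1 - w. The ramp sum
   sum_n chi(n) (x - n)_+ is, up to a constant, the Fejer-regularized trigonometric
   series whose frequencies 2 pi m / q carry the coefficients
   sum_b chi(b) cos(2 pi b m / q) / m^2 and sum_b chi(b) sin(2 pi b m / q) / m^2.
   Integrate against x^{-s-2}: by homogeneity the ramps yield J sum chi(n) n^{-s}
   with J <> 0, while the trigonometric side yields Cesaro means of the twisted
   Dirichlet series sum_m sum_b chi(b) g(bm) m^{-w}. Each of these is a multiple of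
   sum conj chi(m) m^{-w}, up to a sum over integers supported on primes dividing q,
   hence vanishes; this works for imprimitive chi as well. *)
Require Import Defs.
From HB Require Import structures.
From mathcomp Require Import all_boot all_order all_algebra.
From mathcomp Require Import all_classical all_reals all_analysis.
From mathcomp Require Import complex.
From mathcomp Require Import measurable_realfun cyclic.
From mathcomp Require Import ring lra zify.
Import Order.TTheory GRing.Theory Num.Theory.
Import numFieldNormedType.Exports.
Local Open Scope classical_set_scope.
Local Open Scope ring_scope.

Set Implicit Arguments.
Unset Strict Implicit.
Unset Printing Implicit Defensive.

(** Zeros are limits of partial sums, so the argument stays with real functions and conditionally
    convergent series. Expanding in h around Re s = 2 makes continuation elementary: the weights
    n^{h-2} - (n+1)^{h-2} split into pieces whose Taylor coefficients have one sign, so after Abel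
    summation a series with coefficient sums O(N^th) becomes an absolutely convergent power series
    on all of [0, 2 - th), where an identity theorem on an interval is enough. The hypothesis
    controls cosines only, that is, the real part of the prime sum; hence |L|^2 is compared and
    never L itself. From h = 3/2 on, the squares n^{2(h-2)} are no longer summable. For zeros with
    Re s < 1/2, ramps rather than steps give coefficients O(1/m^2). With affine Taylor parts at 0
    removed, both sides are bounded by multiples of x and of x^2, uniformly in the truncation, so
    dominated convergence against x^{-s-2} covers the whole strip 0 < Re s < 1. The reflected
    exponent comes from dilation: a frequency k contributes k^{s+1} = k^2 k^{-(1-s)}, and k^2
    cancels the coefficient 1/k^2. *)

Section RealSequences.
Variable R : realType.
Implicit Types (u v b : nat -> R) (l F e B : R).

Lemma cvgn_distP u l : (u @ \oo --> l) <->
  (forall e, 0 < e -> exists N, forall n, (N <= n)%N -> `|u n - l| <= e).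
Proof.
split=> [/cvgrPdist_le ul e e0 | H].
  have [N _ HN] := ul e e0; exists N => n Nn.
  by rewrite distrC; exact: HN.
apply/cvgrPdist_le => e e0; have [N HN] := H e e0.
by exists N => // n Nn; rewrite distrC; exact: HN.
Qed.

Lemma cvgn_uniq u l l' : u @ \oo --> l -> u @ \oo --> l' -> l = l'.
Proof. by move=> ul ul'; exact: cvg_unique ul ul'. Qed.

Lemma cvgn_shift u l k : (u @ \oo --> l) <-> ((fun n => u (n + k)%N) @ \oo --> l).
Proof.
split=> /cvgn_distP H; apply/cvgn_distP => e /H[N HN].
  by exists N => n Nn; apply: HN; rewrite (leq_trans Nn) // leq_addr.
exists (N + k)%N => n Nn; rewrite -(subnK (leq_trans (leq_addl N k) Nn)); apply: HN.
by rewrite leq_subRL ?(leq_trans (leq_addl N k) Nn) // addnC.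
Qed.

Lemma limn_leP u l B : u @ \oo --> l -> (forall n, u n <= B) -> l <= B.
Proof.
by move=> ul H; rewrite -(cvg_lim _ ul) //; apply: limr_le;
  [apply/cvg_ex; exists l | near=> n; apply: H].
Unshelve. all: by end_near. Qed.

Lemma cvgn_sum (J : nat) (s : nat -> nat -> R) (f : nat -> R) :
  (forall j, s ^~ j @ \oo --> f j) ->
  (fun K => \sum_(0 <= j < J) s K j) @ \oo --> \sum_(0 <= j < J) f j.
Proof.
move=> H; elim: J => [|J IH].
  by rewrite big_geq //; under eq_fun do rewrite big_geq //; exact: cvg_cst.
rewrite big_nat_recr //=; under eq_fun do rewrite big_nat_recr //=.
exact: cvgD IH (H J).
Qed.

Lemma series_cvg_bounded u B : (forall n, \sum_(0 <= k < n) `|u k| <= B) ->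
  cvgn (fun n => \sum_(0 <= k < n) u k).
Proof.
move=> H; apply: (@normed_cvg _ _ u).
apply: nondecreasing_is_cvgn; first by apply: nondecreasing_series => n _ _; exact: normr_ge0.
by exists B => _ [n _ <-]; exact: H.
Qed.

Lemma series_tail b B : (forall j, 0 <= b j) ->
  (forall n, \sum_(0 <= j < n) b j <= B) ->
  forall e, 0 < e -> exists J, forall n, \sum_(J <= j < n) b j <= e.
Proof.
move=> b0 bB e e0.
have /cvg_ex[l /= /cvgn_distP H] : cvgn (fun n => \sum_(0 <= k < n) b k).
  by apply: (@series_cvg_bounded _ B) => n;
    under eq_bigr do rewrite ger0_norm //; exact: bB.
have e2 : 0 < e / 2 by lra.
have [N HN] := H (e / 2) e2; exists N => n.
have [Nn|nN] := leqP N n; last by rewrite big_geq ?ltW // ltnW.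
have -> : \sum_(N <= j < n) b j = \sum_(0 <= j < n) b j - \sum_(0 <= j < N) b j.
  by rewrite [\sum_(0 <= j < n) _](big_cat_nat (n := N)) //= addrAC subrr add0r.
have := HN _ Nn; have := HN _ (leqnn N); rewrite !ler_norml.
by move=> /andP[? ?] /andP[? ?]; lra.
Qed.

(** Dominated convergence for series: beyond an index [J] chosen from the majorant [b] alone, the
    tails of every row and of the limit are small, and only a finite sum remains to pass to the
    limit. *)
Lemma tannery (s : nat -> nat -> R) b B (f S : nat -> R) F :
  (forall K j, `|s K j| <= b j) ->
  (forall n, \sum_(0 <= j < n) b j <= B) ->
  (forall j, s ^~ j @ \oo --> f j) ->
  (forall K, (fun n => \sum_(0 <= j < n) s K j) @ \oo --> S K) ->
  (fun n => \sum_(0 <= j < n) f j) @ \oo --> F ->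
  S @ \oo --> F.
Proof.
move=> sb bB sf sS fF; have b0 j : 0 <= b j := le_trans (normr_ge0 _) (sb 0%N j).
apply/cvgn_distP => e e0; have e4 : 0 < e / 4 by lra.
have [J HJ] := series_tail b0 bB e4.
have tail (a : nat -> R) A : (forall j, `|a j| <= b j) ->
    (fun n => \sum_(0 <= j < n) a j) @ \oo --> A ->
    `|A - \sum_(0 <= j < J) a j| <= e / 4.
  move=> ab /cvgn_distP aA; apply/ler_addgt0Pr => d d0.
  have [N HN] := aA d d0; have := HN _ (leq_maxl N J).
  set n := maxn N J => Hn.
  have E : \sum_(0 <= j < n) a j = \sum_(0 <= j < J) a j + \sum_(J <= j < n) a j.
    by rewrite (big_cat_nat (n := J)) //= leq_maxr.
  have : `|\sum_(J <= j < n) a j| <= e / 4.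
    apply: le_trans (HJ n); apply: le_trans (ler_norm_sum _ _ _) _.
    by apply: ler_sum.
  rewrite E in Hn; move: Hn; rewrite !ler_norml => /andP[? ?] /andP[? ?].
  by apply/andP; split; lra.
have fb j : `|f j| <= b j.
  have /cvg_norm := sf j => /limn_leP; apply => K; exact: sb.
have [N HN] := (cvgn_distP _ _).1 (cvgn_sum (J := J) sf) _ e4.
exists N => n Nn; have := HN _ Nn; have := tail _ _ (sb n) (sS n).
have := tail _ _ fb fF; rewrite !ler_norml.
by move=> /andP[? ?] /andP[? ?] /andP[? ?]; apply/andP; split; lra.
Qed.

(** Fubini for double series, as Tannery's theorem over the rows [j] with the number of columns as
    parameter. The bound on the column sums is returned as well, because it becomes the majorant of
    a power series. *)
Lemma double_series (a : nat -> nat -> R) b B (f e : nat -> R) F :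
  (forall j n, \sum_(0 <= k < n) `|a j k| <= b j) ->
  (forall n, \sum_(0 <= j < n) b j <= B) ->
  (forall j, (fun n => \sum_(0 <= k < n) a j k) @ \oo --> f j) ->
  (forall k, (fun n => \sum_(0 <= j < n) a j k) @ \oo --> e k) ->
  (fun n => \sum_(0 <= j < n) f j) @ \oo --> F ->
  (forall n, \sum_(0 <= k < n) `|e k| <= B) /\
  (fun n => \sum_(0 <= k < n) e k) @ \oo --> F.
Proof.
move=> ab bB af ae fF; split; last first.
  apply: (@tannery (fun K j => \sum_(0 <= k < K) a j k) b B f) => //.
    by move=> K j; exact: le_trans (ler_norm_sum _ _ _) (ab j K).
  move=> K; under eq_fun do rewrite exchange_big /=.
  exact: cvgn_sum.
move=> n; apply: (@limn_leP (fun J => \sum_(0 <= k < n) `|\sum_(0 <= j < J) a j k|)).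
  by apply: (@cvgn_sum n (fun J k => `|\sum_(0 <= j < J) a j k|)) => k; apply: cvg_norm.
move=> J; apply: le_trans (bB J).
apply: le_trans (_ : \sum_(0 <= k < n) \sum_(0 <= j < J) `|a j k| <= _).
  by apply: ler_sum => k _; exact: ler_norm_sum.
by rewrite exchange_big /=; apply: ler_sum => j _; exact: ab.
Qed.

Lemma expR_series (x : R) :
  (fun n => \sum_(0 <= k < n) (k`!%:R)^-1 * x ^+ k) @ \oo --> expR x.
Proof.
have := is_cvg_series_exp_coeff x; rewrite /expR.
rewrite (_ : series _ = (fun n => \sum_(0 <= k < n) (k`!%:R)^-1 * x ^+ k)) //.
by apply/funext => n; apply: eq_bigr => k _; rewrite /exp_coeff /= mulrC.
Qed.

Lemma expR_partial_le (x : R) n : 0 <= x ->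
  \sum_(0 <= k < n) (k`!%:R)^-1 * x ^+ k <= expR x.
Proof.
move=> x0; have H := @expR_series x; rewrite -(cvg_lim _ H) //.
apply: nondecreasing_cvgn_le; last by apply/cvg_ex; exists (expR x).
by apply: nondecreasing_series => k _ _; rewrite mulr_ge0 // ?exprn_ge0 // invr_ge0.
Qed.

End RealSequences.

(** * Power series in a real variable *)

Section PowerSeries.
Variables (R : realType) (r : R).
Implicit Types (f g b c : R -> R) (h : R).

(* The majorant [b] controls the absolute partial sums; it is what makes countable
   sums of such functions again power series ([pseries_sum]). *)
Definition pseries f b := exists c : nat -> R, forall h, 0 <= h < r ->
  (forall n, \sum_(0 <= k < n) `|c k * h ^+ k| <= b h) /\
  (fun n => \sum_(0 <= k < n) c k * h ^+ k) @ \oo --> f h.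

Lemma pseries_ge0 f b h : pseries f b -> 0 <= h < r -> 0 <= b h.
Proof. by move=> [c H] /H[+ _] => /(_ 0%N); rewrite big_geq. Qed.

Lemma pseries_le f b h : pseries f b -> 0 <= h < r -> `|f h| <= b h.
Proof.
move=> [c H] /H[Hb /cvg_norm/limn_leP]; apply => n.
exact: le_trans (ler_norm_sum _ _ _) (Hb n).
Qed.

Lemma pseries_ext f f' b b' : (forall h, 0 <= h < r -> f h = f' h) ->
  (forall h, 0 <= h < r -> b h <= b' h) -> pseries f b -> pseries f' b'.
Proof.
move=> ff bb [c H]; exists c => h hr; have [H1 H2] := H _ hr; split.
  by move=> n; exact: le_trans (bb _ hr).
by rewrite -ff.
Qed.

(** Weierstrass's double series theorem: the coefficients of the sum are the column sums of the
    coefficients, and [double_series] regroups at each [h]. *)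
Lemma pseries_sum (f b : nat -> R -> R) F B :
  (forall j, pseries (f j) (b j)) ->
  (forall h, 0 <= h < r -> forall n, \sum_(0 <= j < n) b j h <= B h) ->
  (forall h, 0 <= h < r -> (fun n => \sum_(0 <= j < n) f j h) @ \oo --> F h) ->
  pseries F B.
Proof.
move=> /choice[c Hc] bB fF.
have [r0|r0] := leP r 0.
  by exists (fun=> 0) => h /andP[? ?]; exfalso; lra.
(* The column sums do not depend on [h], so their convergence is read off at the single interior
   point [r / 2], where the majorant bounds [|c j k| (r / 2)^k]. *)
have ck k : exists e : R, (fun n => \sum_(0 <= j < n) c j k) @ \oo --> e.
  have r2 : 0 <= r / 2 < r by apply/andP; split; lra.
  have rk : 0 < (r / 2) ^+ k by apply: exprn_gt0; lra.
  suff /cvg_ex[e He] : cvgn (fun n => \sum_(0 <= j < n) c j k) by exists e.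
  apply: (@series_cvg_bounded _ _ (B (r / 2) / (r / 2) ^+ k)) => n.
  rewrite ler_pdivlMr // mulr_suml; apply: le_trans (bB _ r2 n).
  apply: ler_sum => j _; have [H _] := Hc j _ r2.
  apply: le_trans (H k.+1); rewrite big_nat_recr //= normrM (gtr0_norm rk) lerDr.
  by apply: sumr_ge0.
have [e He] := choice ck.
exists e => h hr.
apply: (@double_series _ (fun j k => c j k * h ^+ k) (fun j => b j h) (B h)
  (fun j => f j h) (fun k => e k * h ^+ k) (F h)).
- by move=> j n; have [H _] := Hc j _ hr; exact: H.
- exact: bB.
- by move=> j; have [_ H] := Hc j _ hr; exact: H.
- by move=> k; under eq_fun do rewrite -mulr_suml; apply: cvgM (He k) (cvg_cst _).
- exact: fF.
Qed.

Lemma pseries_monomial (a : R) (k : nat) : pseries (fun h => a * h ^+ k) (fun h => `|a| * h ^+ k).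
Proof.
exists (fun j => if j == k then a else 0) => h /andP[h0 _].
have E (g : nat -> R) n : \sum_(0 <= j < n) (if j == k then g j else 0) =
    if (k < n)%N then g k else 0.
  elim: n => [|n IH]; first by rewrite big_geq.
  rewrite big_nat_recr //= IH ltnS; case: ltngtP => // H.
  - by rewrite addr0.
  - by rewrite addr0.
  - by rewrite add0r H.
split.
  move=> n; rewrite (eq_bigr (fun j => if j == k then `|a| * h ^+ j else 0)); last first.
    by move=> j _; case: eqP => _; rewrite ?mul0r ?normr0 // normrM (ger0_norm (exprn_ge0 _ h0)).
  by rewrite E; case: ifP => _ //; rewrite mulr_ge0 // exprn_ge0.
apply/cvgn_distP => e e0; exists k.+1 => n kn.
rewrite (eq_bigr (fun j => if j == k then a * h ^+ j else 0)); last first.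
  by move=> j _; case: eqP => _; rewrite ?mul0r.
by rewrite E kn subrr normr0 ltW.
Qed.

Lemma pseries_add f g b c : pseries f b -> pseries g c ->
  pseries (fun h => f h + g h) (fun h => b h + c h).
Proof.
move=> [u Hu] [v Hv]; exists (fun k => u k + v k) => h hr.
have [u1 u2] := Hu _ hr; have [v1 v2] := Hv _ hr; split.
  move=> n; apply: le_trans (lerD (u1 n) (v1 n)); rewrite -big_split /=.
  by apply: ler_sum => k _; rewrite mulrDl; exact: ler_normD.
under eq_fun do (under eq_bigr do rewrite mulrDl; rewrite big_split /=).
exact: cvgD.
Qed.

Lemma pseries_scale_monomial (a : R) j f b : pseries f b ->
  pseries (fun h => a * h ^+ j * f h) (fun h => `|a * h ^+ j| * b h).
Proof.
move=> [u Hu].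
exists (fun k => if (k < j)%N then 0 else a * u (k - j)%N) => h hr.
have [u1 u2] := Hu _ hr.
have E (w : nat -> R) n : (forall k, (k < j)%N -> w k = 0) ->
    \sum_(0 <= k < n) w k = \sum_(0 <= k < n - j) w (k + j)%N.
  move=> w0; have [nj|jn] := leqP n j.
    rewrite [RHS]big_geq; last by rewrite (eqP (_ : (n - j)%N == 0%N)) // subn_eq0.
    by rewrite big_nat; apply: big1 => k /andP[_ kn]; rewrite w0 // (leq_trans kn).
  rewrite (big_cat_nat (n := j)) //=; last exact: ltnW.
  rewrite big_nat big1 ?add0r; last by move=> k /andP[_ kn]; rewrite w0.
  by rewrite -{1}(add0n j) big_addn.
split.
  move=> n; rewrite E; last by move=> k kj; rewrite kj mul0r normr0.
  apply: le_trans (_ : `|a * h ^+ j| * \sum_(0 <= k < n - j) `|u k * h ^+ k| <= _).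
    rewrite mulr_sumr; apply: ler_sum => k _.
    rewrite ltnNge leq_addl /= addnK exprD -normrM.
    by rewrite (_ : a * u k * _ = a * h ^+ j * (u k * h ^+ k)) //; ring.
  by apply: ler_wpM2l.
apply/(cvgn_shift _ _ j) => /=.
rewrite (_ : (fun n => _) = (fun n => a * h ^+ j * \sum_(0 <= k < n) u k * h ^+ k)).
  by apply: cvgM => //; exact: cvg_cst.
apply/funext => n /=; rewrite E; last by move=> k kj; rewrite kj mul0r.
rewrite addnK mulr_sumr; apply: eq_bigr => k _.
by rewrite ltnNge leq_addl /= addnK exprD; ring.
Qed.

(** The Cauchy product comes from [pseries_sum] applied to the shifted series [u j * h ^+ j * g h],
    so no convolution is ever written. *)
Lemma pseries_mul f g b c : pseries f b -> pseries g c ->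
  pseries (fun h => f h * g h) (fun h => b h * c h).
Proof.
move=> [u Hu] gc.
apply: (@pseries_sum (fun j h => u j * h ^+ j * g h) (fun j h => `|u j * h ^+ j| * c h)).
- by move=> j; exact: pseries_scale_monomial.
- move=> h hr n; rewrite -mulr_suml; apply: ler_wpM2r; first exact: pseries_ge0 gc hr.
  exact: (Hu _ hr).1.
- move=> h hr; under eq_fun do rewrite -mulr_suml.
  by apply: cvgM; [exact: (Hu _ hr).2 | exact: cvg_cst].
Qed.

Lemma pseries_exp f n b : pseries f b -> pseries (fun h => f h ^+ n) (fun h => b h ^+ n).
Proof.
move=> fb; elim: n => [|n IH].
  have := pseries_monomial 1 0; apply: pseries_ext => h _ /=; by rewrite ?normr1 ?mul1r.
by under eq_fun do rewrite exprS; under [X in pseries _ X]eq_fun do rewrite exprS;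
  exact: pseries_mul.
Qed.

Lemma pseries_scale a f b : pseries f b -> pseries (fun h => a * f h) (fun h => `|a| * b h).
Proof.
move=> /(pseries_scale_monomial a 0); apply: pseries_ext => h _; by rewrite expr0 mulr1.
Qed.

Lemma pseries_expR f b : pseries f b -> pseries (fun h => expR (f h)) (fun h => expR (b h)).
Proof.
move=> fb.
apply: (@pseries_sum (fun k h => (k`!%:R)^-1 * f h ^+ k) (fun k h => (k`!%:R)^-1 * b h ^+ k)).
- move=> k; have := pseries_scale (k`!%:R)^-1 (pseries_exp k fb).
  by rewrite ger0_norm // invr_ge0.
- by move=> h hr n; apply: expR_partial_le; exact: pseries_ge0 fb hr.
- by move=> h hr; exact: expR_series.
Qed.

Lemma pseries_expRM (l : R) : 0 <= l -> pseries (fun h => expR (l * h)) (fun h => expR (l * h)).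
Proof.
move=> l0; apply: pseries_expR; have := pseries_monomial l 1.
by rewrite ger0_norm //; apply: pseries_ext => h _; rewrite expr1.
Qed.

(** Identity theorem, the substitute for analytic continuation: near 0 the first nonzero coefficient
    would dominate the rest of the series. *)
Lemma pseries_zero f b d : 0 < d -> pseries f b -> (forall h, 0 <= h < d -> f h = 0) ->
  forall h, 0 <= h < r -> f h = 0.
Proof.
move=> d0 [c Hc] fd.
move=> h hr; have r0 : 0 < r by case/andP: hr => ? ?; lra.
suff c0 k : c k = 0.
  have [_ H] := Hc _ hr; apply: (cvgn_uniq H).
  by under eq_fun do (under eq_bigr do rewrite c0 mul0r; rewrite big1_eq); exact: cvg_cst.
set h1 := r / 2; have h10 : 0 < h1 by rewrite /h1; lra.
have h1r : 0 <= h1 < r by rewrite /h1; apply/andP; split; lra.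
have [B1 _] := Hc _ h1r.
elim/ltn_ind: k => k IH.
(* With the coefficients below [k] gone, [f x = 0] says that [c k * x ^+ k] is minus the tail, and
   for [x <= h1] the tail at [x] is at most [(x / h1) ^+ k.+1] times the absolute tail at [h1]. *)
have key x : 0 < x -> x <= h1 -> x < d -> `|c k| <= x * (b h1 / h1 ^+ k.+1).
  move=> x0 xh xd; have xr : 0 <= x < r by move: h1r => /andP[? ?]; apply/andP; split; lra.
  have [_ ] := Hc _ xr; rewrite fd; last by apply/andP; split => //; exact: ltW.
  move=> /(cvgn_shift _ _ k.+1)/cvg_norm; rewrite normr0 => C.
  suff H : `|c k * x ^+ k| <= (x / h1) ^+ k.+1 * b h1.
    have xk : 0 < x ^+ k by exact: exprn_gt0.
    rewrite -(ler_pM2r xk); apply: le_trans (_ : `|c k * x ^+ k| <= _).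
      by rewrite normrM (gtr0_norm xk).
    apply: le_trans H _; rewrite expr_div_n exprS.
    by rewrite [X in X <= _](_ : _ = x * (b h1 / h1 ^+ k.+1) * x ^+ k) //; ring.
  suff : `|c k * x ^+ k| - 0 <= (x / h1) ^+ k.+1 * b h1 by rewrite subr0.
  apply: (limn_leP (u := fun n => `|c k * x ^+ k| - `|\sum_(0 <= j < n + k.+1) c j * x ^+ j|)).
    by apply: cvgB => //; exact: cvg_cst.
  move=> n; apply: le_trans (lerB_dist _ _) _.
  rewrite (big_cat_nat (n := k.+1)) //=; last exact: leq_addl.
  rewrite big_nat_recr //= big_nat big1 ?add0r; last by move=> j /andP[_ jk]; rewrite IH // mul0r.
  rewrite opprD addrA subrr add0r normrN.
  apply: le_trans (ler_norm_sum _ _ _) _.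
  apply: le_trans (_ : (x / h1) ^+ k.+1 * \sum_(k.+1 <= j < n + k.+1) `|c j * h1 ^+ j| <= _); last first.
    apply: ler_wpM2l; first by rewrite exprn_ge0 // divr_ge0 // ltW.
    apply: le_trans (B1 (n + k.+1)%N).
    by rewrite [leRHS](big_cat_nat (n := k.+1)) //=; [rewrite lerDr; apply: sumr_ge0|exact: leq_addl].
  rewrite mulr_sumr !big_nat; apply: ler_sum => j /andP[kj _].
  have -> : c j * x ^+ j = (x / h1) ^+ j * (c j * h1 ^+ j).
    by rewrite mulrCA -exprMn mulfVK // gt_eqF.
  rewrite normrM; apply: ler_wpM2r => //.
  have xh0 : 0 <= x / h1 by rewrite divr_ge0 // ltW.
  by rewrite ger0_norm ?exprn_ge0 // ler_wiXn2l // ler_pdivrMr // mul1r.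
apply/eqP; rewrite -normr_eq0 eq_le normr_ge0 andbT.
set C := b h1 / h1 ^+ k.+1 in key.
have C0 : 0 <= C by rewrite divr_ge0 ?exprn_ge0 ?(ltW h10) //; have := B1 0%N; rewrite big_geq.
apply/ler_addgt0Pr => e e0; rewrite add0r.
(* [C + 1] keeps the division meaningful when [C = 0]; [d / 2] yields the strict inequality
   [x < d]. *)
set x := Num.min (Num.min h1 (d / 2)) (e / (C + 1)).
have C1 : 0 < C + 1 by lra.
have eC : 0 < e / (C + 1) by rewrite divr_gt0.
have x0 : 0 < x by rewrite /x !lt_min h10 eC andbT /=; lra.
have x1 : x <= h1 by rewrite /x !ge_min lexx.
have x2 : x <= d / 2 by rewrite /x !ge_min lexx orbT.
have x3 : x <= e / (C + 1) by rewrite /x !ge_min lexx orbT.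
have xd : x < d by lra.
apply: le_trans (key x x0 x1 xd) _.
apply: le_trans (_ : x * (C + 1) <= _); first by apply: ler_wpM2l; lra.
by rewrite -ler_pdivlMr.
Qed.

End PowerSeries.

(** * Real powers of natural numbers and the sum of n^{-1-d} *)

Section NatPower.
Variable R : realType.
Implicit Types (x y d : R) (n m : nat).

(* Differs from [powR] at [n = 0], where [ln 0 = 0] makes it equal to [1]. *)
Definition npow n x : R := expR (x * ln n%:R).

Lemma npow_ge0 n x : 0 <= npow n x. Proof. exact: expR_ge0. Qed.
Lemma npowD n x y : npow n (x + y) = npow n x * npow n y.
Proof. by rewrite /npow mulrDl expRD. Qed.
Lemma npowN n x : npow n (- x) = (npow n x)^-1.
Proof. by rewrite /npow mulNr expRN. Qed.
Lemma npow1n x : npow 1 x = 1.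
Proof. by rewrite /npow ln1 mulr0 expR0. Qed.
Lemma npow1 n : (0 < n)%N -> npow n 1 = n%:R.
Proof. by move=> n0; rewrite /npow mul1r lnK // posrE ltr0n. Qed.
Lemma npowN1 n : (0 < n)%N -> npow n (- 1) = n%:R^-1.
Proof. by move=> n0; rewrite npowN npow1. Qed.
Lemma npowM n m x : (0 < n)%N -> (0 < m)%N -> npow (n * m) x = npow n x * npow m x.
Proof.
by move=> n0 m0; rewrite /npow natrM lnM ?posrE ?ltr0n // mulrDr expRD.
Qed.
Lemma npow_natr n k : (0 < n)%N -> npow n k%:R = n%:R ^+ k.
Proof. by move=> n0; rewrite /npow expRM_natl lnK // posrE ltr0n. Qed.
Lemma npow_powR n x : (0 < n)%N -> n%:R `^ x = npow n x.
Proof. by move=> n0; rewrite /powR /npow pnatr_eq0 eqn0Ngt n0. Qed.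

Lemma ln_nat_ge0 n : 0 <= ln n%:R :> R.
Proof.
case: n => [|n]; first by rewrite ln0.
by rewrite ln_ge0 // ler1n.
Qed.

Lemma ler_npow n x y : x <= y -> npow n x <= npow n y.
Proof. by move=> xy; rewrite ler_expR ler_wpM2r // ln_nat_ge0. Qed.

Lemma ler_npowl n m x : (0 < n)%N -> (n <= m)%N -> 0 <= x -> npow n x <= npow m x.
Proof.
move=> n0 nm x0; rewrite ler_expR ler_wpM2l // ler_ln ?posrE ?ltr0n //.
  by rewrite ler_nat.
exact: leq_trans nm.
Qed.

Lemma ler_npowlN n m x : (0 < n)%N -> (n <= m)%N -> x <= 0 -> npow m x <= npow n x.
Proof.
move=> n0 nm x0; rewrite ler_expR ler_wnM2l // ler_ln ?posrE ?ltr0n //.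
  by rewrite ler_nat.
exact: leq_trans nm.
Qed.

Lemma lnS_bounds m : (0 < m)%N ->
  m.+1%:R^-1 <= ln m.+1%:R - ln m%:R :> R /\ ln m.+1%:R - ln m%:R <= m%:R^-1 :> R.
Proof.
move=> m0; have mR : 0 < m%:R :> R by rewrite ltr0n.
have mS : 0 < m.+1%:R :> R by rewrite ltr0n.
split.
  rewrite -lerN2 opprB -ln_div ?posrE //.
  have -> : m%:R / m.+1%:R = 1 + - m.+1%:R^-1 :> R.
    by rewrite -{1}(natr1 m) in mS *; field; rewrite gt_eqF.
  apply: le_ln1Dx; rewrite ltrN2 invf_lt1 // ltr1n.
  by rewrite ltnS.
rewrite -ln_div ?posrE //.
have -> : m.+1%:R / m%:R = 1 + m%:R^-1 :> R.
  by rewrite -natr1; field; rewrite gt_eqF.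
by apply: le_ln1Dx; apply: lt_trans (_ : 0 < _); rewrite ?invr_gt0 // ltrN10.
Qed.

Lemma npow_sum_bound d : 0 < d -> forall N,
  \sum_(0 <= k < N) npow k.+1 (- (1 + d)) <= 1 + d^-1.
Proof.
move=> d0.
(* The remainder [d^-1 * npow N.+1 (- d)] has to be carried through the induction: its decrease
   absorbs the new term, by [1/n <= ln n - ln (n-1)] and [1 + y <= exp y]. *)
suff H N : \sum_(0 <= k < N.+1) npow k.+1 (- (1 + d)) <= 1 + d^-1 - d^-1 * npow N.+1 (- d).
  case=> [|N]; first by rewrite big_geq // addr_ge0 // invr_ge0 ltW.
  apply: le_trans (H N) _; rewrite gerDl oppr_le0 mulr_ge0 ?npow_ge0 //.
  by rewrite invr_ge0 ltW.
elim: N => [|N IH].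
  by rewrite big_nat1 !npow1n mulr1 addrK.
rewrite big_nat_recr //=; apply: le_trans (lerD IH (lexx _)) _.
rewrite -addrA lerD2l -lerBrDl opprK -mulrN -mulrDr mulrC.
rewrite opprD npowD npowN1 // ler_pdivlMr // addrC.
have [L _] := lnS_bounds (ltn0Sn N).
have -> : npow N.+1 (- d) = npow N.+2 (- d) * expR (d * (ln N.+2%:R - ln N.+1%:R)).
  by rewrite /npow -expRD; congr expR; ring.
apply: le_trans (_ : npow N.+2 (- d) * (1 + d * N.+2%:R^-1) - npow N.+2 (- d) <= _).
  by rewrite [leLHS](_ : _ = npow N.+2 (- d) * (1 + d * N.+2%:R^-1) - npow N.+2 (- d)) //; ring.
rewrite lerD2r ler_wpM2l ?npow_ge0 //.
apply: le_trans (expR_ge1Dx _); rewrite lerD2l ler_wpM2l //; exact: ltW.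
Qed.

Lemma npow_cvg0 d : 0 < d -> (fun n => npow n.+1 (- d)) @ \oo --> (0 : R).
Proof.
move=> d0; apply/cvgn_distP => e e0.
pose N := (Num.truncn (expR (- ln e / d))).+1.
exists N => n Nn; rewrite subr0 ger0_norm ?npow_ge0 //.
rewrite -[leRHS]lnK ?posrE // ler_expR mulNr lerNl -ler_pdivrMl // mulrC.
rewrite -(@ler_expR R) lnK ?posrE ?ltr0n //.
apply: ltW; apply: lt_le_trans (truncnS_gt _) _.
by rewrite ler_nat; exact: leqW.
Qed.

End NatPower.

(** * Abel summation of Dirichlet series into power series *)

Section Abel.
Variable R : realType.

Lemma abel_summation (a w : nat -> R) n :
  \sum_(0 <= k < n) a k * w k =
  \sum_(0 <= k < n) (\sum_(0 <= j < k.+1) a j) * (w k - w k.+1)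
  + (\sum_(0 <= j < n) a j) * w n.
Proof.
elim: n => [|n IH]; first by rewrite !big_geq // mul0r addr0.
by rewrite big_nat_recr //= IH [in RHS]big_nat_recr //= [in RHS]big_nat_recr //=; ring.
Qed.

(** With nonnegative coefficients a convergent power series is its own majorant; this serves the
    differences of exponentials below. *)
Lemma pseries_nonneg r (c : nat -> R) (f : R -> R) : (forall k, 0 <= c k) ->
  (forall h, 0 <= h < r -> (fun n => \sum_(0 <= k < n) c k * h ^+ k) @ \oo --> f h) ->
  pseries r f f.
Proof.
move=> c0 H; exists c => h hr; split; last exact: H.
have h0 : 0 <= h by case/andP: hr.
move=> n; under eq_bigr do rewrite ger0_norm ?mulr_ge0 ?exprn_ge0 //.
have C := H _ hr; rewrite -(cvg_lim _ C) //.
apply: nondecreasing_cvgn_le; last by apply/cvg_ex; exists (f h).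
by apply: nondecreasing_series => k _ _; rewrite mulr_ge0 // exprn_ge0.
Qed.

Lemma pseries_expRB r (l l' : R) : 0 <= l <= l' ->
  pseries r (fun h => expR (l' * h) - expR (l * h)) (fun h => expR (l' * h) - expR (l * h)).
Proof.
move=> /andP[l0 ll'].
apply: (@pseries_nonneg _ (fun k => (k`!%:R)^-1 * (l' ^+ k - l ^+ k))).
  by move=> k; rewrite mulr_ge0 ?invr_ge0 // subr_ge0 lerXn2r // nnegrE (le_trans l0).
move=> h _.
rewrite (_ : (fun n => _) = (fun n => \sum_(0 <= k < n) (k`!%:R)^-1 * (l' * h) ^+ k
   - \sum_(0 <= k < n) (k`!%:R)^-1 * (l * h) ^+ k)).
  by apply: cvgB; exact: expR_series.
apply/funext => n; rewrite -sumrB; apply: eq_bigr => k _; rewrite !exprMn; ring.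
Qed.

Lemma npow_diff_le m (x : R) : (0 < m)%N -> 0 <= x ->
  npow m.+1 x - npow m x <= npow m.+1 x * (x * m%:R^-1).
Proof.
move=> m0 x0; have [_ L] := lnS_bounds R m0.
have -> : npow m x = npow m.+1 x * expR (- (x * (ln m.+1%:R - ln m%:R))).
  by rewrite /npow -expRD; congr expR; ring.
apply: le_trans (_ : npow m.+1 x - npow m.+1 x * (1 - x * (ln m.+1%:R - ln m%:R)) <= _).
  by rewrite lerD2l lerN2 ler_wpM2l ?npow_ge0 // expR_ge1Dx.
rewrite [leLHS](_ : _ = npow m.+1 x * (x * (ln m.+1%:R - ln m%:R))); last by ring.
by rewrite ler_wpM2l ?npow_ge0 // ler_wpM2l.
Qed.

Lemma npow_diffN_le m (x : R) : (0 < m)%N -> 0 <= x ->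
  npow m (- x) - npow m.+1 (- x) <= npow m (- x) * (x * m%:R^-1).
Proof.
move=> m0 x0; have [_ L] := lnS_bounds R m0.
have -> : npow m.+1 (- x) = npow m (- x) * expR (- (x * (ln m.+1%:R - ln m%:R))).
  by rewrite /npow -expRD; congr expR; ring.
apply: le_trans (_ : npow m (- x) - npow m (- x) * (1 - x * (ln m.+1%:R - ln m%:R)) <= _).
  by rewrite lerD2l lerN2 ler_wpM2l ?npow_ge0 // expR_ge1Dx.
rewrite [leLHS](_ : _ = npow m (- x) * (x * (ln m.+1%:R - ln m%:R))); last by ring.
by rewrite ler_wpM2l ?npow_ge0 // ler_wpM2l.
Qed.

(* After Abel summation the weights n^{h-2} - (n+1)^{h-2} are combinations of
   exponentials in [h] with nonnegative Taylor coefficients up to sign. *)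
Lemma dirichlet_pseries (a : nat -> R) (C th : R) : 0 <= th ->
  (forall N, `|\sum_(0 <= k < N.+1) a k| <= C * npow N.+1 th) ->
  exists F b, pseries (2 - th) F b /\ forall h, 0 <= h < 2 - th ->
    (fun n => \sum_(0 <= k < n) a k * npow k.+1 (h - 2)) @ \oo --> F h.
Proof.
move=> th0 aC.
have C0 : 0 <= C.
  have := aC 0%N; rewrite npow1n mulr1; exact: le_trans.
pose S k := \sum_(0 <= j < k.+1) a j.
pose f k h := S k * (npow k.+1 (h - 2) - npow k.+2 (h - 2)).
(* For [n = k.+1], [n^(h-2) - (n+1)^(h-2)] is the first summand of [g] minus the second; the sign
   change to plus makes every Taylor coefficient nonnegative and gives the majorant. *)
pose g k (h : R) := (npow k.+1 (-2) - npow k.+2 (-2)) * expR (ln k.+1%:R * h)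
  + npow k.+2 (-2) * (expR (ln k.+2%:R * h) - expR (ln k.+1%:R * h)).
pose b k h := `|S k| * g k h.
have lnS k : 0 <= ln (k.+1%:R : R) <= ln (k.+2%:R : R).
  by rewrite ln_nat_ge0 /= ler_ln ?posrE ?ltr0n // ler_nat.
have w0 k : 0 <= npow k.+1 (-2) - npow k.+2 (-2) :> R.
  by rewrite subr_ge0; apply: ler_npowlN => //; rewrite oppr_le0.
have expE k (h : R) : expR (ln k.+1%:R * h) = npow k.+1 h by rewrite mulrC.
have PSf k : pseries (2 - th) (f k) (b k).
  apply: pseries_scale; have /andP[l0 _] := lnS k.
  have := pseries_add (pseries_scale (npow k.+1 (-2) - npow k.+2 (-2)) (pseries_expRM (2 - th) l0))
    (pseries_scale (- npow k.+2 (-2)) (pseries_expRB (2 - th) (lnS k))).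
  apply: pseries_ext => h _; last by rewrite normrN (ger0_norm (w0 k)) (ger0_norm (npow_ge0 _ _)).
  by rewrite !expE !npowD; ring.
(* Each summand of [g] is at most [2 n^(h-3)], the factor 2 bounding the exponents [2] and [h].
   Against [|S k| <= C n^th] this leaves the exponent [-1 - (2 - th - h)], summable for
   [h < 2 - th]. *)
have bB h : 0 <= h < 2 - th -> forall k, b k h <= 4 * C * npow k.+1 (- (1 + (2 - th - h))).
  move=> /andP[h0 hr] k; have m0 : (0 < k.+1)%N by [].
  have g1 : g k h <= 4 * npow k.+1 (h - 3).
    have k3 : npow k.+1 (h - 3) = npow k.+1 (h - 2) * k.+1%:R^-1.
      by rewrite -npowN1 // -npowD; congr npow; lra.
    have g2 : (npow k.+1 (-2) - npow k.+2 (-2)) * expR (ln k.+1%:R * h) <= 2 * npow k.+1 (h - 3).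
      rewrite expE; apply: le_trans (_ : (npow k.+1 (-2) * (2 * k.+1%:R^-1)) * npow k.+1 h <= _).
        by rewrite ler_wpM2r ?npow_ge0 // npow_diffN_le.
      by rewrite k3 npowD [leLHS](_ : _ = 2 * (npow k.+1 h * npow k.+1 (-2) * k.+1%:R^-1)) //; ring.
    have g3 : npow k.+2 (-2) * (expR (ln k.+2%:R * h) - expR (ln k.+1%:R * h)) <= 2 * npow k.+1 (h - 3).
      rewrite !expE; apply: le_trans (_ : npow k.+2 (-2) * (npow k.+2 h * (h * k.+1%:R^-1)) <= _).
        by rewrite ler_wpM2l ?npow_ge0 // npow_diff_le.
      rewrite k3 mulrA -npowD mulrCA mulrA; rewrite [leRHS]mulrA.
      rewrite ler_wpM2r ?invr_ge0 //; apply: ler_pM => //; first exact: npow_ge0.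
        by lra.
      by rewrite addrC; apply: ler_npowlN => //; lra.
    by rewrite /g; lra.
  apply: le_trans (_ : (C * npow k.+1 th) * (4 * npow k.+1 (h - 3)) <= _).
    apply: ler_pM => //; last exact: aC.
    rewrite /g; apply: addr_ge0; apply: mulr_ge0;
      [exact: w0|exact: expR_ge0|exact: npow_ge0|].
    by rewrite !expE subr_ge0 ler_npowl.
  rewrite [leLHS](_ : _ = 4 * C * (npow k.+1 th * npow k.+1 (h - 3))); last by ring.
  by rewrite -npowD; apply: ler_wpM2l; [rewrite mulr_ge0|apply: ler_npow; lra].
have bS h : 0 <= h < 2 - th -> forall n, \sum_(0 <= k < n) b k h <= 4 * C * (1 + (2 - th - h)^-1).
  move=> hr n; apply: le_trans (_ : \sum_(0 <= k < n) 4 * C * npow k.+1 (- (1 + (2 - th - h))) <= _).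
    by apply: ler_sum => k _; exact: bB.
  rewrite -mulr_sumr ler_wpM2l ?mulr_ge0 // npow_sum_bound //.
  by case/andP: hr => ? ?; lra.
have cvgf h : 0 <= h < 2 - th -> exists e : R, (fun n => \sum_(0 <= k < n) f k h) @ \oo --> e.
  move=> hr; suff /cvg_ex[e He] : cvgn (fun n => \sum_(0 <= k < n) f k h) by exists e.
  apply: (@series_cvg_bounded _ _ (4 * C * (1 + (2 - th - h)^-1))) => n.
  apply: le_trans (bS _ hr n); apply: ler_sum => k _; exact: pseries_le (PSf k) hr.
pose F h := limn (fun n => \sum_(0 <= k < n) f k h).
have FP h : 0 <= h < 2 - th -> (fun n => \sum_(0 <= k < n) f k h) @ \oo --> F h.
  by move=> /cvgf[e He]; rewrite /F (cvg_lim _ He).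
exists F, (fun h => 4 * C * (1 + (2 - th - h)^-1)); split; first exact: pseries_sum PSf bS FP.
move=> h hr; under eq_fun do rewrite (abel_summation a (fun k => npow k.+1 (h - 2))).
rewrite -[F h]addr0; apply: cvgD; first exact: FP.
(* The boundary term of Abel summation is at most [C n^th (n+1)^(h-2)] and tends to 0; the shift
   skips the empty sum, which [aC] does not cover. *)
apply/(cvgn_shift _ _ 1).
apply/norm_cvg0P.
apply: (@squeeze_cvgr _ _ _ _ (fun=> 0) (fun n => C * npow n.+2 (- (2 - th - h)))).
- near=> n; rewrite normr_ge0 /= normrM (ger0_norm (npow_ge0 _ _)) addn1.
  apply: le_trans (_ : C * npow n.+1 th * npow n.+2 (h - 2) <= _).
    by rewrite ler_wpM2r ?npow_ge0.
  rewrite -mulrA ler_wpM2l // (_ : - (2 - th - h) = th + (h - 2)); last by lra.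
  by rewrite [leRHS]npowD ler_wpM2r ?npow_ge0 // ler_npowl.
- exact: cvg_cst.
- rewrite -(mulr0 C); apply: cvgM; first exact: cvg_cst.
  have d0 : 0 < 2 - th - h by case/andP: hr => ? ?; lra.
  have /(cvgn_shift _ _ 1) := npow_cvg0 d0.
  by under eq_fun do rewrite addn1.
Unshelve. all: by end_near.
Qed.

End Abel.

(** * The real logarithm series 2 Re sum z^k / k *)

Section LogSeries.
Variable R : realType.
Implicit Types (x y : R).

Lemma is_derive1D (f g : R -> R) (x a b : R) :
  is_derive x 1 f a -> is_derive x 1 g b -> is_derive x 1 (fun y => f y + g y) (a + b).
Proof. exact: is_deriveD. Qed.

Lemma is_derive1B (f g : R -> R) (x a b : R) :
  is_derive x 1 f a -> is_derive x 1 g b -> is_derive x 1 (fun y => f y - g y) (a - b).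
Proof. exact: is_deriveB. Qed.

Lemma is_derive1M (f g : R -> R) (x a b : R) :
  is_derive x 1 f a -> is_derive x 1 g b ->
  is_derive x 1 (fun y => f y * g y) (f x * b + g x * a).
Proof. exact: is_deriveM. Qed.

Lemma is_derive1Z (c : R) (f : R -> R) (x a : R) :
  is_derive x 1 f a -> is_derive x 1 (fun y => c * f y) (c * a).
Proof. exact: is_deriveZ. Qed.

Lemma is_derive1_pow n (x : R) : is_derive x 1 (fun y => y ^+ n.+1) (n.+1%:R * x ^+ n).
Proof.
elim: n => [|n IH].
  rewrite (_ : (fun y => y ^+ 1) = id) ?funeqE // expr0 mulr1; exact: is_derive_id.
rewrite (_ : (fun y => y ^+ n.+2) = (fun y => y * y ^+ n.+1)) ?funeqE => [|y]; last by rewrite exprS.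
apply: is_derive_eq (is_derive1M (is_derive_id x 1) IH) _.
by rewrite -(natr1 n.+1) exprS; ring.
Qed.

Lemma is_derive1_comp (f g : R -> R) (x a b : R) :
  is_derive x 1 f a -> is_derive (f x) 1 g b -> is_derive x 1 (fun y => g (f y)) (b * a).
Proof.
move=> [df fa] [dg gb].
have d : derivable (g \o f) x 1.
  by apply/derivable1_diffP; apply: differentiable_comp; exact/derivable1_diffP.
have E := derive1_comp df dg; rewrite !derive1E fa gb in E.
exact: DeriveDef d E.
Qed.

Lemma is_derive1_sum (u du : nat -> R -> R) (x : R) n :
  (forall k, is_derive x 1 (u k) (du k x)) ->
  is_derive x 1 (fun y => \sum_(0 <= k < n) u k y) (\sum_(0 <= k < n) du k x).
Proof.
move=> H; elim: n => [|n IH].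
  rewrite big_geq // (_ : (fun _ => _) = cst 0) ?funeqE => [|y]; last by rewrite big_geq.
  exact: is_derive_cst.
rewrite big_nat_recr //= (_ : (fun _ => _) =
  (fun y => \sum_(0 <= k < n) u k y + u n y)) ?funeqE => [|y]; last by rewrite big_nat_recr.
exact: is_derive1D.
Qed.

Lemma MVT_le (f df : R -> R) (a b K : R) : a <= b ->
  (forall x, a <= x <= b -> is_derive x 1 f (df x)) ->
  (forall x, a <= x <= b -> `|df x| <= K) -> `|f b - f a| <= K * (b - a).
Proof.
move=> ab fd dK.
have [||c cab ->] := @MVT_segment _ f df a b ab.
- by move=> x; rewrite in_itv /= => /andP[ax xb]; apply: fd; rewrite !ltW.
- apply: derivable_within_continuous => x; rewrite in_itv /= => /fd[]//.
rewrite normrM (ger0_norm (_ : 0 <= b - a)) ?subr_ge0 // ler_wpM2r ?subr_ge0 //.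
by apply: dK; move: cab; rewrite in_itv.
Qed.

(** Real part of a finite geometric series with ratio [z = r e^{i ph}], cleared of its denominator
    [|1 - z|^2]. *)
Lemma poisson_kernel_sum (ph r : R) n :
  (1 - 2 * r * cos ph + r ^+ 2) * \sum_(0 <= k < n) cos (k.+1%:R * ph) * r ^+ k =
  cos ph - r - r ^+ n * cos (n.+1%:R * ph) + r ^+ n.+1 * cos (n%:R * ph).
Proof.
elim: n => [|n IH]; first by rewrite big_geq // (_ : 0%:R * ph = 0) ?mul0r //
  (_ : 1%:R * ph = ph) ?mul1r // cos0; ring.
rewrite big_nat_recr //= mulrDr IH.
have -> : cos (n.+2%:R * ph) = 2 * cos ph * cos (n.+1%:R * ph) - cos (n%:R * ph).
  have -> : n.+2%:R * ph = n.+1%:R * ph + ph by rewrite -(natr1 n.+1); ring.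
  have -> : n%:R * ph = n.+1%:R * ph - ph by rewrite -(natr1 n); ring.
  by rewrite cosD cosB; ring.
by rewrite !exprS; ring.
Qed.

Lemma quadratic_ge (ph r : R) : 0 <= r -> (1 - r) ^+ 2 <= 1 - 2 * r * cos ph + r ^+ 2.
Proof.
move=> r0; have := cos_le1 ph => c1.
by have := ler_wpM2l r0 c1; rewrite !expr2; lra.
Qed.

(** The identity [-2 log |1 - z| = 2 Re sum z^k / k] for [z = r e^{i ph}]. By [poisson_kernel_sum]
    the partial sum plus [ln Q] has a derivative of order [r^n] on [[0, r]]; both vanish at 0, so
    the mean value theorem bounds the error. *)
Lemma log_series (ph r : R) : 0 <= r < 1 ->
  (fun n => \sum_(0 <= k < n) 2 * cos (k.+1%:R * ph) / k.+1%:R * r ^+ k.+1) @ \oo -->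
  - ln (1 - 2 * r * cos ph + r ^+ 2).
Proof.
move=> /andP[r0 r1].
pose Q (x : R) := 1 - 2 * x * cos ph + x ^+ 2.
pose P n (x : R) := \sum_(0 <= k < n) 2 * cos (k.+1%:R * ph) / k.+1%:R * x ^+ k.+1.
have dP n x : is_derive x 1 (P n) (2 * \sum_(0 <= k < n) cos (k.+1%:R * ph) * x ^+ k).
  rewrite mulr_sumr.
  apply: (@is_derive1_sum _ (fun k x => 2 * (cos (k.+1%:R * ph) * x ^+ k))) => k.
  apply: is_derive_eq (is_derive1Z _ (is_derive1_pow k x)) _.
  have k0 : k.+1%:R != 0 :> R by rewrite pnatr_eq0.
  by field.
have Q0 x : 0 <= x <= r -> 0 < Q x.
  move=> /andP[x0 xr]; apply: lt_le_trans (quadratic_ge ph x0); apply: exprn_gt0; lra.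
have dQ x : is_derive x 1 Q (2 * x - 2 * cos ph).
  rewrite /Q; apply: is_derive_eq
    (is_derive1D (is_derive1B (is_derive_cst (1 : R) x 1)
       (is_derive1M (is_derive1Z 2 (is_derive_id x 1)) (is_derive_cst (cos ph) x 1)))
       (is_derive1_pow 1 x)) _.
  by rewrite expr1 /=; ring.
have dl x : 0 <= x <= r -> is_derive x 1 (fun y => ln (Q y)) ((Q x)^-1 * (2 * x - 2 * cos ph)).
  by move=> xr; apply: is_derive1_comp (dQ x) (is_derive1_ln (Q0 _ xr)).
pose dF n x := 2 * (x ^+ n.+1 * cos (n%:R * ph) - x ^+ n * cos (n.+1%:R * ph)) / Q x.
have dPl n x : 0 <= x <= r -> is_derive x 1 (fun y => P n y + ln (Q y)) (dF n x).
  move=> xr; apply: is_derive_eq (is_derive1D (dP n x) (dl x xr)) _.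
  have q0 : Q x != 0 by rewrite gt_eqF // Q0.
  have := poisson_kernel_sum ph x n; rewrite -/(Q x) /dF => K.
  apply: (mulIf q0); rewrite mulfVK // mulrDl [2 * _ * Q x]mulrAC -mulrA.
  rewrite [_^-1 * _ * _]mulrAC mulVf // mul1r.
  by rewrite K; ring.
have dFle n x : 0 <= x <= r -> `|dF n x| <= 4 / (1 - r) ^+ 2 * r ^+ n.
  move=> xr; have /andP[x0 xr'] := xr; have r10 : 0 < (1 - r) ^+ 2 by apply: exprn_gt0; lra.
  have Qr : (1 - r) ^+ 2 <= Q x.
    apply: le_trans (quadratic_ge ph x0); apply: lerXn2r; rewrite ?nnegrE; lra.
  rewrite /dF normrM normfV (gtr0_norm (Q0 _ xr)) mulrAC.
  apply: ler_pM => //; last by rewrite lef_pV2 // ?posrE ?Q0.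
    by rewrite invr_ge0 ltW ?Q0.
  have xn : x ^+ n <= r ^+ n by apply: lerXn2r.
  have xn0 : 0 <= x ^+ n by apply: exprn_ge0.
  have xn1 : x ^+ n.+1 <= x ^+ n by rewrite exprS ler_piMl //; lra.
  have xn2 : 0 <= x ^+ n.+1 by apply: exprn_ge0.
  have := cos_max (n%:R * ph); have := cos_max (n.+1%:R * ph).
  move: (cos _) (cos _) => c c' c1 c2.
  rewrite normrM (ger0_norm (_ : 0 <= 2)) //.
  apply: le_trans (_ : 2 * (x ^+ n + x ^+ n) <= _); last by lra.
  rewrite ler_wpM2l //; apply: le_trans (ler_normB _ _) _.
  rewrite !normrM (ger0_norm xn0) (ger0_norm xn2); apply: lerD.
    by apply: le_trans xn1; rewrite ler_piMr.
  by rewrite ler_piMr.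
have key n : `|P n r - - ln (Q r)| <= 4 / (1 - r) ^+ 2 * r * r ^+ n.
  have := @MVT_le (fun y => P n y + ln (Q y)) (dF n) 0 r _ r0 (dPl n) (dFle n).
  have P0 : P n 0 = 0 by rewrite /P; apply: big1 => k _; rewrite exprS mul0r mulr0.
  have Q1 : Q 0 = 1 by rewrite /Q expr0n mulr0 mul0r subr0 addr0.
  by rewrite P0 Q1 ln1 addr0 !subr0 opprK mulrAC.
apply/cvgn_distP => e e0.
have : (fun n => 4 / (1 - r) ^+ 2 * r * r ^+ n) @ \oo --> 4 / (1 - r) ^+ 2 * r * 0.
  by apply: cvgM; [exact: cvg_cst|apply: cvg_expr; rewrite ger0_norm].
rewrite mulr0 => /cvgn_distP/(_ e e0)[N HN]; exists N => n /HN; rewrite subr0 => H.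
exact: le_trans (key n) (le_trans (ler_norm _) H).
Qed.

End LogSeries.

(** * Complex limits by components, and the squared modulus *)

Section ComplexLimits.
Variable R : realType.
Implicit Types (z w l : R[i]) (u v : nat -> R[i]).
Local Notation Re := complex.Re.
Local Notation Im := complex.Im.

Lemma Re_mul z w : Re (z * w) = Re z * Re w - Im z * Im w.
Proof. by case: z; case: w. Qed.
Lemma Im_mul z w : Im (z * w) = Re z * Im w + Im z * Re w.
Proof. by case: z => a b; case: w => c d /=. Qed.
Lemma Re_add z w : Re (z + w) = Re z + Re w.
Proof. by case: z; case: w. Qed.
Lemma Im_add z w : Im (z + w) = Im z + Im w.
Proof. by case: z; case: w. Qed.
Lemma Re_opp z : Re (- z) = - Re z.
Proof. by case: z. Qed.
Lemma Im_opp z : Im (- z) = - Im z.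
Proof. by case: z. Qed.
Lemma Re_sum I (r : seq I) (P : pred I) (F : I -> R[i]) :
  Re (\sum_(i <- r | P i) F i) = \sum_(i <- r | P i) Re (F i).
Proof. by elim/big_rec2: _ => //= i x y _ <-; rewrite Re_add. Qed.
Lemma Im_sum I (r : seq I) (P : pred I) (F : I -> R[i]) :
  Im (\sum_(i <- r | P i) F i) = \sum_(i <- r | P i) Im (F i).
Proof. by elim/big_rec2: _ => //= i x y _ <-; rewrite Im_add. Qed.
Lemma Re_scale (a : R) z : Re (a%:C%C * z) = a * Re z.
Proof. by rewrite Re_mul /= mul0r subr0. Qed.
Lemma Im_scale (a : R) z : Im (a%:C%C * z) = a * Im z.
Proof. by rewrite Im_mul /= mul0r addr0. Qed.

(** Componentwise, in the form of [L_zero]. *)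
Definition clim u l := ((fun n => Re (u n)) @ \oo --> Re l) /\
                       ((fun n => Im (u n)) @ \oo --> Im l).

Lemma clim_cst l : clim (fun=> l) l.
Proof. by split; exact: cvg_cst. Qed.

Lemma climD u v l l' : clim u l -> clim v l' -> clim (fun n => u n + v n) (l + l').
Proof.
move=> [a b] [c d]; split; [rewrite Re_add|rewrite Im_add];
  [under eq_fun do rewrite Re_add|under eq_fun do rewrite Im_add]; exact: cvgD.
Qed.

Lemma climN u l : clim u l -> clim (fun n => - u n) (- l).
Proof.
move=> [a b]; split; [rewrite Re_opp|rewrite Im_opp];
  [under eq_fun do rewrite Re_opp|under eq_fun do rewrite Im_opp]; exact: cvgN.
Qed.

Lemma climB u v l l' : clim u l -> clim v l' -> clim (fun n => u n - v n) (l - l').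
Proof. by move=> a b; apply: climD => //; exact: climN. Qed.

Lemma climM u v l l' : clim u l -> clim v l' -> clim (fun n => u n * v n) (l * l').
Proof.
move=> [a b] [c d]; split; [rewrite Re_mul|rewrite Im_mul];
  [under eq_fun do rewrite Re_mul|under eq_fun do rewrite Im_mul].
  by apply: cvgB; exact: cvgM.
by apply: cvgD; exact: cvgM.
Qed.

Lemma climZ z u l : clim u l -> clim (fun n => z * u n) (z * l).
Proof. by apply: climM; exact: clim_cst. Qed.

Lemma cvgn_dist_le (u : nat -> R) (l c B : R) : u @ \oo --> l ->
  (forall n, `|u n - c| <= B) -> `|l - c| <= B.
Proof.
move=> ul H; have uc : (fun n => u n - c) @ \oo --> l - c.
  by apply: cvgB => //; exact: cvg_cst.
exact: limn_leP (cvg_norm uc) H.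
Qed.

Lemma cvgn_continuous (g : R -> R) (u : nat -> R) (l : R) : continuous g ->
  u @ \oo --> l -> (fun n => g (u n)) @ \oo --> g l.
Proof. by move=> cg ul; exact: (@cvg_comp _ _ _ u g _ _ _ ul (cg l)). Qed.

Lemma cvgn_comp_div (u : nat -> R) (l : R) k : (0 < k)%N ->
  u @ \oo --> l -> (fun n => u (n %/ k)%N) @ \oo --> l.
Proof.
move=> k0 /cvgn_distP H; apply/cvgn_distP => e /H[N HN]; exists (N * k)%N => n Nn.
by apply: HN; rewrite leq_divRL.
Qed.

Lemma clim_comp_div u l k : (0 < k)%N -> clim u l -> clim (fun n => u (n %/ k)%N) l.
Proof. move=> k0 [a b]; split; first exact: (cvgn_comp_div k0 a).
exact: (cvgn_comp_div k0 b). Qed.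

(** The squared modulus stays in [R] and is multiplicative, so its logarithm can be summed over
    primes. *)
Definition sqnorm z : R := Re z ^+ 2 + Im z ^+ 2.

Lemma sqnormM z w : sqnorm (z * w) = sqnorm z * sqnorm w.
Proof. rewrite /sqnorm Re_mul Im_mul; ring. Qed.
Lemma sqnorm1 : sqnorm 1 = 1.
Proof. by rewrite /sqnorm /= expr1n expr0n addr0. Qed.
Lemma sqnorm_ge0 z : 0 <= sqnorm z.
Proof. by rewrite addr_ge0 // sqr_ge0. Qed.
Lemma sqnorm_prod I (r : seq I) (P : pred I) (F : I -> R[i]) :
  sqnorm (\prod_(i <- r | P i) F i) = \prod_(i <- r | P i) sqnorm (F i).
Proof. by elim/big_rec2: _ => [|i x y _ <-]; rewrite ?sqnorm1 ?sqnormM. Qed.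
Lemma Re_le_sqnorm z : sqnorm z <= 1 -> `|Re z| <= 1.
Proof.
move=> H; rewrite -(@ler_pXn2r _ 2) ?nnegrE // expr1n real_normK ?num_real //.
by apply: le_trans H; rewrite lerDl sqr_ge0.
Qed.
Lemma Im_le_sqnorm z : sqnorm z <= 1 -> `|Im z| <= 1.
Proof.
move=> H; rewrite -(@ler_pXn2r _ 2) ?nnegrE // expr1n real_normK ?num_real //.
by apply: le_trans H; rewrite lerDr sqr_ge0.
Qed.
Lemma sqnorm_lim u l : clim u l -> (fun n => sqnorm (u n)) @ \oo --> sqnorm l.
Proof.
move=> [a b]; rewrite /sqnorm; under eq_fun do rewrite !expr2.
by rewrite !expr2; apply: cvgD; exact: cvgM.
Qed.

End ComplexLimits.

(** * Integers free of small prime factors *)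

Section Rough.

(** Recursion on [k] makes one step of the sieve of Eratosthenes definitional; a composite [k]
    changes nothing. *)
Fixpoint rough (k n : nat) : bool :=
  if k is j.+1 then rough j n && ~~ (prime k && (k %| n)%N) else true.

Lemma roughP k n : reflect (forall p, prime p -> (p <= k)%N -> ~~ (p %| n)%N) (rough k n).
Proof.
elim: k => [|k IH] /=.
  by apply: ReflectT => p /prime_gt0; rewrite leqn0; case: p.
apply: (iffP andP) => [[/IH H1 H2] p pp | H].
  rewrite leq_eqVlt => /predU1P[E|]; last exact: H1.
  by move: H2; rewrite -E pp.
split; first by apply/IH => p pp pk; apply: H => //; exact: leqW.
by apply/negP => /andP[pp]; apply/negP; exact: H.
Qed.

Lemma rough_mul j m : prime j.+1 -> rough j (j.+1 * m) = rough j m.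
Proof.
move=> pj; apply/roughP/roughP => H p pp pj'; have := H p pp pj'; rewrite Euclid_dvdM //.
  by case/norP.
move=> H'; rewrite negb_or H' andbT dvdn_prime2 //.
by apply: contraTN pj' => /eqP ->; rewrite ltnn.
Qed.

Lemma rough_small k n : (1 < n)%N -> (n <= k)%N -> rough k n = false.
Proof.
move=> n1 nk; apply/negP => /roughP/(_ (pdiv n) (pdiv_prime n1)).
rewrite pdiv_dvd => H; have := H (leq_trans (pdiv_leq (ltnW n1)) nk); done.
Qed.

Lemma sum_multiples (V : nmodType) (P : pred nat) (F : nat -> V) k N : (0 < k)%N ->
  \sum_(1 <= n < N.+1 | P n && (k %| n)%N) F n =
  \sum_(1 <= m < (N %/ k).+1 | P (k * m)%N) F (k * m)%N.
Proof.
move=> k0; elim: N => [|N IH]; first by rewrite div0n !big_geq.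
rewrite big_mkcond big_nat_recr //= -big_mkcond IH divnS //.
case: (boolP (k %| N.+1)%N) => kN; last by rewrite andbF addr0.
rewrite andbT add1n; case/dvdnP: kN => m mk.
have -> : (N %/ k)%N = m.-1.
  have m0 : (0 < m)%N by case: m mk.
  have := divnS N k0; rewrite mk mulnK // dvdn_mull // add1n => ->.
  by [].
have m0 : (0 < m)%N by case: m mk.
rewrite prednK // [RHS]big_mkcond big_nat_recr //= -?big_mkcond.
by rewrite mk [(k * m)%N]mulnC.
Qed.

End Rough.

(** * Euler product *)

Section EulerProduct.
Variables (R : realType) (X : nat -> R[i]) (sg : R).
Hypothesis X1 : X 1 = 1.
Hypothesis XM : forall m n, (0 < m)%N -> (0 < n)%N -> X (m * n)%N = X m * X n.
Hypothesis X_le1 : forall n, sqnorm (X n) <= 1.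
Hypothesis sg1 : 1 < sg.
Local Notation Re := complex.Re.
Local Notation Im := complex.Im.

Let f n : R[i] := (npow n (- sg))%:C%C * X n.
Let T k N := \sum_(1 <= n < N.+1 | rough k n) f n.

Let fM m n : (0 < m)%N -> (0 < n)%N -> f (m * n)%N = f m * f n.
Proof.
move=> m0 n0; rewrite /f npowM // XM // rmorphM /=; ring.
Qed.

Let f1 : f 1 = 1.
Proof. by rewrite /f npow1n X1 mulr1. Qed.

Let Ref n : `|Re (f n)| <= npow n (- sg).
Proof.
rewrite /f Re_scale normrM (ger0_norm (npow_ge0 _ _)) ler_piMr ?npow_ge0 //.
exact: Re_le_sqnorm.
Qed.

Let Imf n : `|Im (f n)| <= npow n (- sg).
Proof.
rewrite /f Im_scale normrM (ger0_norm (npow_ge0 _ _)) ler_piMr ?npow_ge0 //.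
exact: Im_le_sqnorm.
Qed.

(** The [j]-rough multiples of a prime [j.+1] are its products with arbitrary [j]-rough integers,
    and [f] is multiplicative; hence the cutoff [N %/ j.+1]. *)
Let T_step j N : T j.+1 N =
  T j N - (if prime j.+1 then f j.+1 * T j (N %/ j.+1) else 0).
Proof.
rewrite /T /=; case: (boolP (prime j.+1)) => pj /=; last first.
  by rewrite subr0; apply: eq_bigl => n; rewrite andbT.
rewrite [X in _ = X - _](bigID (fun n => (j.+1 %| n)%N)) /= addrC -addrA.
rewrite (sum_multiples (rough j) f N (ltn0Sn j)).
rewrite [X in _ = _ + (X - _)](_ : _ = f j.+1 * T j (N %/ j.+1)) ?subrr ?addr0 //.
rewrite /T mulr_sumr; rewrite big_mkcond [RHS]big_mkcond !big_nat.
apply: eq_bigr => m /andP[m0 _]; rewrite rough_mul //; case: ifP => // _.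
by rewrite fM.
Qed.

(* Sieving by the primes up to [k] multiplies the Dirichlet series [l] by the
   corresponding Euler factors. *)
Let lk (l : R[i]) k := l * \prod_(1 <= p < k.+1 | prime p) (1 - f p).

Let T_lim l : clim (T 0) l -> forall k, clim (T k) (lk l k).
Proof.
move=> H; elim=> [|k IH]; first by rewrite /lk big_geq // mulr1.
have -> : lk l k.+1 = lk l k - (if prime k.+1 then f k.+1 * lk l k else 0).
  rewrite /lk big_mkcond big_nat_recr //= -big_mkcond /=.
  by case: ifP => _; ring.
rewrite (_ : T k.+1 = fun N => T k N - (if prime k.+1 then f k.+1 * T k (N %/ k.+1) else 0)).
  apply: climB => //; case: ifP => _; last exact: clim_cst.
  by apply: climZ; exact: clim_comp_div.
by apply/funext => N; exact: T_step.
Qed.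

(** A [k]-rough integer [n >= 2] exceeds [k], so the sum is part of the tail of a convergent series,
    uniformly in [N]. *)
Let tail e : 0 < e -> exists J, forall k N, (J <= k)%N ->
  \sum_(2 <= n < N.+1 | rough k n) npow n (- sg) <= e.
Proof.
move=> e0; have d0 : 0 < sg - 1 by rewrite subr_gt0.
have [|n|J HJ] := @series_tail R (fun j => npow j.+1 (- sg)) (1 + (sg - 1)^-1) _ _ _ e0.
- by move=> j; exact: npow_ge0.
- by have := npow_sum_bound d0 n; rewrite (_ : 1 + (sg - 1) = sg) //; lra.
exists J => k N Jk.
apply: le_trans (_ : \sum_(0 <= j < N) (if (k <= j)%N then npow j.+1 (- sg) else 0) <= _).
  rewrite big_mkcond big_add1 /=.
  case: N => [|N]; first by rewrite !big_geq.
  rewrite [leRHS]big_ltn // -[leLHS]add0r; apply: lerD.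
    by case: ifP => _ //; exact: npow_ge0.
  rewrite !big_nat; apply: ler_sum => j /andP[j0 _].
  have [kj|jk] := leqP k j; first by case: ifP => _ //; exact: npow_ge0.
  by rewrite rough_small.
have [NJ|JN] := leqP N J.
  rewrite big_nat big1 ?ltW // => j /andP[_ jN].
  by rewrite leqNgt (leq_trans jN (leq_trans NJ Jk)).
rewrite (big_cat_nat (n := J)) //=; last exact: ltnW.
rewrite big_nat big1 ?add0r; last first.
  by move=> j /andP[_ jN]; rewrite leqNgt (leq_trans jN Jk).
apply: le_trans (HJ N); apply: ler_sum => j _; case: ifP => // _; exact: npow_ge0.
Qed.

(** After sieving, only the term [n = 1] survives besides a tail that vanishes as [k] grows. *)
Let lk_lim l : clim (T 0) l -> clim (lk l) 1.
Proof.
move=> H.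
have T1 k N : T k N.+1 = 1 + \sum_(2 <= n < N.+2 | rough k n) f n.
  rewrite /T big_mkcond big_ltn // -big_mkcond f1 ifT //; apply/roughP => p pp _.
  by rewrite dvdn1; apply: contraTneq pp => ->.
split; apply/cvgn_distP => e e0; have [J HJ] := tail e0; exists J => k Jk.
- have [/(cvgn_shift _ _ 1) Hk _] := T_lim H k.
  apply: (cvgn_dist_le Hk) => N /=.
  rewrite addn1 T1 Re_add addrC addKr Re_sum; apply: le_trans (HJ k N.+1 Jk).
  apply: le_trans (ler_norm_sum _ _ _) _; exact: ler_sum.
- have [_ /(cvgn_shift _ _ 1) Hk] := T_lim H k.
  apply: (cvgn_dist_le Hk) => N /=.
  rewrite addn1 T1 Im_add add0r subr0 Im_sum; apply: le_trans (HJ k N.+1 Jk).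
  apply: le_trans (ler_norm_sum _ _ _) _; exact: ler_sum.
Qed.

Lemma euler_factor_sqnorm_gt0 p : prime p -> 0 < sqnorm (1 - f p).
Proof.
move=> pp; apply: (@lt_le_trans _ _ ((1 - Re (f p)) ^+ 2)); last first.
  by rewrite /sqnorm Re_add Re_opp /= lerDl sqr_ge0.
apply: exprn_gt0; rewrite subr_gt0; apply: le_lt_trans (ler_norm _) _.
apply: le_lt_trans (Ref p) _; rewrite /npow expR_lt1 mulNr oppr_lt0.
by rewrite mulr_gt0 ?ln_gt0 ?ltr1n ?prime_gt1 //; apply: lt_trans sg1.
Qed.

(** The sieved value tends to 1, while its squared modulus is [sqnorm l] times the exponential of a
    sum tending to [- G]; only real logarithms enter. *)
Lemma euler_product l G : clim (fun N => \sum_(1 <= n < N.+1) f n) l ->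
  (fun N => \sum_(1 <= p < N.+1 | prime p) - ln (sqnorm (1 - f p))) @ \oo --> G ->
  sqnorm l = expR G.
Proof.
move=> Hl HG.
have := sqnorm_lim (lk_lim (l := l) Hl); rewrite sqnorm1 => H1.
have H2 : (fun k => sqnorm (lk l k)) @ \oo --> sqnorm l * expR (- G).
  rewrite (_ : (fun k => _) = (fun k => sqnorm l *
     expR (- \sum_(1 <= p < k.+1 | prime p) - ln (sqnorm (1 - f p))))).
    apply: cvgM; first exact: cvg_cst.
    by apply: (cvgn_continuous (@continuous_expR R)); exact: cvgN.
  apply/funext => k; rewrite sqnormM sqnorm_prod; congr (_ * _).
  rewrite -sumrN expR_sum; apply: eq_bigr => p pp.
  by rewrite opprK lnK // posrE euler_factor_sqnorm_gt0.
have E := cvgn_uniq H2 H1; have e0 : expR G != 0 by rewrite expR_eq0.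
by rewrite -[LHS](mulfVK e0) -expRN E mul1r.
Qed.

End EulerProduct.

(** * Nonvanishing to the right of the abscissa given by the bounds *)

Section NonVanishing.
Variable R : realType.
Implicit Types (h : R).
Local Notation Re := complex.Re.
Local Notation Im := complex.Im.

Lemma sqnorm_polar (rh ph : R) (z : R[i]) : z = rh%:C%C * Complex (cos ph) (sin ph) ->
  sqnorm (1 - z) = 1 - 2 * rh * cos ph + rh ^+ 2.
Proof.
move=> ->; rewrite /sqnorm !Re_add !Im_add !Re_opp !Im_opp !Re_scale !Im_scale /=.
have E : rh ^+ 2 = rh ^+ 2 * (cos ph ^+ 2 + sin ph ^+ 2) by rewrite cos2Dsin2 mulr1.
by rewrite [in RHS]E; ring.
Qed.

Lemma geometric_bound (rh : R) n : 0 <= rh <= 3 / 4 ->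
  \sum_(0 <= j < n) rh ^+ j.+2 <= 4 * rh ^+ 2.
Proof.
move=> /andP[r0 r1].
have E : (\sum_(0 <= j < n) rh ^+ j.+2) * (1 - rh) = rh ^+ 2 - rh ^+ n.+2.
  elim: n => [|n IH]; first by rewrite big_geq // mul0r subrr.
  by rewrite big_nat_recr //= mulrDl IH !exprS; ring.
have S0 : 0 <= \sum_(0 <= j < n) rh ^+ j.+2 by apply: sumr_ge0 => j _; exact: exprn_ge0.
have rn : 0 <= rh ^+ n.+2 by exact: exprn_ge0.
have : (\sum_(0 <= j < n) rh ^+ j.+2) * (1 / 4) <= (\sum_(0 <= j < n) rh ^+ j.+2) * (1 - rh).
  by apply: ler_wpM2l => //; lra.
by rewrite E; lra.
Qed.

(** In this range [p^(h-2) <= p^(-1/2)], whose square is at most [1/2 < (3/4)^2]; staying away from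
    1 keeps the geometric sums uniform in [p]. *)
Lemma npow_prime_le p (th h : R) : (1 < p)%N -> 1 / 2 <= th -> h <= 2 - th ->
  0 <= npow p (h - 2) <= 3 / 4.
Proof.
move=> p1 t2 ht; rewrite npow_ge0 /=.
have : npow p (h - 2) ^+ 2 <= (3 / 4) ^+ 2 :> R.
  rewrite expr2 -npowD; apply: le_trans (_ : npow p (-1) <= _).
    by apply: ler_npow; lra.
  rewrite npowN1 ?(ltnW p1) //; apply: le_trans (_ : 2^-1 <= _); last by lra.
  by rewrite lef_pV2 ?posrE ?ltr0n ?(ltnW p1) // ler_nat.
by rewrite ler_pXn2r // nnegrE ?npow_ge0 //; lra.
Qed.

(** What is left of [log_series] for an Euler factor once the linear term is removed. Every
    remaining power [p^((j+2)(h-2))] is a positive constant times an exponential in [h], hence its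
    own majorant, and their sum is quadratic in [p^(h-2)], so summable over [p] for [h < 3/2]. *)
Lemma pseries_euler_factor p (th ph : R) : (1 < p)%N -> 1 / 2 <= th ->
  pseries (2 - th) (fun h => - ln (1 - 2 * npow p (h - 2) * cos ph + npow p (h - 2) ^+ 2)
                        - 2 * cos ph * npow p (h - 2))
     (fun h => 4 * npow p (h - 2) ^+ 2).
Proof.
move=> p1 t2.
pose c (j : nat) : R := 2 * cos (j.+2%:R * ph) / j.+2%:R.
have npE j h : npow p (h - 2) ^+ j.+2 = npow p (- 2) ^+ j.+2 * expR (j.+2%:R * ln p%:R * h).
  by rewrite npowD exprMn mulrC; congr (_ * _); rewrite /npow -expRM_natl; congr expR; ring.
have cle j : `|c j| <= 1.
  rewrite /c normrM normfV (ger0_norm (ler0n _ _)) ler_pdivrMr ?ltr0n // mul1r.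
  rewrite normrM (ger0_norm (_ : 0 <= 2)) //.
  apply: le_trans (_ : 2 * 1 <= _); first by rewrite ler_wpM2l // cos_max.
  by rewrite mulr1 ler_nat.
apply: (@pseries_sum _ _ (fun j h => c j * npow p (h - 2) ^+ j.+2)
  (fun j h => npow p (h - 2) ^+ j.+2)).
- move=> j; have l0 : 0 <= j.+2%:R * ln (p%:R : R) by rewrite mulr_ge0 // ln_nat_ge0.
  have := pseries_scale (c j * npow p (- 2) ^+ j.+2) (pseries_expRM (2 - th) l0).
  apply: pseries_ext => h _; first by rewrite npE mulrA.
  rewrite npE normrM (ger0_norm (exprn_ge0 _ (npow_ge0 _ _))) -[leLHS]mulrA; apply: ler_piMl => //.
  by rewrite mulr_ge0 ?expR_ge0 // exprn_ge0 // npow_ge0.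
- move=> h /andP[h0 hr] n; apply: geometric_bound; apply: npow_prime_le p1 t2 (ltW hr).
- move=> h /andP[h0 hr].
  have /andP[r0 r1] := npow_prime_le p1 t2 (ltW hr).
  have r01 : 0 <= npow p (h - 2) < 1 by rewrite r0 /=; lra.
  have /(cvgn_shift _ _ 1) L := @log_series _ ph _ r01.
  rewrite (_ : (fun n => _) = (fun n =>
    (\sum_(0 <= k < n + 1) 2 * cos (k.+1%:R * ph) / k.+1%:R * npow p (h - 2) ^+ k.+1)
    - 2 * cos ph * npow p (h - 2))).
    by apply: cvgB => //; exact: cvg_cst.
  apply/funext => n; rewrite addn1 big_nat_recl //= mul1r divr1 expr1.
  by rewrite addrAC subrr add0r.
Qed.

(** Meant for [X n = chi(n) n^{-i ga}]. Over primes a bound on the real part suffices, since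
    [log |L|^2] involves nothing else to first order; [1/2 < th] makes the higher order terms
    converge on all of [[0, 2 - th)]. *)
Lemma dirichlet_series_nonvanishing (X : nat -> R[i]) (th C be : R) :
  X 1 = 1 ->
  (forall m n, (0 < m)%N -> (0 < n)%N -> X (m * n)%N = X m * X n) ->
  (forall n, sqnorm (X n) <= 1) ->
  (forall p, prime p -> X p = 0 \/ exists ph, X p = Complex (cos ph) (sin ph)) ->
  1 / 2 < th ->
  (forall N, `|\sum_(0 <= k < N.+1) Re (X k.+1)| <= C * npow N.+1 th) ->
  (forall N, `|\sum_(0 <= k < N.+1) Im (X k.+1)| <= C * npow N.+1 th) ->
  (forall N, `|\sum_(0 <= k < N.+1) (if prime k.+1 then Re (X k.+1) else 0)|
     <= C * npow N.+1 th) ->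
  th < be <= 1 ->
  ~ clim (fun N => \sum_(1 <= n < N.+1) (npow n (- be))%:C%C * X n) 0.
Proof.
move=> X1 XM X_le1 Xp th_half XRe XIm XP.
move=> /andP[tb b2] [ReL ImL].
have th0 : 0 <= th by lra.
have [A [bA [PA HA]]] := dirichlet_pseries th0 XRe.
have [B [bB [PB HB]]] := dirichlet_pseries th0 XIm.
have [D [bD [PD HD]]] := dirichlet_pseries th0 XP.
(* The logarithm contributed by one Euler factor minus its linear term, which is accounted for by
   [D]. *)
pose fac k h := - ln (sqnorm (1 - (npow k.+1 (h - 2))%:C%C * X k.+1))
                - 2 * Re (X k.+1) * npow k.+1 (h - 2).
pose e k h := if prime k.+1 then fac k h else 0.
have Pe k : pseries (2 - th) (e k) (fun h => 4 * npow k.+1 (h - 2) ^+ 2).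
  have PS0 (f : R -> R) : (forall h, f h = 0) -> pseries (2 - th) f (fun h => 4 * npow k.+1 (h - 2) ^+ 2).
    move=> f0; have := pseries_monomial (2 - th) 0 0; apply: pseries_ext => h _ /=.
      by rewrite mul0r f0.
    by rewrite normr0 mul0r mulr_ge0 // exprn_ge0 // npow_ge0.
  rewrite /e; case: (boolP (prime k.+1)) => [pp|_]; last exact: PS0.
  have [X0|[ph Xph]] := Xp _ pp.
    apply: PS0 => h; by rewrite /fac X0 mulr0 subr0 sqnorm1 ln1 oppr0 /= mulr0 mul0r subr0.
  have := pseries_euler_factor ph (prime_gt1 pp) (ltW th_half).
  apply: pseries_ext => h _ //; rewrite /fac Xph (sqnorm_polar (erefl _)) /=; ring.
have eB h : 0 <= h < 2 - th -> forall n, \sum_(0 <= k < n) 4 * npow k.+1 (h - 2) ^+ 2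
    <= 4 * (1 + (3 - 2 * h)^-1).
  move=> /andP[h0 hr] n; rewrite -mulr_sumr ler_wpM2l //.
  under eq_bigr do rewrite expr2 -npowD.
  have d0 : 0 < 3 - 2 * h by lra.
  have := npow_sum_bound d0 n; rewrite (_ : - (1 + (3 - 2 * h)) = h - 2 + (h - 2)) //; lra.
pose E h := limn (fun n => \sum_(0 <= k < n) e k h).
have HE h : 0 <= h < 2 - th -> (fun n => \sum_(0 <= k < n) e k h) @ \oo --> E h.
  move=> hr; suff : cvgn (fun n => \sum_(0 <= k < n) e k h) by [].
  apply: (@series_cvg_bounded _ _ (4 * (1 + (3 - 2 * h)^-1))) => n.
  apply: le_trans (eB _ hr n); apply: ler_sum => k _; exact: pseries_le (Pe k) hr.
have PE : pseries (2 - th) E (fun h => 4 * (1 + (3 - 2 * h)^-1)) := pseries_sum Pe eB HE.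
have PG := pseries_expR (pseries_add (pseries_scale 2 PD) PE).
have PF := pseries_add (pseries_add (pseries_mul PA PA) (pseries_mul PB PB)) (pseries_scale (-1) PG).
have idx (u : nat -> R) : (fun N => \sum_(1 <= n < N.+1) u n) = (fun N => \sum_(0 <= k < N) u k.+1).
  by apply/funext => N; rewrite big_add1.
(* For [h < 1] the exponent [2 - h] exceeds 1 and the Euler product converges; [pseries_zero] then
   carries the identity to [h = 2 - be]. *)
have Z h : 0 <= h < 1 -> A h * A h + B h * B h + -1 * expR (2 * D h + E h) = 0.
  move=> /andP[h0 h1].
  have hr : 0 <= h < 2 - th.
    by rewrite h0 /=; lra.
  have sg1 : 1 < 2 - h by lra.
  have := @euler_product R X (2 - h) X1 XM X_le1 sg1 (Complex (A h) (B h)) (2 * D h + E h).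
  move=> H; rewrite (_ : A h * A h + B h * B h = sqnorm (Complex (A h) (B h))); last first.
    by rewrite /sqnorm /= !expr2.
  rewrite H ?mulN1r ?subrr //.
    split => /=.
      under eq_fun do rewrite Re_sum; rewrite idx.
      by under eq_fun do under eq_bigr do rewrite Re_scale opprB mulrC; exact: HA.
    under eq_fun do rewrite Im_sum; rewrite idx.
    by under eq_fun do under eq_bigr do rewrite Im_scale opprB mulrC; exact: HB.
  under eq_fun do rewrite big_mkcond /=; rewrite idx.
  rewrite (_ : (fun N => _) = (fun N =>
    2 * (\sum_(0 <= k < N) (if prime k.+1 then Re (X k.+1) else 0) * npow k.+1 (h - 2)) +
    \sum_(0 <= k < N) e k h)).
    by apply: cvgD; [apply: cvgM; [exact: cvg_cst|exact: HD]|exact: HE].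
  apply/funext => N; rewrite mulr_sumr -big_split /=; apply: eq_bigr => k _.
  rewrite /e /fac opprB; case: ifP => _; last by rewrite mul0r mulr0 addr0.
  ring.
have hb : 0 <= 2 - be < 2 - th by apply/andP; split; lra.
have d1 : 0 < 1 :> R by [].
have := pseries_zero d1 PF Z hb; have AB0 : A (2 - be) = 0 /\ B (2 - be) = 0.
  split.
    have := HA _ hb; move=> /cvgn_uniq; apply.
    move: ReL; under eq_fun do rewrite Re_sum; rewrite idx.
    under eq_fun do under eq_bigr do rewrite Re_scale mulrC.
    by rewrite (_ : 2 - be - 2 = - be) //; lra.
  have := HB _ hb; move=> /cvgn_uniq; apply.
  move: ImL; under eq_fun do rewrite Im_sum; rewrite idx.
  under eq_fun do under eq_bigr do rewrite Im_scale mulrC.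
  by rewrite (_ : 2 - be - 2 = - be) //; lra.
case: AB0 => -> ->; rewrite !mul0r !add0r mulN1r => /eqP.
by rewrite oppr_eq0 expR_eq0.
Qed.

End NonVanishing.

(** * Dirichlet characters and primes *)

Section Periodic.

Lemma periodic_modn (T : Type) (f : nat -> T) q : (forall n, f (n + q)%N = f n) ->
  forall n, f n = f (n %% q)%N.
Proof.
move=> fq n; rewrite {1}(divn_eq n q) addnC.
by elim: (n %/ q)%N => [|k IH]; rewrite ?mul0n ?addn0 // mulSn addnCA addnC fq.
Qed.

(** Multiplication by a unit permutes the residues modulo [q]. *)
Lemma sum_period_mul (V : nmodType) (f : nat -> V) q c : (0 < q)%N -> coprime c q ->
  (forall n, f (n + q)%N = f n) ->
  \sum_(0 <= b < q) f (c * b)%N = \sum_(0 <= b < q) f b.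
Proof.
case: q => // q _ cq fq; rewrite !big_mkord.
pose h (i : 'I_q.+1) : 'I_q.+1 := Ordinal (ltn_pmod (c * i) (ltn0Sn q)).
have hinj : injective h.
  move=> i j /(congr1 val) /= E; apply: val_inj => /=; wlog ij : i j E / (i <= j)%N.
    by move=> H; case: (leqP i j) => [|/ltnW] /H; [apply|move=> ->].
  move/eqP: E; rewrite eq_sym eqn_mod_dvd ?leq_mul2l ?ij ?orbT // -mulnBr.
  rewrite mulnC Gauss_dvdl 1?coprime_sym // => /dvdn_leq.
  rewrite subn_gt0 => H; apply/eqP; rewrite eqn_leq ij leqNgt; apply/negP => /H.
  by rewrite leqNgt (leq_ltn_trans (leq_subr _ _) (ltn_ord j)).
rewrite [RHS](reindex_inj hinj); apply: eq_bigr => i _.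
by rewrite (periodic_modn fq).
Qed.

Lemma sum_periodic_modn (V : nmodType) (f : nat -> V) q :
  (forall n, f (n + q)%N = f n) -> \sum_(0 <= b < q) f b = 0 ->
  forall N, \sum_(0 <= k < N) f k = \sum_(0 <= k < N %% q) f k.
Proof.
move=> fq f0 N; rewrite {1}(divn_eq N q).
elim: (N %/ q)%N => [|j IH]; first by rewrite mul0n.
rewrite mulSn -addnA (big_cat_nat (n := q)) //= ?leq_addr // f0 add0r.
rewrite -{1}(add0n q) big_addn addKn -[RHS]IH.
by under eq_bigr do rewrite fq.
Qed.

Lemma periodic_bounded (R : realType) (f : nat -> R) q : (0 < q)%N ->
  (forall n, f (n + q)%N = f n) -> \sum_(0 <= b < q) f b = 0 ->
  exists2 B, 0 <= B & forall N, `|\sum_(0 <= k < N) f k.+1| <= B.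
Proof.
move=> q0 fq f0; exists (\sum_(0 <= k < q) `|f k| + `|f 0%N|).
  by rewrite addr_ge0 // sumr_ge0.
move=> N; have -> : \sum_(0 <= k < N) f k.+1 = \sum_(0 <= k < N.+1) f k - f 0%N.
  by rewrite big_nat_recl //= addrAC subrr add0r.
apply: le_trans (ler_normB _ _) _; rewrite lerD2r (sum_periodic_modn fq) //.
apply: le_trans (ler_norm_sum _ _ _) _.
rewrite [leRHS](big_cat_nat (n := (N.+1 %% q)%N)) //=; last by rewrite ltnW // ltn_pmod.
by rewrite lerDl; apply: sumr_ge0.
Qed.

End Periodic.

Section Characters.
Variables (R : realType) (q : nat) (chi : nat -> R[i]).
Hypothesis q0 : (0 < q)%N.
Hypothesis chiP : is_dirichlet_character q chi.

Lemma chi1 : chi 1 = 1. Proof. by case: chiP. Qed.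
Lemma chiM m n : chi (m * n)%N = chi m * chi n. Proof. by case: chiP. Qed.
Lemma chi_period n : chi (n + q)%N = chi n. Proof. by case: chiP. Qed.
Lemma chi_eq0 n : chi n = 0 <-> ~~ coprime n q. Proof. by case: chiP. Qed.

(** [chi n] to the power [totient q] is [chi 1 = 1] by Euler's theorem, and a nonnegative real with
    a positive power equal to 1 is 1. *)
Lemma chi_sqnorm n : coprime n q -> sqnorm (chi n) = 1.
Proof.
move=> cn; have t0 : (0 < totient q)%N by rewrite totient_gt0.
have E : sqnorm (chi n) ^+ totient q = 1.
  have powE k : sqnorm (chi n) ^+ k = sqnorm (chi (n ^ k)).
    elim: k => [|k IH]; first by rewrite expr0 expn0 chi1 sqnorm1.
    by rewrite exprS expnS chiM sqnormM IH.
  rewrite powE (periodic_modn chi_period) Euler_exp_totient //.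
  by rewrite -(periodic_modn chi_period) chi1 sqnorm1.
by apply/eqP; rewrite -(@pexpr_eq1 _ _ (totient q)) ?E ?sqnorm_ge0.
Qed.

Lemma chi_sqnorm_le1 n : sqnorm (chi n) <= 1.
Proof.
have [/chi_sqnorm -> //|/chi_eq0 ->] := boolP (coprime n q).
by rewrite /sqnorm /= expr0n addr0.
Qed.

(** Multiplying by some [chi c] different from 1, with [c] coprime to [q], only permutes the
    terms. *)
Lemma chi_sum_eq0 : ~ principal_character q chi -> \sum_(0 <= b < q) chi b = 0.
Proof.
move=> /existsNP[c /not_implyP[cq c1]].
have E : chi c * \sum_(0 <= b < q) chi b = \sum_(0 <= b < q) chi b.
  rewrite mulr_sumr -[RHS](sum_period_mul q0 cq chi_period).
  by apply: eq_bigr => b _; rewrite chiM.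
have : (chi c - 1) * \sum_(0 <= b < q) chi b = 0 by rewrite mulrBl E mul1r subrr.
by move/eqP; rewrite mulf_eq0 subr_eq0 => /orP[/eqP|/eqP].
Qed.

End Characters.

(** * Sums over primes and sums over their indices *)

Section NthPrime.

Lemma next_primeP n : prime (next_prime n) /\ (n < next_prime n)%N.
Proof.
by rewrite /next_prime; case: ex_minnP => p /andP[].
Qed.

Lemma next_prime_le n p : prime p -> (n < p)%N -> (next_prime n <= p)%N.
Proof.
move=> pp np; rewrite /next_prime; case: ex_minnP => r _; apply.
by rewrite np.
Qed.

Lemma nth_prime_gt n : (n < nth_prime n)%N.
Proof.
elim: n => //= n IH; have [_ H] := next_primeP (nth_prime n).
exact: leq_ltn_trans IH H.
Qed.

Lemma nth_prime_prime n : (0 < n)%N -> prime (nth_prime n).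
Proof. by case: n => // n _ /=; have [] := next_primeP (nth_prime n). Qed.

(** The index [k] is the number of primes up to [x]: the probabilistic sums run over prime indices,
    the Dirichlet series over integers. *)
Lemma sum_primes (V : nmodType) (F : nat -> V) x : exists2 k, (k <= x)%N &
  \sum_(0 <= j < x) (if prime j.+1 then F j.+1 else 0) =
  \sum_(1 <= n < k.+1) F (nth_prime n).
Proof.
pose pi n := \sum_(0 <= j < n) (prime j.+1 : nat).
have piS n : pi n.+1 = (pi n + prime n.+1)%N by rewrite /pi big_nat_recr.
have pi_le n : (pi n <= n)%N.
  elim: n => [|n IH]; first by rewrite /pi big_geq.
  by rewrite piS -addn1 leq_add // leq_b1.
(* This is [p_{pi(n)} <= n < p_{pi(n)+1}]; the maximum with 1 covers [n = 0], where the dummy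
   [nth_prime 0] is 1. *)
have inv n : (nth_prime (pi n) <= maxn n 1)%N /\ (n < nth_prime (pi n).+1)%N /\
    (prime n.+1 -> nth_prime (pi n).+1 = n.+1).
  have aux k : (nth_prime (pi k) <= maxn k 1)%N -> (k < nth_prime (pi k).+1)%N ->
      prime k.+1 -> nth_prime (pi k).+1 = k.+1.
    move=> H1 H2 pk; apply/eqP; rewrite eqn_leq H2 andbT; apply: next_prime_le => //.
    apply: leq_ltn_trans H1 _; rewrite gtn_max ltnSn.
    by case: k pk {H2}.
  elim: n => [|n [H1 [H2 H3]]].
    have E : pi 0%N = 0%N by rewrite /pi big_geq.
    by rewrite E; split => //; split => [|pp]; [exact: ltnW (nth_prime_gt 1)|done].
  have [] : (nth_prime (pi n.+1) <= maxn n.+1 1)%N /\ (n.+1 < nth_prime (pi n.+1).+1)%N.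
    rewrite piS; case: (boolP (prime n.+1)) => [/[dup] pn /H3 E|pn].
      rewrite addn1 E; split; first by rewrite leq_max leqnn.
      by have [_] := next_primeP (nth_prime (pi n).+1); rewrite {1}E.
    rewrite addn0; split; first by apply: leq_trans H1 _; rewrite geq_max !leq_max leqnSn.
    rewrite ltn_neqAle H2 andbT; apply: contraNneq pn => ->.
    exact: nth_prime_prime.
  by move=> I1 I2; split=> //; split=> //; exact: aux.
exists (pi x); first exact: pi_le.
elim: x => [|x IH]; first by rewrite !big_geq // /pi big_geq.
rewrite big_nat_recr //= IH piS; case: (boolP (prime x.+1)) => px; last by rewrite addn0 addr0.
rewrite addn1 [RHS]big_nat_recr //=; congr (_ + F _).
by have [_ [_ /(_ px)]] := inv x.
Qed.

End NthPrime.

(** * Zeros with Re s > 1/2, and the exclusion of principal characters *)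

Section ZeroFreeRight.
Variable R : realType.
Local Notation Re := complex.Re.
Local Notation Im := complex.Im.

Lemma cos_lip (x y : R) : `|cos x - cos y| <= `|x - y|.
Proof.
wlog xy : x y / y <= x => [H|].
  by have [yx|/ltW xy] := leP y x; [exact: H|rewrite distrC [leRHS]distrC; exact: H].
have := @MVT_le R cos (fun t => - sin t) y x 1 xy (fun t _ => is_derive_cos t).
rewrite mul1r [`|x - y|]ger0_norm ?subr_ge0 //; apply.
by move=> t _; rewrite normrN sin_max.
Qed.

Lemma sin_lip (x y : R) : `|sin x - sin y| <= `|x - y|.
Proof.
wlog xy : x y / y <= x => [H|].
  by have [yx|/ltW xy] := leP y x; [exact: H|rewrite distrC [leRHS]distrC; exact: H].
have := @MVT_le R sin cos y x 1 xy (fun t _ => is_derive_sin t).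
rewrite mul1r [`|x - y|]ger0_norm ?subr_ge0 //; apply.
by move=> t _; exact: cos_max.
Qed.

(** Far from sharp, but a power 1/2 is harmless here: [1/n = n^{-3/2} n^{1/2}], and [npow_sum_bound]
    with [d = 1/2] supplies the constant 3. *)
Lemma harmonic_le N : \sum_(0 <= k < N) k.+1%:R^-1 <= 3 * npow N (1 / 2) :> R.
Proof.
case: N => [|N]; first by rewrite big_geq // mulr_ge0 // npow_ge0.
apply: le_trans (_ : \sum_(0 <= k < N.+1) npow k.+1 (- (1 + 1 / 2)) * npow N.+1 (1 / 2) <= _).
  rewrite !big_nat; apply: ler_sum => k /andP[_ kN].
  rewrite -npowN1 // (_ : -1 = - (1 + 1 / 2) + 1 / 2 :> R) ?npowD; last by lra.
  by rewrite ler_wpM2l ?npow_ge0 // ler_npowl //; lra.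
rewrite -mulr_suml ler_wpM2r ?npow_ge0 //.
have h0 : 0 < 1 / 2 :> R by lra.
by apply: le_trans (npow_sum_bound h0 _) _; lra.
Qed.

Lemma npow_ge1 n (x : R) : 0 <= x -> 1 <= npow n.+1 x.
Proof. by move=> x0; rewrite -(npow1n x) ler_npowl. Qed.

(** Weights varying by [O(1/k)] cost only a harmonic sum, absorbed in [N^{1/2}]; this covers the
    cosine and sine of [ga * ln n]. *)
Lemma abel_bound (a w : nat -> R) (B G : R) : 0 <= B -> 0 <= G ->
  (forall N, `|\sum_(0 <= k < N) a k| <= B) ->
  (forall k, `|w k| <= 1) -> (forall k, `|w k - w k.+1| <= G * k.+1%:R^-1) ->
  forall N, `|\sum_(0 <= k < N.+1) a k * w k| <= B * (3 * G + 1) * npow N.+1 (1 / 2).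
Proof.
move=> B0 G0 aB w1 wG N; rewrite abel_summation.
apply: le_trans (ler_normD _ _) _; rewrite mulrDr mulr1 mulrDl; apply: lerD.
  apply: le_trans (ler_norm_sum _ _ _) _.
  apply: le_trans (_ : \sum_(0 <= k < N.+1) B * G * k.+1%:R^-1 <= _).
    apply: ler_sum => k _; rewrite normrM -mulrA; apply: ler_pM => //; exact: aB.
  rewrite -mulr_sumr -mulrA -mulrA ler_wpM2l // -mulrA mulrCA ler_wpM2l //.
  exact: harmonic_le.
rewrite normrM; apply: ler_pM => //; apply: le_trans (w1 _) _; apply: npow_ge1; lra.
Qed.

Variables (q : nat) (chi : nat -> R[i]) (theta : nat -> R) (M : nat) (mu : nat -> nat).
Variable (ga : R).

(** [n^{-i ga}]: the height is moved into the coefficients, so that the series keeps a real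
    exponent. *)
Let rot n : R[i] := Complex (cos (ga * ln n%:R)) (- sin (ga * ln n%:R)).
Let X n := chi n * rot n.

Lemma cpowRE n (be : R) :
  cpowR n%:R (- Complex be ga) = (npow n (- be))%:C%C * rot n.
Proof.
rewrite /cpowR /rot /npow /= -[in RHS]sinN -[in RHS](cosN (ga * _)) -mulNr.
by apply/eqP; rewrite eq_complex /= !mul0r subr0 addr0 !eqxx.
Qed.

Lemma zero_free_right : (0 < q)%N -> is_dirichlet_character q chi ->
  ~ principal_character q chi ->
  (forall p : nat, prime p -> ~~ (p %| q)%N ->
     chi p = Complex (cos (theta p)) (sin (theta p))) ->
  (forall n, (mu n <= M)%N) -> forall be, 1 / 2 < be < 1 ->
  (exists (C : R) (N0 : nat), forall N : nat, (N0 <= N)%N ->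
     `|Bprime q theta mu N ga| <= C * (N%:R) `^ (1 / 2 + (be - 1 / 2) / 2)) ->
  ~ clim (fun N => \sum_(1 <= n < N.+1) chi n * cpowR n%:R (- Complex be ga)) 0.
Proof.
move=> q0 chiP np chith muM be /andP[b1 b2] HB.
(* Half the excess of [be] over 1/2, so that [th] lies strictly between 1/2 and [be]. *)
pose eps := (be - 1 / 2) / 2; pose th := 1 / 2 + eps.
have eps0 : 0 < eps by rewrite /eps; lra.
have th1 : th < be by rewrite /th /eps; lra.
have thh : 1 / 2 < th by rewrite /th; lra.
have ReX n : Re (X n) = Re (chi n) * cos (ga * ln n%:R) + Im (chi n) * sin (ga * ln n%:R).
  by rewrite /X Re_mul /=; ring.
have ImX n : Im (X n) = Im (chi n) * cos (ga * ln n%:R) - Re (chi n) * sin (ga * ln n%:R).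
  by rewrite /X Im_mul /=; ring.
have dln k : `|ga * ln k.+1%:R - ga * ln k.+2%:R| <= `|ga| * k.+1%:R^-1.
  have [L0 L] := lnS_bounds R (ltn0Sn k).
  rewrite -mulrBr normrM ler_wpM2l // distrC ger0_norm //.
  by apply: le_trans L0; rewrite invr_ge0.
have dcos k : `|cos (ga * ln k.+1%:R) - cos (ga * ln k.+2%:R)| <= `|ga| * k.+1%:R^-1.
  exact: le_trans (cos_lip _ _) (dln k).
have dsin k : `|sin (ga * ln k.+1%:R) - sin (ga * ln k.+2%:R)| <= `|ga| * k.+1%:R^-1.
  exact: le_trans (sin_lip _ _) (dln k).
have chi0 := chi_sum_eq0 q0 chiP np.
have [B1 B10 HB1] : exists2 B : R, 0 <= B & forall N, `|\sum_(0 <= k < N) Re (chi k.+1)| <= B.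
  apply: (periodic_bounded (f := fun n => Re (chi n)) q0) => [n|].
    by rewrite (chi_period chiP).
  by rewrite -Re_sum chi0.
have [B2 B20 HB2] : exists2 B : R, 0 <= B & forall N, `|\sum_(0 <= k < N) Im (chi k.+1)| <= B.
  apply: (periodic_bounded (f := fun n => Im (chi n)) q0) => [n|].
    by rewrite (chi_period chiP).
  by rewrite -Im_sum chi0.
have g0 : 0 <= `|ga| by [].
have c1 k : `|cos (ga * ln k.+1%:R)| <= 1 by exact: cos_max.
have s1 k : `|sin (ga * ln k.+1%:R)| <= 1 by exact: sin_max.
pose C1 := (B1 + B2) * (3 * `|ga| + 1).
have half_th N : npow N.+1 (1 / 2) <= npow N.+1 th :> R by apply: ler_npow; lra.
have C10 : 0 <= C1 by rewrite mulr_ge0 ?addr_ge0 // mulr_ge0.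
have HRe N : `|\sum_(0 <= k < N.+1) Re (X k.+1)| <= C1 * npow N.+1 th.
  under eq_bigr do rewrite ReX; rewrite big_split /=.
  apply: le_trans (ler_normD _ _) _.
  apply: le_trans (lerD (abel_bound B10 g0 HB1 c1 dcos N) (abel_bound B20 g0 HB2 s1 dsin N)) _.
  by rewrite -!mulrDl ler_wpM2l.
have HIm N : `|\sum_(0 <= k < N.+1) Im (X k.+1)| <= C1 * npow N.+1 th.
  under eq_bigr do rewrite ImX; rewrite sumrB.
  apply: le_trans (ler_normB _ _) _.
  apply: le_trans (lerD (abel_bound B20 g0 HB2 c1 dcos N) (abel_bound B10 g0 HB1 s1 dsin N)) _.
  by rewrite -!mulrDl addrC ler_wpM2l.
pose S N := \sum_(1 <= n < N.+1) Re (X (nth_prime n)).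
have ReXp p : prime p -> Re (X p) = if (p %| q)%N then 0 else cos (ga * ln p%:R - theta p).
  move=> pp; rewrite ReX; case: ifP => pq.
    have -> : chi p = 0 by apply/(chi_eq0 chiP); rewrite prime_coprime // pq.
    by rewrite !mul0r addr0.
  by rewrite chith ?pq //= cosB; ring.
have [C2 C20 HS] : exists2 C : R, 0 <= C & forall N, `|S N.+1| <= C * npow N.+1 th.
  have [C [N0 HC]] := HB.
  (* Below [N0] the trivial bound by the number of terms replaces the hypothesis. *)
  have HBp N : `|Bprime q theta mu N.+1 ga| <= (`|C| + N0%:R) * npow N.+1 th.
    have [NN0|N0N] := leqP N0 N.+1.
      apply: le_trans (HC _ NN0) _; rewrite -/eps npow_powR // ler_wpM2r ?npow_ge0 //.
      by apply: le_trans (ler_norm _) _; rewrite lerDl.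
    apply: le_trans (_ : (`|C| + N0%:R) * 1 <= _); last first.
      by rewrite ler_wpM2l ?addr_ge0 // npow_ge1; lra.
    rewrite mulr1; apply: le_trans (_ : N0%:R <= _); last by rewrite lerDr.
    apply: le_trans (ler_norm_sum _ _ _) _.
    apply: le_trans (_ : \sum_(1 <= n < N.+2) 1 <= _).
      rewrite big_mkcond /=; apply: ler_sum => n _; case: ifP => // _; exact: cos_max.
    by rewrite sumr_const_nat subn1 ler_nat ltnW.
  (* The shift costs at most [|ga| ln (1 + m q / p)] per prime, hence at most [|ga| M q / n] because
     [p_n > n]; the 3 is that of [harmonic_le]. *)
  pose K := `|ga| * (M * q)%:R * 3.
  have K0 : 0 <= K by rewrite !mulr_ge0.
  exists (`|C| + N0%:R + K); first by rewrite !addr_ge0.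
  move=> N; rewrite -(subrK (Bprime q theta mu N.+1 ga) (S N.+1)).
  apply: le_trans (ler_normD _ _) _; rewrite addrC mulrDl; apply: lerD => //.
  rewrite /S /Bprime [X in _ - X]big_mkcond -sumrB big_add1 /=.
  apply: le_trans (ler_norm_sum _ _ _) _.
  apply: le_trans (_ : \sum_(0 <= k < N.+1) `|ga| * (M * q)%:R * k.+1%:R^-1 <= _); last first.
    rewrite -mulr_sumr /K -[leRHS]mulrA ler_wpM2l ?mulr_ge0 //.
    by apply: le_trans (harmonic_le _) _; rewrite ler_wpM2l.
  apply: ler_sum => k _; have pp := nth_prime_prime (ltn0Sn k).
  rewrite ReXp // -![next_prime (nth_prime k)]/(nth_prime k.+1).
  move: pp (nth_prime_gt k.+1).
  move: (nth_prime k.+1) => p pp pk; case: ifP => pq.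
    by rewrite subrr normr0 !mulr_ge0 // invr_ge0.
  apply: le_trans (cos_lip _ _) _.
  rewrite (_ : _ - _ - (_ - _) = ga * (ln p%:R - ln (p + mu k.+1 * q)%:R)); last by ring.
  rewrite normrM -mulrA ler_wpM2l //.
  have p0 : 0 < p%:R :> R by rewrite ltr0n prime_gt0.
  have pm0 : 0 < (p + mu k.+1 * q)%:R :> R by rewrite ltr0n addn_gt0 prime_gt0.
  rewrite distrC -ln_div ?posrE // ger0_norm; last first.
    by rewrite ln_ge0 // ler_pdivlMr // mul1r ler_nat leq_addr.
  rewrite natrD mulrDl divff ?gt_eqF //.
  apply: le_trans (_ : (mu k.+1 * q)%:R / p%:R <= _).
    by apply: le_ln1Dx; apply: lt_le_trans (_ : 0 <= _); rewrite ?ltrN10 // divr_ge0.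
  apply: ler_pM => //; first by rewrite ler_nat leq_mul2r muM orbT.
  rewrite lef_pV2; [by rewrite ler_nat ltnW|exact: p0|by rewrite posrE ltr0n].
have HP N : `|\sum_(0 <= k < N.+1) (if prime k.+1 then Re (X k.+1) else 0)| <= C2 * npow N.+1 th.
  have [k kN ->] := sum_primes (fun n => Re (X n)) N.+1.
  case: k kN => [|k] kN; first by rewrite big_geq // normr0 mulr_ge0 // npow_ge0.
  apply: le_trans (HS k) _; rewrite ler_wpM2l // ler_npowl //; lra.
have XM m n : (0 < m)%N -> (0 < n)%N -> X (m * n)%N = X m * X n.
  move=> m0 n0; rewrite /X (chiM chiP) mulrACA; congr (_ * _).
  rewrite /rot natrM lnM ?posrE ?ltr0n // mulrDr cosD sinD.
  by apply/eqP; rewrite eq_complex /=; apply/andP; split; apply/eqP; ring.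
have X1 : X 1 = 1.
  rewrite /X (chi1 chiP) mul1r /rot ln1 mulr0 cos0 sin0 oppr0; done.
have Xle n : sqnorm (X n) <= 1.
  rewrite /X sqnormM (_ : sqnorm (rot n) = 1) ?mulr1; first exact: chi_sqnorm_le1 q0 chiP n.
  by rewrite /sqnorm /rot /= sqrrN cos2Dsin2.
have Xp p : prime p -> X p = 0 \/ exists ph, X p = Complex (cos ph) (sin ph).
  move=> pp; case: (boolP (p %| q)%N) => pq.
    left; rewrite /X; have -> : chi p = 0 by apply/(chi_eq0 chiP); rewrite prime_coprime // pq.
    by rewrite mul0r.
  right; exists (theta p - ga * ln p%:R); rewrite /X chith // /rot cosB sinB.
  by apply/eqP; rewrite eq_complex /=; apply/andP; split; apply/eqP; ring.
have wk N C : C <= C1 + C2 -> C * npow N.+1 th <= (C1 + C2) * npow N.+1 th.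
  by move=> CC; rewrite ler_wpM2r ?npow_ge0.
have := @dirichlet_series_nonvanishing R X th (C1 + C2) be X1 XM Xle Xp thh.
move=> H; have {}H := H _ _ _ _.
under eq_fun do under eq_bigr do rewrite cpowRE mulrCA; apply: H => //.
- move=> N; apply: le_trans (HRe N) (wk _ _ _); lra.
- move=> N; apply: le_trans (HIm N) (wk _ _ _); lra.
- move=> N; apply: le_trans (HP N) (wk _ _ _); lra.
- by rewrite th1 ltW.
Qed.

(** At [t = 0] every cosine equals [Re chi(p) = 1], so the sum grows like [N], against a bound of
    order [N^{3/4}]. *)
Lemma principal_contradiction : (0 < q)%N -> principal_character q chi ->
  (forall p : nat, prime p -> ~~ (p %| q)%N ->
     chi p = Complex (cos (theta p)) (sin (theta p))) ->
  (exists (C : R) (N0 : nat), forall N : nat,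
        (N0 <= N)%N -> `|Bprime q theta mu N 0| <= C * (N%:R) `^ (1 / 2 + 1 / 4)) -> False.
Proof.
move=> q0 pr chith [C [N0 HC]].
have cosE n : (0 < n)%N -> ~~ (nth_prime n %| q)%N ->
    cos (0 * ln (nth_prime n + mu n * q)%:R - theta (nth_prime n)) = 1.
  move=> n0 nq; have pp := nth_prime_prime n0.
  rewrite mul0r sub0r cosN; have := chith _ pp nq.
  by rewrite pr ?prime_coprime // => -[].
(* For [n >= q] the prime [p_n > n] is too large to divide [q]. *)
have low N : (q <= N)%N -> N%:R - q%:R <= Bprime q theta mu N 0.
  move=> qN; rewrite /Bprime.
  apply: le_trans (_ : \sum_(q <= n < N.+1) 1 <= _).
    by rewrite sumr_const_nat -natrB // ler_nat leq_sub2r.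
  rewrite [leRHS](big_cat_nat (n := q)) //=; last exact: leqW.
  rewrite -[leLHS]add0r; apply: lerD.
    rewrite big_nat_cond; apply: sumr_ge0 => n /andP[/andP[n1 _] nq].
    by rewrite cosE.
  rewrite [leRHS]big_mkcond !big_nat; apply: ler_sum => n /andP[qn _].
  have n0 : (0 < n)%N := leq_trans q0 qn.
  rewrite ifT ?cosE //.
    by apply: contraTN qn => /(dvdn_leq q0) H; rewrite -ltnNge (leq_trans (nth_prime_gt n)).
  by apply: contraTN qn => /(dvdn_leq q0) H; rewrite -ltnNge (leq_trans (nth_prime_gt n)).
(* Evaluating at [N = K^4] makes [N^{3/4} = K^3] exact. *)
pose K := (maxn (maxn N0 q) (Num.truncn (`|C| + q%:R + 1)).+1).+1.
have KC : `|C| + q%:R + 1 <= K%:R.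
  apply: le_trans (ltW (truncnS_gt _)) _.
  by rewrite ler_nat leqW // leq_max leqnn orbT.
have K1 : (1 <= K)%N by [].
have K4 : (K <= K ^ 4)%N by rewrite -{1}(expn1 K) leq_pexp2l.
have := HC (K ^ 4)%N; have := low (K ^ 4)%N.
have -> : (q <= K ^ 4)%N by apply: leq_trans K4; rewrite leqW // !leq_max leqnn orbT.
have -> : (N0 <= K ^ 4)%N by apply: leq_trans K4; rewrite leqW // !leq_max leqnn.
move=> /(_ isT) L /(_ isT) U; have := le_trans L (le_trans (ler_norm _) U).
have -> : (K ^ 4)%:R `^ (1 / 2 + 1 / 4) = K%:R ^+ 3 :> R.
  rewrite npow_powR ?expn_gt0 // /npow natrX lnXn ?ltr0n // -[ln _ *+ 4]mulr_natl mulrA.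
  by rewrite (_ : (1 / 2 + 1 / 4) * 4 = 3 :> R) ?expRM_natl ?lnK ?posrE ?ltr0n //; lra.
rewrite natrX; set x : R := K%:R in KC *.
have q0R : 0 <= q%:R :> R by [].
have C0 := normr_ge0 C; have CC := ler_norm C.
have x1 : 1 <= x by lra.
have x3 : 1 <= x ^+ 3 by exact: exprn_ege1.
have : (q%:R + 1) * x ^+ 3 <= (x - C) * x ^+ 3.
  by apply: ler_wpM2r; [exact: le_trans x3|lra].
have : (q%:R + 1) * 1 <= (q%:R + 1) * x ^+ 3 by apply: ler_wpM2l => //; lra.
rewrite (_ : x ^+ 4 = x * x ^+ 3); last by rewrite -exprS.
lra.
Qed.

End ZeroFreeRight.

(** * Dirichlet series twisted by periodic functions *)

Section SmoothNumbers.
Variable R : realType.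

(** The full series is a finite Euler product and converges for every [sg > 0]. Induction on the
    primes: separating the multiples of [p], the sum [S] satisfies [S <= C + rho S] with
    [rho = p^{-sg} < 1]. *)
Lemma smooth_sum_bounded (sg : R) (ps : seq nat) : 0 < sg -> all prime ps ->
  exists C, forall N, \sum_(1 <= d < N.+1 | all [in ps] (primes d)) npow d (- sg) <= C.
Proof.
move=> s0; elim: ps => [|p ps IH] /=.
  move=> _; exists 1 => N; rewrite big_mkcond /=.
  case: N => [|N]; first by rewrite big_geq.
  rewrite big_ltn // big_nat big1 ?addr0 => [|d /andP[d1 _]]; first by rewrite npow1n.
  case: (boolP (all _ _)) => // /allP/(_ (pdiv d)).
  by rewrite mem_primes pdiv_prime // pdiv_dvd (ltnW d1) => /(_ isT).
move=> /andP[pp /IH[C HC]].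
pose sm d := all [in p :: ps] (primes d).
pose rho : R := npow p (- sg).
have rho1 : rho < 1.
  rewrite /rho /npow expR_lt1 mulNr oppr_lt0 mulr_gt0 // ln_gt0 // ltr1n.
  exact: prime_gt1.
have r0 : 0 < 1 - rho by lra.
exists (C / (1 - rho)) => N; rewrite -/(sm _) ler_pdivlMr // mulrBr mulr1 lerBlDr.
set S := (X in X * rho).
have ES : S = \sum_(1 <= d < N.+1 | sm d && ~~ (p %| d)%N) npow d (- sg) +
    \sum_(1 <= d < N.+1 | sm d && (p %| d)%N) npow d (- sg).
  by rewrite /S (bigID (fun d => (p %| d)%N)) /= addrC.
rewrite [leLHS]ES; apply: lerD.
  apply: le_trans (HC N); rewrite big_mkcond [leRHS]big_mkcond /=.
  apply: ler_sum => d _; case: ifP => [/andP[/allP sd pd]|_]; last first.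
    by case: ifP => // _; exact: npow_ge0.
  rewrite ifT //; apply/allP => r rd; have := sd r rd; rewrite inE => /orP[/eqP rp|//].
  by move: rd; rewrite rp mem_primes (negbTE pd) !andbF.
rewrite (sum_multiples sm (fun d => npow d (- sg)) N (prime_gt0 pp)).
apply: le_trans (_ : \sum_(1 <= m < N.+1 | sm m) npow m (- sg) * rho <= _); last first.
  by rewrite -mulr_suml.
rewrite [leRHS]big_mkcond [leLHS]big_mkcond /=.
have NN : ((N %/ p).+1 <= N.+1)%N by rewrite ltnS leq_div.
rewrite [leRHS](big_cat_nat (n := (N %/ p).+1)) //= -[leLHS]addr0.
apply: lerD; last first.
  apply: sumr_ge0 => m _; by case: ifP => // _; rewrite mulr_ge0 ?npow_ge0.
rewrite !big_nat; apply: ler_sum => m /andP[m0 _].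
case: ifP => [/allP H|_]; last by case: ifP => // _; rewrite mulr_ge0 ?npow_ge0 //; exact: npow_ge0.
have smm : sm m.
  by apply/allP => r rm; apply: H; rewrite (primesM r (prime_gt0 pp) m0) rm orbT.
by rewrite smm (npowM _ (prime_gt0 pp) m0) mulrC.
Qed.

End SmoothNumbers.

Section FourierTransform.
Variables (R : realType) (q : nat) (chi : nat -> R[i]).
Local Notation Re := complex.Re.
Local Notation Im := complex.Im.
Hypothesis q0 : (0 < q)%N.
Hypothesis chiP : is_dirichlet_character q chi.

Definition npowc n (w : R[i]) : R[i] := cpowR n%:R (- w).

Lemma npowcM m n w : (0 < m)%N -> (0 < n)%N -> npowc (m * n) w = npowc m w * npowc n w.
Proof.
move=> m0 n0; rewrite /npowc /cpowR natrM lnM ?posrE ?ltr0n // !mulrDr expRD cosD sinD.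
by apply/eqP; rewrite eq_complex /=; apply/andP; split; apply/eqP; ring.
Qed.

Lemma npowc_sqnorm n w : sqnorm (npowc n w) = npow n (- Re w) ^+ 2.
Proof.
rewrite /sqnorm /npowc /cpowR /npow Re_opp Im_opp /= !exprMn -mulrDr cos2Dsin2 mulr1.
done.
Qed.

(** For [g n = cos (2 pi n / q)] and [g n = sin (2 pi n / q)] these are the two halves of the Gauss
    sums of [chi], kept apart because different Mellin constants multiply them. *)
Definition char_transform (g : nat -> R) n : R[i] := \sum_(0 <= b < q) chi b * (g (b * n)%N)%:C%C.

(* Only the part of [n] coprime to [q] is pulled out, so [chi] need not be primitive. *)
Lemma char_transform_mul g d m : (forall n, g (n + q)%N = g n) -> coprime m q ->
  char_transform g (d * m) = (chi m)^*%C * char_transform g d.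
Proof.
move=> gq mq.
have E : chi m * char_transform g (d * m) = char_transform g d.
  rewrite /char_transform mulr_sumr.
  rewrite -(@sum_period_mul _ (fun b => chi b * (g (b * d)%N)%:C%C) q m) //.
    apply: eq_bigr => b _; rewrite mulrA -(chiM chiP); congr (_ * (g _)%:C%C).
    by rewrite [(d * m)%N]mulnC mulnA [(b * m)%N]mulnC.
  move=> b; rewrite (chi_period chiP) mulnDl.
  congr (_ * _%:C%C); rewrite (periodic_modn gq) addnC mulnC modnMDl.
  by rewrite -(periodic_modn gq).
rewrite -E mulrA; have := chi_sqnorm q0 chiP mq; rewrite /sqnorm => nm.
suff -> : (chi m)^*%C * chi m = 1 by rewrite mul1r.
case: (chi m) nm => a b /= nm; apply/eqP; rewrite eq_complex /=.
by apply/andP; split; apply/eqP; [rewrite -nm|]; ring.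
Qed.

(** Each [n] is uniquely [d m] with all primes of [d] dividing [q] and [m] coprime to [q]. *)
Lemma sum_pi_part (F : nat -> R[i]) N :
  \sum_(1 <= n < N.+1) F n =
  \sum_(1 <= d < N.+1 | all [in primes q] (primes d))
    \sum_(1 <= m < (N %/ d).+1 | coprime m q) F (d * m)%N.
Proof.
pose D n := (n`_(\pi(q)))%N.
have pos_all d : (0 < d)%N -> all [in primes q] (primes d) = (\pi(q).-nat d)%N.
  by move=> d0; rewrite /pnat d0 /=; apply: eq_all => r; rewrite inE.
transitivity (\sum_(1 <= d < N.+1 | all [in primes q] (primes d))
    \sum_(1 <= n < N.+1 | (D n == d) && (d %| n)%N) F n).
  rewrite big_nat_cond [RHS]big_nat_cond.
  under [RHS]eq_bigr do rewrite big_nat_cond.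
  rewrite (exchange_big_dep (fun n => (0 < n < N.+1)%N && true)) /=; last first.
    by move=> i j _ /andP[-> _].
  apply: eq_bigr => n /andP[/andP[n0 nN] _].
  have D0 : (0 < D n)%N by exact: part_gt0.
  have DN : (D n < N.+1)%N by apply: leq_ltn_trans nN; apply: dvdn_leq => //; exact: dvdn_part.
  rewrite (eq_bigl (fun d => ((0 < d < N.+1)%N && (d == D n)))) => [|d].
    rewrite -big_nat_cond big_nat1_eq.
    by rewrite D0 DN.
  rewrite n0 nN /= [d == _]eq_sym; case: (eqVneq (D n) d) => [<-|]; last by rewrite !andbF.
  by rewrite dvdn_part pos_all // part_pnat !andbT.
rewrite big_nat_cond [RHS]big_nat_cond; apply: eq_bigr => d /andP[/andP[d0 dN] dq].
rewrite (sum_multiples (fun n => D n == d) F N d0).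
rewrite big_nat_cond [RHS]big_nat_cond; apply: eq_bigl => m.
case: (boolP (0 < m < _)%N) => //= /andP[m0 _].
rewrite /D partnM // part_pnat_id -?pos_all // -{2}(muln1 d) eqn_pmul2l //.
by rewrite partn_eq1 // coprime_sym coprime_pi'.
Qed.

(** By [sum_pi_part] and [char_transform_mul] the sum equals that of
    [char_transform g d * d^{-w} * T (N %/ d)] over the [d] supported on the primes of [q]. Each
    term tends to 0, [T] is bounded and [d^{-Re w}] is summable over such [d], so Tannery's theorem
    applies. *)
Lemma char_transform_zero g w : (forall n, g (n + q)%N = g n) -> 0 < Re w ->
  clim (fun N => \sum_(1 <= m < N.+1) (chi m)^*%C * npowc m w) 0 ->
  clim (fun N => \sum_(1 <= n < N.+1) char_transform g n * npowc n w) 0.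
Proof.
move=> gq w0 T0.
pose T N := \sum_(1 <= m < N.+1) (chi m)^*%C * npowc m w.
pose sm d := all [in primes q] (primes d).
(* The index [j] stands for [d = j.+1]; for [d > N] the factor [T 0] is an empty sum, so the series
   over all [j] is finite. *)
pose s N j := if sm j.+1 then char_transform g j.+1 * npowc j.+1 w * T (N %/ j.+1)%N else 0.
have E N n : (N <= n)%N -> \sum_(0 <= j < n) s N j =
    \sum_(1 <= n < N.+1) char_transform g n * npowc n w.
  move=> Nn; rewrite sum_pi_part.
  rewrite (big_cat_nat (n := N)) //= [X in _ + X]big_nat [X in _ + X]big1 ?addr0; last first.
    move=> j /andP[Nj _]; rewrite /s divn_small ?ltnS // /T big_geq // mulr0.
    by case: ifP.
  rewrite [RHS]big_mkcond big_add1 /=; apply: eq_bigr => j _; rewrite /s -/(sm _).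
  case: ifP => // _; rewrite /T mulr_sumr [RHS]big_mkcond !big_nat.
  apply: eq_bigr => m /andP[m0 _]; case: ifPn => mq.
    by rewrite char_transform_mul // npowcM //; ring.
  have -> : chi m = 0 by exact/(chi_eq0 chiP).
  by rewrite conjc0 mul0r mulr0.
have gper n : char_transform g (n + q) = char_transform g n.
  rewrite /char_transform; apply: eq_bigr => b _; congr (_ * _%:C%C).
  by rewrite mulnDr (periodic_modn gq) addnC modnMDl -(periodic_modn gq).
have [B B0 HB] : exists2 B, 0 <= B & forall N, sqnorm (T N) <= B.
  have := cvg_has_ub (u_ := fun N => sqnorm (T N)).
  have /cvgP cT := sqnorm_lim T0.
  move=> /(_ cT) [B HB]; exists `|B| => // N.
  apply: le_trans (ler_norm _) _; apply: le_trans (ler_norm B).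
  by apply: HB; exists N.
pose K := \sum_(0 <= b < q) sqnorm (char_transform g b).
have K0 : 0 <= K by apply: sumr_ge0 => b _; exact: sqnorm_ge0.
have HK n : sqnorm (char_transform g n) <= K.
  rewrite (periodic_modn gper) /K (big_cat_nat (n := (n %% q)%N)) //=; last first.
    by rewrite ltnW // ltn_pmod.
  rewrite [X in _ + X]big_ltn ?ltn_pmod // addrCA lerDl addr_ge0 //.
    by apply: sumr_ge0 => b _; exact: sqnorm_ge0.
  by apply: sumr_ge0 => b _; exact: sqnorm_ge0.
have [|C HC] := @smooth_sum_bounded R (Re w) (primes q) w0.
  by apply/allP => p; rewrite mem_primes => /andP[].
pose b j : R := Num.sqrt (K * B) * (if sm j.+1 then npow j.+1 (- Re w) else 0).
have nsqs N j : sqnorm (s N j) <= b j ^+ 2.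
  rewrite /s /b; case: ifP => _; last by rewrite /sqnorm /= expr0n addr0 sqr_ge0.
  rewrite !sqnormM npowc_sqnorm exprMn sqr_sqrtr ?mulr_ge0 //.
  rewrite mulrAC; apply: ler_wpM2r; first exact: sqr_ge0.
  by apply: ler_pM; rewrite ?sqnorm_ge0.
have b0 j : 0 <= b j by rewrite mulr_ge0 ?sqrtr_ge0 //; case: ifP => // _; exact: npow_ge0.
have sumb n : \sum_(0 <= j < n) b j <= Num.sqrt (K * B) * C.
  rewrite -mulr_sumr ler_wpM2l ?sqrtr_ge0 //.
  by have := HC n; rewrite big_mkcond big_add1.
have sq (x y : R) : 0 <= y -> x ^+ 2 <= y ^+ 2 -> `|x| <= y.
  by move=> y0 H; rewrite -(@ler_pXn2r _ 2) ?nnegrE // real_normK ?num_real.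
have cst0 : (fun n => \sum_(0 <= j < n) (0 : R)) @ \oo --> (0 : R).
  by under eq_fun do rewrite big1_eq; exact: cvg_cst.
have s0 j : clim (fun N => s N j) 0.
  rewrite /s; case: (sm j.+1); last exact: clim_cst.
  rewrite -[0](mulr0 (char_transform g j.+1 * npowc j.+1 w)); apply: climZ.
  exact: (clim_comp_div (ltn0Sn j) T0).
have ev (f : R[i] -> R) (fs : {morph f : x y / x + y}) N : f 0 = 0 ->
    (fun n => \sum_(0 <= j < n) f (s N j)) @ \oo -->
    f (\sum_(1 <= n < N.+1) char_transform g n * npowc n w).
  move=> f0; apply/cvgn_distP => e e0; exists N => n Nn.
  by rewrite -(E N n Nn) (big_morph f fs f0) subrr normr0 ltW.
split.
  apply: (@tannery R (fun N j => Re (s N j)) b _ (fun=> 0)) sumb _ _ cst0.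
  - move=> N j; apply: sq => //; apply: le_trans (nsqs N j); rewrite /sqnorm lerDl.
    exact: sqr_ge0.
  - by move=> j; have [] := s0 j.
  - by move=> N; apply: ev => // x y; exact: Re_add.
apply: (@tannery R (fun N j => Im (s N j)) b _ (fun=> 0)) sumb _ _ cst0.
- move=> N j; apply: sq => //; apply: le_trans (nsqs N j); rewrite /sqnorm lerDr.
  exact: sqr_ge0.
- by move=> j; have [] := s0 j.
- by move=> N; apply: ev => // x y; exact: Im_add.
Qed.

End FourierTransform.

(** * Fejer means of the quadratic cosine series *)

Section Taylor.
Variable R : realType.
Implicit Types (x y u v : R).

(** Two uses of the mean value theorem give [e] instead of the sharp [e / 2], which suffices. *)
Lemma taylor2 (f f1 f2 : R -> R) (u v e x y : R) : 0 <= e ->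
  (forall t, u <= t <= v -> is_derive t 1 f (f1 t)) ->
  (forall t, u <= t <= v -> is_derive t 1 f1 (f2 t)) ->
  (forall t, u <= t <= v -> `|f2 t| <= e) ->
  u <= x <= v -> u <= y <= v ->
  `|f y - f x - f1 x * (y - x)| <= e * (y - x) ^+ 2.
Proof.
move=> e0 d1 d2 b2 /andP[ux xv] /andP[uy yv].
have dg t : u <= t <= v -> is_derive t 1 (fun z => f z - f1 x * z) (f1 t - f1 x).
  move=> /d1 d1t; apply: is_derive_eq (is_derive1B d1t (is_derive1Z _ (is_derive_id t 1))) _.
  by rewrite mulr1.
have [xy|/ltW yx] := leP x y.
  have H t : x <= t <= y -> `|f1 t - f1 x| <= e * (y - x).
    move=> /andP[xt ty].
    have := @MVT_le R f1 f2 x t e xt; move=> H.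
    apply: le_trans (H _ _) _.
    - by move=> z /andP[xz zt]; apply: d2; apply/andP; split; lra.
    - by move=> z /andP[xz zt]; apply: b2; apply/andP; split; lra.
    - by rewrite ler_wpM2l //; lra.
  have := @MVT_le R (fun z => f z - f1 x * z) (fun t => f1 t - f1 x) x y (e * (y - x)) xy.
  move=> K; rewrite (_ : f y - f x - _ = f y - f1 x * y - (f x - f1 x * x)); last by ring.
  rewrite expr2 mulrA; apply: K => //.
  by move=> t /andP[xt ty]; apply: dg; apply/andP; split; lra.
have H t : y <= t <= x -> `|f1 t - f1 x| <= e * (x - y).
  move=> /andP[yt tx].
  have := @MVT_le R f1 f2 t x e tx; move=> H; rewrite distrC.
  apply: le_trans (H _ _) _.
  - by move=> z /andP[xz zt]; apply: d2; apply/andP; split; lra.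
  - by move=> z /andP[xz zt]; apply: b2; apply/andP; split; lra.
  - by rewrite ler_wpM2l //; lra.
have := @MVT_le R (fun z => f z - f1 x * z) (fun t => f1 t - f1 x) y x (e * (x - y)) yx.
move=> K; rewrite (_ : f y - f x - _ = - (f x - f1 x * x - (f y - f1 x * y))); last by ring.
rewrite normrN (_ : e * _ = e * (x - y) * (x - y)); last by ring.
apply: K => // t /andP[xt ty]; apply: dg; apply/andP; split; lra.
Qed.

(** Cross-multiplied comparison of two chord slopes, in which the unknown [f1 x] cancels. As [e]
    tends to 0 the three points become collinear, with no control of the first derivatives. *)
Lemma three_points (f f1 f2 : R -> R) (u v e a x b : R) : 0 <= e ->
  (forall t, u <= t <= v -> is_derive t 1 f (f1 t)) ->
  (forall t, u <= t <= v -> is_derive t 1 f1 (f2 t)) ->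
  (forall t, u <= t <= v -> `|f2 t| <= e) ->
  u <= a -> a <= x -> x <= b -> b <= v ->
  `|(f x - f a) * (b - x) - (f b - f x) * (x - a)| <= 2 * e * (v - u) ^+ 3.
Proof.
move=> e0 d1 d2 b2 ua ax xb bv.
have xuv : u <= x <= v by apply/andP; split; lra.
have auv : u <= a <= v by apply/andP; split; lra.
have buv : u <= b <= v by apply/andP; split; lra.
have Ha := taylor2 e0 d1 d2 b2 xuv auv.
have Hb := taylor2 e0 d1 d2 b2 xuv buv.
rewrite (_ : _ - _ = - (f a - f x - f1 x * (a - x)) * (b - x)
   - (f b - f x - f1 x * (b - x)) * (x - a)); last by ring.
apply: le_trans (ler_normB _ _) _; rewrite !normrM normrN.
rewrite (ger0_norm (_ : 0 <= b - x)) ?(ger0_norm (_ : 0 <= x - a)); try lra.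
have vu : 0 <= v - u by lra.
have sq1 : e * (a - x) ^+ 2 <= e * (v - u) ^+ 2.
  apply: ler_wpM2l => //; rewrite -(sqrrN (a - x)); apply: lerXn2r; rewrite ?nnegrE; lra.
have sq2 : e * (b - x) ^+ 2 <= e * (v - u) ^+ 2.
  apply: ler_wpM2l => //; apply: lerXn2r; rewrite ?nnegrE; lra.
have T1 : `|f a - f x - f1 x * (a - x)| * (b - x) <= e * (v - u) ^+ 2 * (v - u).
  apply: ler_pM => //; [lra|exact: le_trans sq1|lra].
have T2 : `|f b - f x - f1 x * (b - x)| * (x - a) <= e * (v - u) ^+ 2 * (v - u).
  apply: ler_pM => //; [lra|exact: le_trans sq2|lra].
apply: le_trans (lerD T1 T2) _; rewrite exprSr; lra.
Qed.

End Taylor.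

Section Fejer.
Variable R : realType.
Implicit Types (x y u : R) (N k : nat).

Lemma dirichlet_kernel u N :
  sin u * (1 + 2 * \sum_(0 <= k < N) cos (k.+1%:R * (u + u))) =
  sin (N%:R * (u + u) + u).
Proof.
elim: N => [|N IH]; first by rewrite big_geq // mulr0 addr0 mulr1 mul0r add0r.
rewrite big_nat_recr //= [2 * (_ + _)]mulrDr addrA mulrDr IH.
have -> : N%:R * (u + u) + u = N.+1%:R * (u + u) - u by rewrite -(natr1 N); ring.
by rewrite sinB sinD; ring.
Qed.

(** Summation of the Dirichlet kernels; [u] is half the angle. *)
Lemma fejer_kernel u N :
  sin u ^+ 2 * (N%:R + 2 * \sum_(0 <= k < N) (N%:R - k.+1%:R) * cos (k.+1%:R * (u + u))) =
  sin (N%:R * u) ^+ 2.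
Proof.
elim: N => [|N IH]; first by rewrite big_geq // mul0r sin0 mulr0 addr0 mulr0 expr0n.
have -> : \sum_(0 <= k < N.+1) (N.+1%:R - k.+1%:R) * cos (k.+1%:R * (u + u)) =
   \sum_(0 <= k < N) (N%:R - k.+1%:R) * cos (k.+1%:R * (u + u)) +
   \sum_(0 <= k < N) cos (k.+1%:R * (u + u)).
  rewrite big_nat_recr //= subrr mul0r addr0 -big_split /=; apply: eq_bigr => k _.
  by rewrite -(natr1 N); ring.
have := dirichlet_kernel u N.
set S := \sum_(0 <= k < N) cos _; set S' := \sum_(0 <= k < N) _ * _ in IH *.
move=> D; rewrite -(natr1 N).
have -> : sin u ^+ 2 * (N%:R + 1 + 2 * (S' + S)) =
  sin u ^+ 2 * (N%:R + 2 * S') + sin u * (sin u * (1 + 2 * S)) by ring.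
(* What remains is [sin^2 a + sin u sin (2a + u) = sin^2 (a + u)] with [a = N u]. *)
rewrite IH D (_ : N%:R * (u + u) + u = N%:R * u + N%:R * u + u); last by ring.
rewrite (_ : (N%:R + 1) * u = N%:R * u + u); last by ring.
move: (N%:R * u) => a; rewrite !sinD cosD.
have ca := cos2sin2 a; have cu := cos2sin2 u.
have E1 : cos a * cos a = 1 - sin a * sin a by rewrite -!expr2.
have E2 : cos u * cos u = 1 - sin u * sin u by rewrite -!expr2.
transitivity (sin a ^+ 2 + sin u * (2 * sin a * cos a * cos u) +
   sin u ^+ 2 * (cos a * cos a - sin a * sin a)); first by ring.
rewrite [RHS](_ : _ = sin a ^+ 2 * (cos u * cos u) + 2 * sin a * cos a * sin u * cos u
  + sin u ^+ 2 * (cos a * cos a)); last by ring.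
by rewrite E1 E2; ring.
Qed.

(** Index [k] carries the frequency [k.+1], so the last weight is 0. Up to sign, [fejer_sin] and
    [fejer_sum] are the successive derivatives of [fejer_cos]. *)
Definition fejer_weight N k : R := 1 - k.+1%:R / N%:R.
Definition fejer_cos N y : R := \sum_(0 <= k < N) fejer_weight N k * cos (k.+1%:R * y) / k.+1%:R ^+ 2.
Definition fejer_sin N y : R := \sum_(0 <= k < N) fejer_weight N k * sin (k.+1%:R * y) / k.+1%:R.
Definition fejer_sum N y : R := \sum_(0 <= k < N) fejer_weight N k * cos (k.+1%:R * y).

Lemma fejer_weight_le1 N k : (k < N)%N -> `|fejer_weight N k| <= 1.
Proof.
move=> kN; have N0 : 0 < N%:R :> R by rewrite ltr0n (leq_ltn_trans _ kN).
rewrite /fejer_weight ger0_norm; first by rewrite gerBl divr_ge0.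
by rewrite subr_ge0 ler_pdivrMr // mul1r ler_nat.
Qed.

(** [N + 2 N fejer_sum] is the Fejer kernel [sin^2 (N y/2) / sin^2 (y/2)], bounded away from the
    multiples of [2 pi]; division by [2 N] gives the decay. *)
Lemma fejer_sum_bound N y : sin (y / 2) != 0 ->
  `|fejer_sum N.+1 y + 1 / 2| <= (2 * N.+1%:R * sin (y / 2) ^+ 2)^-1.
Proof.
move=> sy; have N0 : N.+1%:R != 0 :> R by rewrite pnatr_eq0.
have := fejer_kernel (y / 2) N.+1; rewrite -splitr => E.
have s2 : sin (y / 2) ^+ 2 != 0 by rewrite expf_neq0.
have -> : fejer_sum N.+1 y + 1 / 2 = sin (N.+1%:R * (y / 2)) ^+ 2 * (2 * N.+1%:R * sin (y / 2) ^+ 2)^-1.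
  rewrite -E; have -> : \sum_(0 <= k < N.+1) (N.+1%:R - k.+1%:R) * cos (k.+1%:R * y)
     = N.+1%:R * fejer_sum N.+1 y.
    rewrite /fejer_sum mulr_sumr; apply: eq_bigr => k _; rewrite /fejer_weight; by field.
  move: (fejer_sum _ _) => D; move: sy N0; move: (sin _) (N.+1%:R) => s n s0 n0.
  by field; rewrite s0 n0.
rewrite normrM; have d0 : 0 <= (2 * N.+1%:R * sin (y / 2) ^+ 2)^-1.
  by rewrite invr_ge0 mulr_ge0 ?sqr_ge0 // mulr_ge0.
rewrite [X in _ * X]ger0_norm // ler_piMl // ger0_norm ?sqr_ge0 //.
Qed.

Lemma is_derive_fejer_cos N (c d x : R) :
  is_derive x 1 (fun t => fejer_cos N (c * (t - d)))
    (- c * fejer_sin N (c * (x - d))).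
Proof.
rewrite /fejer_sin mulr_sumr.
apply: (@is_derive1_sum R (fun k t => fejer_weight N k * cos (k.+1%:R * (c * (t - d))) / k.+1%:R ^+ 2)
  (fun k t => - c * (fejer_weight N k * sin (k.+1%:R * (c * (t - d))) / k.+1%:R))) => k.
have k0 : k.+1%:R != 0 :> R by rewrite pnatr_eq0.
have da : is_derive x 1 (fun t => k.+1%:R * (c * (t - d))) (k.+1%:R * (c * (1 - 0))).
  by apply: is_derive1Z; apply: is_derive1Z; apply: is_derive1B.
have := is_derive1Z (fejer_weight N k / k.+1%:R ^+ 2) (is_derive1_comp da (is_derive_cos _)).
rewrite (_ : (fun y => _) = (fun t => fejer_weight N k * cos (k.+1%:R * (c * (t - d))) / k.+1%:R ^+ 2)); last first.
  by apply/funext => t; rewrite mulrAC.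
by move=> H; apply: is_derive_eq H _; field.
Qed.

Lemma is_derive_fejer_sin N (c d x : R) :
  is_derive x 1 (fun t => fejer_sin N (c * (t - d)))
    (c * fejer_sum N (c * (x - d))).
Proof.
rewrite /fejer_sum mulr_sumr.
apply: (@is_derive1_sum R (fun k t => fejer_weight N k * sin (k.+1%:R * (c * (t - d))) / k.+1%:R)
  (fun k t => c * (fejer_weight N k * cos (k.+1%:R * (c * (t - d)))))) => k.
have k0 : k.+1%:R != 0 :> R by rewrite pnatr_eq0.
have da : is_derive x 1 (fun t => k.+1%:R * (c * (t - d))) (k.+1%:R * (c * (1 - 0))).
  by apply: is_derive1Z; apply: is_derive1Z; apply: is_derive1B.
have := is_derive1Z (fejer_weight N k / k.+1%:R) (is_derive1_comp da (is_derive_sin _)).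
rewrite (_ : (fun y => _) = (fun t => fejer_weight N k * sin (k.+1%:R * (c * (t - d))) / k.+1%:R)); last first.
  by apply/funext => t; rewrite mulrAC.
by move=> H; apply: is_derive_eq H _; field.
Qed.

Lemma sin_lower (d x : R) : 0 <= d -> d <= x -> x <= pi - d -> sin d <= sin x.
Proof.
move=> d0 dx xd; have mono (s t : R) : 0 <= s -> s <= t -> t <= pi / 2 -> sin s <= sin t.
  move=> s0 st tp; have p0 := pi_gt0 R.
  move: st; rewrite le_eqVlt => /orP[/eqP -> //|st]; apply: ltW.
  by rewrite ltr_sin // in_itv /=; apply/andP; split; lra.
have [xp|px] := leP x (pi / 2); first exact: mono.
have -> : sin x = sin (pi - x) by rewrite sinB sinpi cospi; ring.
by apply: mono; lra.
Qed.

End Fejer.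

(** * Integration over the line of exponentially decaying functions *)

Section Functional.
Variable R : realType.
Local Notation mu := (@lebesgue_measure R).
Implicit Types (f g h : R -> R) (c K l v : R).

Definition exp_dominated c h := continuous h /\
  exists K, forall v, `|h v| <= K * expR (- c * `|v|).

Lemma continuous_expabs c : continuous (fun v : R => expR (- c * `|v|)).
Proof.
move=> v; apply: continuous_comp; last exact: continuous_expR.
apply: continuousM; first exact: cvg_cst.
exact: norm_continuous.
Qed.

(** By symmetry the integral is [2 / c] times that of the exponential density. *)
Lemma integrable_expabs c : 0 < c ->
  mu.-integrable setT (EFin \o (fun v => expR (- c * `|v|))).
Proof.
move=> c0; have me : measurable_fun setT (fun v : R => expR (- c * `|v|)).
  by apply: continuous_measurable_fun; exact: continuous_expabs.
apply/integrableP; split; first exact/measurable_EFinP.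
under eq_integral do rewrite /= ger0_norm ?expR_ge0 //.
rewrite ge0_symfun_integralT; last 3 first.
- by move=> v; exact: expR_ge0.
- exact: continuous_expabs.
- by move=> v /=; rewrite normrN.
apply: lte_mul_pinfty => //.
rewrite (_ : \int[mu]_(x in [set x : R | (0 <= x)%R]) (expR (- c * `|x|))%:E =
    \int[mu]_x (c^-1%:E * (exponential_pdf c x)%:E))%E; last first.
  rewrite integral_mkcond; apply: eq_integral => x _; rewrite patchE.
  case: ifPn => [|/negP]; rewrite inE /= => x0.
    rewrite exponential_pdfE // -EFinM ger0_norm // mulrA mulVf ?mul1r //.
    by rewrite gt_eqF.
  by rewrite lt0_exponential_pdf ?mule0 // ltNge; apply/negP.
rewrite ge0_integralZl ?lee_fin ?invr_ge0 ?(ltW c0) //; last 2 first.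
- apply/measurable_EFinP; exact: measurable_exponential_pdf.
- by move=> x _; rewrite lee_fin exponential_pdf_ge0 // ltW.
by rewrite integral_exponential_pdf // mule1 ltry.
Qed.

Lemma exp_dominated_integrable c h : 0 < c -> exp_dominated c h -> mu.-integrable setT (EFin \o h).
Proof.
move=> c0 [ch [K hK]].
apply: (@le_integrable _ _ _ mu setT measurableT _ (EFin \o (fun v => K * expR (- c * `|v|)))).
- apply/measurable_EFinP; exact: continuous_measurable_fun.
- move=> v _ /=; rewrite lee_fin; apply: le_trans (hK v) (ler_norm _).
- have := integrableZl measurableT K (integrable_expabs c0).
  by under eq_fun do rewrite /= -EFinM.
Qed.

Definition lint h := \int[mu]_v h v.

Lemma lintD c h1 h2 : 0 < c -> exp_dominated c h1 -> exp_dominated c h2 ->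
  lint (fun v => h1 v + h2 v) = lint h1 + lint h2.
Proof.
by move=> c0 d1 d2; rewrite /lint RintegralD //; exact: (exp_dominated_integrable c0).
Qed.

Lemma lintZ c h a : 0 < c -> exp_dominated c h -> lint (fun v => a * h v) = a * lint h.
Proof.
by move=> c0 d; rewrite /lint RintegralZl //; exact: (exp_dominated_integrable c0).
Qed.

Lemma exp_dominatedD c h1 h2 : exp_dominated c h1 -> exp_dominated c h2 ->
  exp_dominated c (fun v => h1 v + h2 v).
Proof.
move=> [c1 [K1 H1]] [c2 [K2 H2]]; split.
  by move=> v; apply: continuousD; [exact: c1|exact: c2].
exists (K1 + K2) => v; apply: le_trans (ler_normD _ _) _.
by rewrite mulrDl lerD.
Qed.

Lemma exp_dominatedZ c h (a : R) : exp_dominated c h -> exp_dominated c (fun v => a * h v).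
Proof.
move=> [c1 [K1 H1]]; split.
  by move=> v; apply: continuousM; [exact: cvg_cst|exact: c1].
by exists (`|a| * K1) => v; rewrite normrM -mulrA ler_wpM2l.
Qed.

Lemma exp_dominated_shift c h l : 0 < c -> exp_dominated c h -> exp_dominated c (fun v => h (v + l)).
Proof.
move=> c0 [ch [K HK]]; split.
  move=> v; apply: continuous_comp; last exact: ch.
  by apply: continuousD; [exact: cvg_id|exact: cvg_cst].
have K0 : 0 <= K by have := HK 0; rewrite normr0 mulr0 expR0 mulr1; exact: le_trans.
exists (K * expR (c * `|l|)) => v; apply: le_trans (HK _) _.
rewrite -mulrA; apply: ler_wpM2l => //; rewrite -expRD ler_expR.
have H : `|v| <= `|v + l| + `|l| by have := ler_normB (v + l) l; rewrite addrK.
by have := ler_wpM2l (ltW c0) H; rewrite mulrDr; lra.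
Qed.

(** The change of variables is made for nonnegative integrands; a signed [h] is treated as
    [(h + D) - D] with its majorant [D]. *)
Lemma lint_shift c h l : 0 < c -> exp_dominated c h -> lint (fun v => h (v + l)) = lint h.
Proof.
move=> c0.
have ge0 g : exp_dominated c g -> (forall v, 0 <= g v) -> lint (fun v => g (v + l)) = lint g.
  move=> [cg _] g0; rewrite /lint /Rintegral; congr fine; apply/esym.
  pose F (v : R) : R := v + l.
  have dF (x : R) : is_derive x 1 F 1.
    by apply: is_derive_eq (is_derive1D (is_derive_id x 1) (is_derive_cst l x 1)) _; rewrite addr0.
  have F1 : derive1 F = cst 1.
    by apply/funext => x; rewrite derive1E; have [_ ->] := dF x.
  rewrite (@increasing_ge0_integration_by_substitutionT R F g) // ?F1.
  - by apply: eq_integral => x _ /=; rewrite mulr1.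
  - by move=> x y; rewrite /F ltrD2r.
  - by move=> x; exact: cvg_cst.
  - exact: is_cvg_cst.
  - exact: is_cvg_cst.
  - by apply/cvgrNyPle => A; near=> x; rewrite -lerBrDr; near: x; apply: nbhs_ninfty_le; exact: num_real.
  - by apply/cvgryPge => A; near=> x; rewrite -lerBlDr; near: x; apply: nbhs_pinfty_ge; exact: num_real.
move=> dh; have [ch [K HK]] := dh.
pose D (v : R) := K * expR (- c * `|v|).
have D0 v : 0 <= D v := le_trans (normr_ge0 _) (HK v).
have dD : exp_dominated c D.
  split; last by exists K => v; rewrite ger0_norm.
  apply: (exp_dominatedZ K (c := c) (h := fun v => expR (- c * `|v|)) _).1.
  split; first exact: continuous_expabs.
  by exists 1 => v; rewrite mul1r ger0_norm ?expR_ge0.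
have dhD := exp_dominatedD dh dD.
have := ge0 _ dhD; have := ge0 _ dD D0.
rewrite (lintD c0 (exp_dominated_shift l c0 dh) (exp_dominated_shift l c0 dD)) (lintD c0 dh dD) => -> H.
apply: (addIr (lint D)); apply: H => v.
by have := HK v; rewrite ler_norml => /andP[? _]; rewrite -lerBlDr sub0r.
Unshelve. all: by end_near. Qed.

Lemma lint_cvg0 c K (h : nat -> R -> R) : 0 < c -> (forall n, continuous (h n)) ->
  (forall n v, `|h n v| <= K * expR (- c * `|v|)) ->
  (forall v, (fun n => h n v) @ \oo --> 0) ->
  (fun n => lint (h n)) @ \oo --> 0.
Proof.
move=> c0 ch hK h0.
have mh n : measurable_fun setT (EFin \o h n).
  apply/measurable_EFinP; exact: continuous_measurable_fun.
have ig : mu.-integrable setT (EFin \o (fun v => K * expR (- c * `|v|))).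
  have := integrableZl measurableT K (integrable_expabs c0).
  by under eq_fun do rewrite /= -EFinM.
have [] := @dominated_convergence _ _ R mu setT measurableT (fun n => EFin \o h n)
  (fun=> 0%E) (EFin \o (fun v => K * expR (- c * `|v|))) mh.
- exact: measurable_cst.
- by apply: aeW => v _ /=; apply: cvg_EFin; [near=> n|exact: h0].
- exact: ig.
- by apply: aeW => v n _ /=; rewrite lee_fin.
move=> _ _; rewrite integral0 => H.
rewrite /lint /Rintegral -[0]/(fine 0%E); exact: fine_cvg H.
Unshelve. all: by end_near. Qed.

Lemma lint_gt0 c h : 0 < c -> exp_dominated c h -> (forall v, 0 <= h v) -> 0 < h 0 -> 0 < lint h.
Proof.
move=> c0 dh h0 h00; have [ch _] := dh.
have [e /= e0 He] : exists2 e : R, 0 < e & forall v, `|v| < e -> h 0 / 2 <= h v.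
  have h2 : 0 < h 0 / 2 by lra.
  have /cvgrPdist_le/(_ _ h2)/nbhs_ballP[e /= e0 He] := ch 0.
  exists e => // v ve; have := He v; rewrite /ball /= sub0r normrN => /(_ ve).
  by rewrite ler_norml => /andP[_ ?]; lra.
have mh : measurable_fun setT (EFin \o h).
  apply/measurable_EFinP; exact: continuous_measurable_fun.
have fin : (\int[mu]_v (h v)%:E)%E \is a fin_num.
  by apply: integrable_fin_num => //; exact: (exp_dominated_integrable c0 dh).
apply: (@lt_le_trans _ _ (h 0 / 2 * e)); first by rewrite mulr_gt0 //; lra.
rewrite -lee_fin /lint /Rintegral fineK //.
apply: (@le_trans _ _ (\int[mu]_(v in `[0%R, e[%classic) (h v)%:E)%E); last first.
  apply: ge0_subset_integral => //.
    by move=> v _ /=; rewrite lee_fin.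
apply: (@le_trans _ _ (\int[mu]_(v in `[0%R, e[%classic) (h 0 / 2)%:E)%E).
  rewrite integral_cst //= lebesgue_measure_itv /= lte_fin e0 sube0 EFinM.
  done.
apply: ge0_le_integral => //.
- by move=> v _; rewrite lee_fin; lra.
- exact: measurable_funTS.
move=> v /=; rewrite in_itv /= => /andP[v0 ve]; rewrite lee_fin; apply: He.
by rewrite ger0_norm.
Qed.

End Functional.

(** * The series sum cos(ky)/k^2 is piecewise quadratic *)

Section CosineSeries.
Variable R : realType.
Implicit Types (x y : R) (N k : nat).

Lemma cvg_divn (c : R) : (fun N => c / N.+1%:R) @ \oo --> 0.
Proof. by rewrite -(mulr0 c); apply: cvgM; [exact: cvg_cst|exact: cvg_harmonic]. Qed.

Lemma cvgn_bound0 (u : nat -> R) (l c : R) : u @ \oo --> l ->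
  (forall N, `|u N| <= c / N.+1%:R) -> l = 0.
Proof.
move=> ul uc; apply/eqP; rewrite -normr_eq0; apply/eqP/(cvgn_uniq (cvg_norm ul)).
apply: (@squeeze_cvgr _ _ _ _ (fun=> 0) (fun N => c / N.+1%:R)).
- by near=> N; rewrite normr_ge0 uc.
- exact: cvg_cst.
- exact: cvg_divn.
Unshelve. all: by end_near. Qed.

Lemma sum_inv_sqr_le n : \sum_(0 <= k < n) (k.+1%:R ^+ 2)^-1 <= 2 :> R.
Proof.
have := npow_sum_bound (ltr01 : 0 < 1 :> R) n; rewrite invr1.
rewrite (eq_bigr (fun k => (k.+1%:R ^+ 2)^-1)) => [|k _]; first by move=> /le_trans; apply; lra.
by rewrite npowN -npow_natr.
Qed.

(** On one period this is essentially the second Bernoulli polynomial. Its value at 0 is never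
    computed: it cancels in [spline]. *)
Definition cos_series y : R := limn (fun n => \sum_(0 <= k < n) cos (k.+1%:R * y) / k.+1%:R ^+ 2).

Lemma cos_term_le k y : `|cos (k.+1%:R * y) / k.+1%:R ^+ 2| <= (k.+1%:R ^+ 2)^-1 :> R.
Proof.
rewrite normrM [X in _ * X]ger0_norm ?invr_ge0 ?sqr_ge0 //.
by rewrite ler_piMl ?invr_ge0 ?sqr_ge0 // cos_max.
Qed.

Lemma cos_series_cvg y :
  (fun n => \sum_(0 <= k < n) cos (k.+1%:R * y) / k.+1%:R ^+ 2) @ \oo --> cos_series y.
Proof.
apply: (@series_cvg_bounded R _ 2) => n; apply: le_trans (sum_inv_sqr_le n).
by apply: ler_sum => k _; exact: cos_term_le.
Qed.

Lemma fejer_cos_cvg y : (fun N => fejer_cos N y) @ \oo --> cos_series y.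
Proof.
apply: (@tannery R (fun N k => if (k < N)%N then fejer_weight R N k * (cos (k.+1%:R * y) / k.+1%:R ^+ 2) else 0)
  (fun k => (k.+1%:R ^+ 2)^-1) 2 (fun k => cos (k.+1%:R * y) / k.+1%:R ^+ 2)).
- move=> N k; case: ifP => kN; last by rewrite normr0 invr_ge0 sqr_ge0.
  rewrite normrM; apply: le_trans (cos_term_le k y).
  by rewrite ler_piMl // fejer_weight_le1.
- exact: sum_inv_sqr_le.
- move=> k; apply/(cvgn_shift _ _ k.+1).
  under eq_fun do rewrite ltn_addl //.
  have F1 : (fun N => fejer_weight R (N + k.+1) k) @ \oo --> (1 : R).
    rewrite /fejer_weight -[X in _ --> X](subr0 (1 : R)); apply: cvgB; first exact: cvg_cst.
    have /(cvgn_shift _ _ k) := cvg_divn k.+1%:R.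
    by under eq_fun do rewrite -addnS.
  have := cvgM F1 (cvg_cst (cos (k.+1%:R * y) / k.+1%:R ^+ 2)); rewrite mul1r; exact.
- move=> N; apply/cvgn_distP => e e0; exists N => n Nn.
  have -> : \sum_(0 <= k < n) (if (k < N)%N then fejer_weight R N k * (cos (k.+1%:R * y) / k.+1%:R ^+ 2) else 0)
      = fejer_cos N y.
    rewrite [LHS](big_cat_nat (n := N)) //= [X in _ + X]big_nat [X in _ + X]big1 ?addr0; last first.
      by move=> k /andP[Nk _]; rewrite ltnNge Nk.
    by rewrite /fejer_cos !big_nat; apply: eq_bigr => k /andP[_ ->]; rewrite mulrA.
  by rewrite subrr normr0 ltW.
- exact: cos_series_cvg.
Qed.

Lemma is_derive_fejer_cos1 N x : is_derive x 1 (fejer_cos N) (- fejer_sin N x).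
Proof.
have := @is_derive_fejer_cos R N 1 0 x.
rewrite (_ : (fun t => _) = fejer_cos N); last by apply/funext => t; rewrite subr0 mul1r.
by rewrite subr0 mul1r mulN1r.
Qed.

Lemma is_derive_fejer_sin1 N x : is_derive x 1 (fejer_sin N) (fejer_sum N x).
Proof.
have := @is_derive_fejer_sin R N 1 0 x.
rewrite (_ : (fun t => _) = fejer_sin N); last by apply/funext => t; rewrite subr0 mul1r.
by rewrite subr0 !mul1r.
Qed.

(* Constant on [0, 2 pi]: away from the endpoints the second derivative of the
   Fejer means of [cos_series y - y ^+ 2 / 4] is minus the Fejer kernel, up to a
   factor, and tends to 0. *)
Let Dc y := cos_series y - y ^+ 2 / 4 + pi * y / 2.

Lemma cos_series_period y : cos_series (y + pi *+ 2) = cos_series y.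
Proof.
rewrite /cos_series; congr (lim (_ @ \oo)); apply/funext => n; apply: eq_bigr => k _.
by rewrite mulrDr [_ * (pi *+ 2)]mulr_natl (periodicn (@cosD2pi R)).
Qed.

Lemma cos_series_refl y : cos_series (pi *+ 2 - y) = cos_series y.
Proof.
rewrite addrC cos_series_period /cos_series; congr (lim (_ @ \oo)); apply/funext => n.
by apply: eq_bigr => k _; rewrite mulrN cosN.
Qed.

Let Dc_refl y : Dc (pi *+ 2 - y) = Dc y.
Proof. by rewrite /Dc cos_series_refl; field. Qed.

(** By [three_points] on [[y, 2 pi - y]], where the Fejer kernel is bounded and its [1/N] multiple
    vanishes, the limit values at [y], [pi] and [2 pi - y] are collinear. The linear term [pi y / 2]
    makes [Dc] symmetric about [pi], so collinear means equal. *)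
Let Dc_const y : 0 < y < pi *+ 2 -> Dc y = Dc pi.
Proof.
wlog yp : y / y <= pi.
  move=> H /andP[y0 y2]; have [yp|py] := leP y pi; first by apply: H; rewrite ?yp ?y0.
  by rewrite -Dc_refl; apply: H; [|apply/andP; split]; move: y2; rewrite mulr2n; lra.
move=> /andP[y0 _]; move: yp; rewrite le_eqVlt => /orP[/eqP -> //|yp].
have p0 := pi_gt0 R.
have s0 : 0 < sin (y / 2) by apply: sin_gt0_pi; apply/andP; split; lra.
pose f N (t : R) := fejer_cos N t - t ^+ 2 / 4.
pose f1 N (t : R) := - fejer_sin N t - t / 2.
pose f2 N (t : R) := - fejer_sum N t - 1 / 2.
have d1 N (t : R) : is_derive t 1 (f N) (f1 N t).
  have H := is_derive1Z (4^-1) (is_derive1_pow 1 t).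
  rewrite (_ : f N = fun t => fejer_cos N t - 4^-1 * t ^+ 2); last by apply/funext => z; rewrite /f mulrC.
  by apply: is_derive_eq (is_derive1B (is_derive_fejer_cos1 N t) H) _; rewrite /f1 expr1; lra.
have d2 N (t : R) : is_derive t 1 (f1 N) (f2 N t).
  have H := is_derive1Z (2^-1) (is_derive_id t 1).
  have H' := is_derive1Z (-1) (is_derive_fejer_sin1 N t).
  rewrite (_ : f1 N = fun t => -1 * fejer_sin N t - 2^-1 * t); last first.
    by apply/funext => z; rewrite /f1; lra.
  by apply: is_derive_eq (is_derive1B H' H) _; rewrite /f2; lra.
pose e N : R := (2 * N.+1%:R * sin (y / 2) ^+ 2)^-1.
have s20 : 0 < sin (y / 2) ^+ 2 by rewrite exprn_gt0.
have N0 N : 0 < 2 * N.+1%:R :> R by rewrite mulr_gt0.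
have e0 N : 0 <= e N by rewrite invr_ge0 mulr_ge0 // ?ltW.
have b2 N (t : R) : y <= t <= pi *+ 2 - y -> `|f2 N.+1 t| <= e N.
  move=> /andP[yt ty]; move: ty; rewrite mulr2n => ty.
  have st : sin (y / 2) <= sin (t / 2) by apply: sin_lower; lra.
  have st0 : 0 < sin (t / 2) := lt_le_trans s0 st.
  rewrite /f2 -opprD normrN; apply: le_trans (fejer_sum_bound _ _) _; first by rewrite gt_eqF.
  rewrite /e lef_pV2 ?posrE ?mulr_gt0 ?exprn_gt0 //; apply: ler_wpM2l; first exact: ltW.
  by rewrite lerXn2r // nnegrE ltW.
have lim0 : (cos_series pi - pi ^+ 2 / 4 - (cos_series y - y ^+ 2 / 4)) * (pi *+ 2 - y - pi)
    - (cos_series (pi *+ 2 - y) - (pi *+ 2 - y) ^+ 2 / 4 - (cos_series pi - pi ^+ 2 / 4)) * (pi - y) = 0.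
  apply: (@cvgn_bound0 (fun N => (f N.+1 pi - f N.+1 y) * (pi *+ 2 - y - pi)
      - (f N.+1 (pi *+ 2 - y) - f N.+1 pi) * (pi - y)) _
      (2 * (2 * sin (y / 2) ^+ 2)^-1 * (pi *+ 2 - y - y) ^+ 3)).
    have fl t : (fun N => f N.+1 t) @ \oo --> cos_series t - t ^+ 2 / 4.
      apply: cvgB; last exact: cvg_cst.
      by have /(cvgn_shift _ _ 1) := @fejer_cos_cvg t; under eq_fun do rewrite addn1.
    by apply: cvgB; apply: cvgM; (exact: cvg_cst || exact: cvgB).
  move=> N; have y2 : pi <= pi *+ 2 - y by rewrite mulr2n; lra.
  have := three_points (e0 N) (fun t _ => d1 N.+1 t) (fun t _ => d2 N.+1 t) (b2 N)
     (lexx y) (ltW yp) y2 (lexx _).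
  move=> /le_trans; apply; rewrite /e.
  rewrite le_eqVlt; apply/orP; left; apply/eqP; field.
  by apply/andP; split; [rewrite nat1r pnatr_eq0|rewrite gt_eqF].
rewrite cos_series_refl mulr2n in lim0.
have : (pi - y) * (Dc pi - Dc y) = 0 by rewrite /Dc; lra.
by move/eqP; rewrite mulf_eq0 !subr_eq0 => /orP[/eqP E|/eqP ->//]; move: yp; rewrite E ltxx.
Qed.

(** The kernel bound degenerates at 0, so the endpoint is reached by continuity of the absolutely
    convergent series, along [1 / (j + 1)]. *)
Let Dc0 : Dc 0 = Dc pi.
Proof.
have p2 := pi_ge2 R.
pose y j : R := 1 / j.+1%:R.
have yl : y @ \oo --> 0 := cvg_divn 1.
have Cy : (fun j => cos_series (y j)) @ \oo --> cos_series 0.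
  apply: (@tannery R (fun j k => cos (k.+1%:R * y j) / k.+1%:R ^+ 2)
     (fun k => (k.+1%:R ^+ 2)^-1) 2 (fun k => cos (k.+1%:R * 0) / k.+1%:R ^+ 2)).
  - by move=> j k; exact: cos_term_le.
  - exact: sum_inv_sqr_le.
  - move=> k; apply: cvgM; last exact: cvg_cst.
    apply: (cvgn_continuous (@continuous_cos R)).
    by apply: cvgM; [exact: cvg_cst|].
  - by move=> j; exact: cos_series_cvg.
  - exact: cos_series_cvg.
have : (fun j => Dc (y j)) @ \oo --> Dc 0.
  rewrite /Dc; apply: cvgD; first apply: cvgB => //.
    apply: cvgM; last exact: cvg_cst.
    by under eq_fun do rewrite expr2; rewrite expr2; exact: cvgM.
  by apply: cvgM; [apply: cvgM => //; exact: cvg_cst|exact: cvg_cst].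
move=> /cvgn_uniq; apply; rewrite (_ : (fun j => Dc (y j)) = fun=> Dc pi); first exact: cvg_cst.
apply/funext => j; apply: Dc_const; rewrite /y divr_gt0 //= mulr2n.
apply: (@le_lt_trans _ _ 1); last by lra.
by rewrite ler_pdivrMr // mul1r ler1n.
Qed.

Lemma cos_series_quadratic y : 0 <= y < 1 ->
  cos_series (pi *+ 2 * y) = cos_series 0 + pi ^+ 2 * (y ^+ 2 - y).
Proof.
have p0 := pi_gt0 R.
move=> /andP[]; rewrite le_eqVlt => /orP[/eqP <- _|y0 y1].
  by rewrite mulr0; ring.
have H : Dc (pi *+ 2 * y) = Dc 0.
  rewrite Dc0 Dc_const // mulr2n; apply/andP; split; first by rewrite mulr_gt0 //; lra.
  by rewrite gtr_pMr //; lra.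
move: H; rewrite /Dc expr0n mulr0 !mul0r subr0 addr0 => <-.
by rewrite -mulr_natl; field.
Qed.

(** On [[-1, 0)] periodicity gives the polynomial [y^2 + y]; at each integer the slope drops by
    [2 pi^2], which is one more ramp. The induction translates by one period. *)
Lemma cos_series_formula J y : -1 <= y < J%:R ->
  cos_series (pi *+ 2 * y) = cos_series 0 + pi ^+ 2 * (y ^+ 2 + y)
    - 2 * pi ^+ 2 * \sum_(0 <= j < J) Num.max 0 (y - j%:R).
Proof.
elim: J y => [|J IH] y /andP[y1 yJ].
  rewrite big_geq // mulr0 subr0 -cos_series_period.
  rewrite (_ : pi *+ 2 * y + pi *+ 2 = pi *+ 2 * (y + 1)); last by rewrite mulrDr mulr1.
  by rewrite cos_series_quadratic; [congr (_ + _ * _); ring|apply/andP; split; lra].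
have [y0|y0] := ltP y 0.
  rewrite IH; last by rewrite y1 (lt_le_trans y0).
  congr (_ - _ * _); rewrite [RHS]big_nat_recr //=.
  rewrite (max_idPl (_ : y - J%:R <= 0)) ?addr0 //.
  by rewrite subr_le0 (le_trans (ltW y0)).
rewrite big_nat_recl //= subr0 (max_idPr y0).
rewrite (eq_bigr (fun j => Num.max 0 (y - 1 - j%:R))) => [|j _]; last first.
  by rewrite -natr1; congr Num.max; ring.
have := IH (y - 1); rewrite -cos_series_period.
rewrite (_ : pi *+ 2 * (y - 1) + _ = pi *+ 2 * y); last by rewrite mulrBr mulr1 subrK.
move: yJ; rewrite -natr1 => yJ ->; last by apply/andP; split; lra.
by ring.
Qed.

End CosineSeries.

(** * Uniform bounds and limits of the splines *)

Section Gamma.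
Variable R : realType.
Variable q : nat.
Hypothesis q1 : (1 < q)%N.
Implicit Types (x y : R) (N b : nat).
Let a : R := pi *+ 2 / q%:R.

(* Fejer means of the cosine series of a piecewise quadratic function of [x] with
   kinks at the points congruent to [b] modulo [q], minus the affine Taylor part
   at [x = 0]; see [spline_cvg] for the limit. *)
Definition spline N x b : R :=
  fejer_cos N (a * (x - b%:R)) - fejer_cos N (a * b%:R) - a * x * fejer_sin N (a * b%:R).

Let q0 : 0 < q%:R :> R. Proof. by rewrite ltr0n ltnW. Qed.
Let a0 : 0 < a. Proof. by rewrite divr_gt0 // mulrn_wgt0 // pi_gt0. Qed.
Let aq : a * q%:R = pi + pi. Proof. by rewrite /a mulfVK ?gt_eqF // mulr2n. Qed.

(** For [0 <= t <= 1/2] and [0 < b < q] the half-angle [a (b - t) / 2] stays in [[d, pi - d]], so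
    [e / N.+1] will bound the error in the second derivative of the Fejer mean there. *)
Let d := a / 4.
Let sd : 0 < sin d.
Proof.
have p0 := pi_gt0 R; have q2 : 2 <= q%:R :> R by rewrite ler_nat.
apply: sin_gt0_pi; apply/andP; split; rewrite /d; first by rewrite divr_gt0.
have := ler_wpM2l (ltW a0) q2; rewrite aq; lra.
Qed.
Let e := a ^+ 2 * (2 * sin d ^+ 2)^-1.
Let e0 : 0 <= e.
Proof. by rewrite mulr_ge0 ?sqr_ge0 // invr_ge0 mulr_ge0 // sqr_ge0. Qed.

(** No kink lies in [[0, 1/2]], and [spline] is by construction a Taylor remainder at 0; [a^2 / 4]
    is half the limit [a^2 / 2] of the second derivative. *)
Lemma spline_near N b x : (0 < b < q)%N -> 0 <= x <= 1 / 2 ->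
  `|spline N.+1 x b - a ^+ 2 / 4 * x ^+ 2| <= e / N.+1%:R * x ^+ 2.
Proof.
move=> /andP[b1 bq] x2.
have p0 := pi_gt0 R.
have b1' : 1 <= b%:R :> R by rewrite ler1n.
have bq' : b%:R <= q%:R - 1 :> R by rewrite lerBrDr natr1 ler_nat.
pose f (t : R) := fejer_cos N.+1 (a * (t - b%:R)) - a ^+ 2 / 4 * t ^+ 2.
pose f1 (t : R) := - a * fejer_sin N.+1 (a * (t - b%:R)) - a ^+ 2 / 4 * (2 * t ^+ 1).
pose f2 (t : R) := - a * (a * fejer_sum N.+1 (a * (t - b%:R))) - a ^+ 2 / 4 * (2 * 1).
have d1 (t : R) : 0 <= t <= 1 / 2 -> is_derive t 1 f (f1 t).
  by move=> _; apply: is_derive1B; [exact: is_derive_fejer_cos|exact/is_derive1Z/is_derive1_pow].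
have d2 (t : R) : 0 <= t <= 1 / 2 -> is_derive t 1 f1 (f2 t).
  move=> _; apply: is_derive1B; first by apply: is_derive1Z; exact: is_derive_fejer_sin.

have b2 (t : R) : 0 <= t <= 1 / 2 -> `|f2 t| <= e / N.+1%:R.
  move=> /andP[t0 t2].
  have su : sin d <= sin (a * (b%:R - t) / 2).
    apply: sin_lower; rewrite /d; first by rewrite divr_ge0 // ltW.
      have := ler_wpM2l (ltW a0) (_ : 1 / 2 <= b%:R - t); lra.
    have := ler_wpM2l (ltW a0) (_ : b%:R - t + 1 / 2 <= q%:R); rewrite aq; lra.
  have su0 : 0 < sin (a * (b%:R - t) / 2) := lt_le_trans sd su.
  have E : sin (a * (t - b%:R) / 2) = - sin (a * (b%:R - t) / 2).
    by rewrite -sinN; congr sin; ring.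
  have -> : f2 t = - (a ^+ 2 * (fejer_sum N.+1 (a * (t - b%:R)) + 1 / 2)) by rewrite /f2; lra.
  rewrite normrN normrM ger0_norm ?sqr_ge0 // /e -mulrA; apply: ler_wpM2l; first exact: sqr_ge0.
  apply: le_trans (fejer_sum_bound _ _) _; first by rewrite E oppr_eq0 gt_eqF.
  rewrite E sqrrN -invfM.
  have N0 : 0 < N.+1%:R :> R by [].
  rewrite lef_pV2 ?posrE ?mulr_gt0 ?exprn_gt0 //.
  rewrite mulrAC; apply: ler_wpM2l; first by rewrite mulr_ge0 // ltW.
  by rewrite lerXn2r // nnegrE ltW.
have eN : 0 <= e / N.+1%:R by rewrite divr_ge0.
have z0 : 0 <= (0 : R) <= 1 / 2 by rewrite lexx /=; lra.
have := taylor2 eN d1 d2 b2 z0 x2; rewrite subr0.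
suff -> : f x - f 0 - f1 0 * x = spline N.+1 x b - a ^+ 2 / 4 * x ^+ 2 by [].
rewrite /f /f1 /spline sub0r mulrN /fejer_cos /fejer_sin.
under [X in _ - (X - _) - _]eq_bigr do rewrite mulrN cosN.
under [X in - a * X - _]eq_bigr do rewrite mulrN sinN mulrN mulNr.
rewrite sumrN; ring.
Qed.

(** Domination uniform in [N]: quadratic near 0 by [spline_near], linear growth beyond 1/2. *)
Lemma spline_bound : exists2 K, 0 <= K & forall N b x, (0 < b < q)%N -> 0 <= x ->
  `|spline N.+1 x b| <= K * x /\ `|spline N.+1 x b| <= K * x ^+ 2.
Proof.
pose K1 := e + a ^+ 2 / 4.
have K10 : 0 <= K1 by rewrite addr_ge0 // divr_ge0 // sqr_ge0.
have near N b x : (0 < b < q)%N -> 0 <= x <= 1 / 2 -> `|spline N.+1 x b| <= K1 * x ^+ 2.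
  move=> bq x2; have := spline_near N bq x2.
  have eN : e / N.+1%:R * x ^+ 2 <= e * x ^+ 2.
    apply: ler_wpM2r; first exact: sqr_ge0.
    by rewrite ler_pdivrMr // ler_peMr // ler1n.
  have : 0 <= a ^+ 2 / 4 * x ^+ 2 by rewrite mulr_ge0 ?sqr_ge0 // divr_ge0 // sqr_ge0.
  move=> H1 H2; have := ler_normD (spline N.+1 x b - a ^+ 2 / 4 * x ^+ 2) (a ^+ 2 / 4 * x ^+ 2).
  rewrite subrK (ger0_norm H1) /K1 mulrDl => H3.
  by apply: le_trans H3 _; apply: lerD => //; exact: le_trans H2 _.
have CFb N y : `|fejer_cos N.+1 y| <= 2.
  apply: le_trans (ler_norm_sum _ _ _) _; apply: le_trans (sum_inv_sqr_le R N.+1).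
  rewrite !big_nat; apply: ler_sum => k /andP[_ kN].
  rewrite -mulrA normrM; apply: le_trans (cos_term_le k y).
  by rewrite ler_piMl // fejer_weight_le1.
(* The slope is not summed directly; it is recovered from the bounded value of the spline at
   [x = 1/2]. *)
have lam N b : (0 < b < q)%N -> `|a * fejer_sin N.+1 (a * b%:R)| <= 8 + K1.
  move=> bq; have h2 : 0 <= (1 / 2 : R) <= 1 / 2 by apply/andP; split; lra.
  have := near N b (1 / 2) bq h2; rewrite /spline.
  have := CFb N (a * (1 / 2 - b%:R)); have := CFb N (a * b%:R).
  rewrite !ler_norml; move: (fejer_cos _ _) (fejer_cos _ _) (fejer_sin _ _) => u v w.
  rewrite (_ : a * (1 / 2) * w = a * w / 2); last by lra.
  move: (a * w) => z /andP[? ?] /andP[? ?] /andP[]; rewrite expr2 => ? ?.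
  by apply/andP; split; lra.
pose K2 := 16 + K1; have K20 : 0 <= K2 by rewrite /K2; lra.
exists (2 * K2) => [|N b x bq x0]; first by lra.
have [x2|/ltW x2] := leP x (1 / 2).
  have := near N b x bq; rewrite x0 x2 => /(_ isT) H.
  have H1 : K1 * x ^+ 2 <= K1 * x.
    by apply: ler_wpM2l => //; rewrite expr2 ler_piMl //; lra.
  have H2 : 0 <= x ^+ 2 by exact: sqr_ge0.
  have H3 := mulr_ge0 K10 x0; have H4 := mulr_ge0 K10 H2.
  by rewrite /K2; split; lra.
have H : `|spline N.+1 x b| <= K2 * x.
  rewrite /spline; have := CFb N (a * (x - b%:R)); have := CFb N (a * b%:R).
  have L : `|a * x * fejer_sin N.+1 (a * b%:R)| <= (8 + K1) * x.
    by rewrite mulrAC normrM [X in _ * X]ger0_norm // ler_wpM2r // lam.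
  move: (fejer_cos _ _) (fejer_cos _ _) (fejer_sin _ _) L => u v w L H1 H2.
  apply: le_trans (ler_normB _ _) _; have := ler_normB u v; rewrite /K2; lra.
have xx : x <= 2 * x ^+ 2 by rewrite expr2; nra.
have := ler_wpM2l K20 xx; have := mulr_ge0 K20 x0.
by split; lra.
Qed.

(** The quadratic coefficient does not depend on [b], so it will drop out against a sequence whose
    sum over a period is zero. *)
Lemma spline_cvg b x J : (0 < b < q)%N -> 0 <= x -> x < J%:R * q%:R ->
  (fun N => spline N.+1 x b) @ \oo --> pi ^+ 2 / q%:R ^+ 2 * x ^+ 2
    - 2 * pi ^+ 2 / q%:R * \sum_(0 <= j < J) Num.max 0 (x - (b + j * q)%N%:R).
Proof.
move=> /andP[b1 bq] x0 xJ.
have p0 := pi_gt0 R.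
have qn0 : q%:R != 0 :> R by rewrite gt_eqF.
have b1' : 1 <= b%:R :> R by rewrite ler1n.
have bq' : b%:R <= q%:R :> R by rewrite ler_nat ltnW.
have CFs y : (fun N => fejer_cos N.+1 y) @ \oo --> cos_series y.
  by have /(cvgn_shift _ _ 1) := @fejer_cos_cvg R y; under eq_fun do rewrite addn1.
have aE y : a * y = pi *+ 2 * (y / q%:R) by rewrite /a; field.
have ab : cos_series (a * b%:R) = cos_series 0 + pi ^+ 2 * ((b%:R / q%:R) ^+ 2 - b%:R / q%:R).
  rewrite aE cos_series_quadratic // divr_ge0 ?ler0n //= ltr_pdivrMr // mul1r ltr_nat //.
(* The limit of the slope is read off at [x = 1/2], where all the other terms of the spline are
   known to converge. *)
have lam : (fun N => a * fejer_sin N.+1 (a * b%:R)) @ \oo --> pi ^+ 2 * (1 - 2 * (b%:R / q%:R)) / q%:R.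
  have G0 : (fun N => spline N.+1 (1 / 2) b) @ \oo --> a ^+ 2 / 4 * (1 / 2) ^+ 2.
    apply/cvgn_distP => r r0; have /cvgn_distP/(_ r r0)[N HN] := @cvg_divn R (e * (1 / 2) ^+ 2).
    exists N => n /HN; rewrite subr0 => H.
    apply: le_trans (spline_near n (x := 1 / 2) (b := b) _ _) _; first by rewrite b1.
      by rewrite lexx andbT; lra.
    by apply: le_trans H; rewrite mulrAC ler_norm.
  have -> : (fun N => a * fejer_sin N.+1 (a * b%:R)) =
      (fun N => (fejer_cos N.+1 (a * (1 / 2 - b%:R)) - fejer_cos N.+1 (a * b%:R) - spline N.+1 (1 / 2) b) * 2).
    by apply/funext => N /=; rewrite /spline; lra.
  have -> : pi ^+ 2 * (1 - 2 * (b%:R / q%:R)) / q%:R =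
      (cos_series (a * (1 / 2 - b%:R)) - cos_series (a * b%:R) - a ^+ 2 / 4 * (1 / 2) ^+ 2) * 2.
    rewrite ab aE (@cos_series_formula R 0); first by rewrite big_geq // mulr0 subr0 /a; field.
    rewrite ler_pdivlMr // ltr_pdivrMr // mul0r; apply/andP; split; last by lra.
    by lra.
  by apply: cvgM; [apply: cvgB => //; apply: cvgB|exact: cvg_cst].
rewrite /spline.
have xq : (x - b%:R) / q%:R < J%:R by rewrite ltr_pdivrMr //; lra.
have xq1 : -1 <= (x - b%:R) / q%:R by rewrite ler_pdivlMr //; lra.
have -> : (fun N => fejer_cos N.+1 (a * (x - b%:R)) - fejer_cos N.+1 (a * b%:R) - a * x * fejer_sin N.+1 (a * b%:R)) =
    (fun N => fejer_cos N.+1 (a * (x - b%:R)) - fejer_cos N.+1 (a * b%:R) - a * fejer_sin N.+1 (a * b%:R) * x).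
  by apply/funext => N; rewrite [a * x * _]mulrAC.
have -> : pi ^+ 2 / q%:R ^+ 2 * x ^+ 2
    - 2 * pi ^+ 2 / q%:R * \sum_(0 <= j < J) Num.max 0 (x - (b + j * q)%N%:R) =
    cos_series (a * (x - b%:R)) - cos_series (a * b%:R) - pi ^+ 2 * (1 - 2 * (b%:R / q%:R)) / q%:R * x.
  rewrite ab [a * (x - b%:R)]aE (@cos_series_formula R J) ?xq ?xq1 //.
  have -> : \sum_(0 <= j < J) Num.max 0 (x - (b + j * q)%N%:R) =
     q%:R * \sum_(0 <= j < J) Num.max 0 ((x - b%:R) / q%:R - j%:R).
    rewrite mulr_sumr; apply: eq_bigr => j _.
    rewrite maxr_pMr ?(ltW q0) // mulr0 natrD natrM; congr Num.max; by field.
  by move: (\sum_(0 <= j < J) _) => S; field.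
by apply: cvgB; [exact: cvgB|apply: cvgM => //; exact: cvg_cst].
Qed.

End Gamma.

(** * Mellin functional *)

Section Mellin.
Variable R : realType.
Variables sg ga : R.
Hypothesis sg01 : 0 < sg < 1.
Implicit Types (f g : R -> R) (x K l v : R).

(** Decay rate in [v = ln x] of the integrands built from [adm] functions: [sg] at plus infinity
    from the linear bound, [1 - sg] at minus infinity from the quadratic one. *)
Let c := Num.min sg (1 - sg).
Let c0 : 0 < c.
Proof. by case/andP: sg01 => s0 s1; rewrite /c lt_min s0 subr_gt0. Qed.

Definition adm f := continuous f /\
  exists K, forall x, 0 <= x -> `|f x| <= K * x /\ `|f x| <= K * x ^+ 2.

Definition mellin_integrand g f v := f (expR v) * expR (- (sg + 1) * v) * g (ga * v).

Definition trig g := continuous g /\ forall v, `|g v| <= 1.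

Lemma trig_cos : trig cos.
Proof. by split; [exact: continuous_cos|move=> v; exact: cos_max]. Qed.

Lemma trig_sin : trig sin.
Proof. by split; [exact: continuous_sin|move=> v; exact: sin_max]. Qed.

Lemma mellin_integrand_le g f K v : trig g ->
  (forall x, 0 <= x -> `|f x| <= K * x /\ `|f x| <= K * x ^+ 2) ->
  `|mellin_integrand g f v| <= K * expR (- c * `|v|).
Proof.
move=> [_ g1] fK; have [H1 H2] := fK _ (expR_ge0 v).
have [K0 _] := fK 1 ler01; rewrite mulr1 in K0; have {}K0 := le_trans (normr_ge0 _) K0.
have cs : c <= sg by rewrite /c ge_min lexx.
have cs' : c <= 1 - sg by rewrite /c ge_min lexx orbT.
rewrite /mellin_integrand !normrM (ger0_norm (expR_ge0 _)).
apply: le_trans (_ : `|f (expR v)| * expR (- (sg + 1) * v) <= _).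
  by rewrite ler_piMr // mulr_ge0 // expR_ge0.
have [v0|/ltW v0] := leP 0 v.
  apply: le_trans (ler_wpM2r (expR_ge0 _) H1) _.
  rewrite -mulrA -expRD ler_wpM2l // ler_expR ger0_norm //.
  by have := ler_wpM2r v0 cs; lra.
apply: le_trans (ler_wpM2r (expR_ge0 _) H2) _.
rewrite -mulrA -expRM_natl -expRD ler_wpM2l // ler_expR ler0_norm //.
have := ler_wnM2r v0 cs'; lra.
Qed.

Lemma continuous_mellin_integrand g f : trig g -> continuous f -> continuous (mellin_integrand g f).
Proof.
move=> [cg _] cf v.
rewrite (_ : mellin_integrand g f = fun t => f (expR t) * expR (- (sg + 1) * t) * g (ga * t)) //.
apply: cvgM; first apply: cvgM.
- by apply: continuous_comp; [exact: continuous_expR|exact: cf].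
- apply: continuous_comp; last exact: continuous_expR.
  by apply: continuousM; [exact: cvg_cst|exact: cvg_id].
- apply: continuous_comp; last exact: cg.
  by apply: continuousM; [exact: cvg_cst|exact: cvg_id].
Qed.

Lemma exp_dominated_mellin_integrand g f : trig g -> adm f -> exp_dominated c (mellin_integrand g f).
Proof.
move=> tg [cf [K fK]]; split; first exact: continuous_mellin_integrand.
by exists K => v; exact: mellin_integrand_le.
Qed.

Lemma adm0 : adm (fun=> 0).
Proof.
split; first by move=> x; exact: cvg_cst.
by exists 0 => x _; rewrite normr0 !mul0r.
Qed.

Lemma admD f1 f2 : adm f1 -> adm f2 -> adm (fun x => f1 x + f2 x).
Proof.
move=> [c1 [K1 H1]] [c2 [K2 H2]]; split.
  by move=> x; apply: continuousD; [exact: c1|exact: c2].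
exists (K1 + K2) => x x0; have [? ?] := H1 x x0; have [? ?] := H2 x x0.
by split; apply: le_trans (ler_normD _ _) _; rewrite mulrDl lerD.
Qed.

Lemma admZ (r : R) f : adm f -> adm (fun x => r * f x).
Proof.
move=> [c1 [K1 H1]]; split.
  by move=> x; apply: continuousM; [exact: cvg_cst|exact: c1].
exists (`|r| * K1) => x x0; have [? ?] := H1 x x0.
by rewrite normrM -!mulrA; split; apply: ler_wpM2l.
Qed.

Lemma adm_sum (r : nat -> R) (f : nat -> R -> R) m n : (forall k, (m <= k < n)%N -> adm (f k)) ->
  adm (fun x => \sum_(m <= k < n) r k * f k x).
Proof.
elim: n => [|n IH] H.
  by under eq_fun do rewrite big_geq //; exact: adm0.
have [mn|nm] := leqP m n; last first.
  by under eq_fun do rewrite big_geq //; exact: adm0.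
under eq_fun do rewrite big_nat_recr //=.
apply: admD; last by apply: admZ; apply: H; rewrite mn ltnSn.
by apply: IH => k /andP[mk kn]; apply: H; rewrite mk ltnW.
Qed.

Lemma adm_dil l f : 0 <= l -> adm f -> adm (fun x => f (l * x)).
Proof.
move=> l0 [cf [K fK]]; split.
  move=> x; apply: continuous_comp; last exact: cf.
  by apply: continuousM; [exact: cvg_cst|exact: cvg_id].
exists (Num.max (K * l) (K * l ^+ 2)) => x x0; have [H1 H2] := fK _ (mulr_ge0 l0 x0).
split; [apply: le_trans H1 _|apply: le_trans H2 _]; rewrite ?exprMn mulrA; apply: ler_wpM2r => //.
- by rewrite le_max lexx.
- exact: sqr_ge0.
- by rewrite le_max lexx orbT.
Qed.

(* [mellin f] is the integral over [x > 0] of [f x * x^(-s-2)], with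
   [s = Complex sg ga], after the substitution [x = expR v]. *)
Definition mellin f : R[i] := Complex (lint (mellin_integrand cos f)) (- lint (mellin_integrand sin f)).

Lemma lint_mellin_integrandD g f1 f2 : trig g -> adm f1 -> adm f2 ->
  lint (mellin_integrand g (fun x => f1 x + f2 x)) = lint (mellin_integrand g f1) + lint (mellin_integrand g f2).
Proof.
move=> tg a1 a2; rewrite -(lintD c0 (exp_dominated_mellin_integrand tg a1) (exp_dominated_mellin_integrand tg a2)).
by congr lint; apply/funext => v; rewrite /mellin_integrand; ring.
Qed.

Lemma lint_mellin_integrandZ g (r : R) f : trig g -> adm f ->
  lint (mellin_integrand g (fun x => r * f x)) = r * lint (mellin_integrand g f).
Proof.
move=> tg a1; rewrite -(lintZ r c0 (exp_dominated_mellin_integrand tg a1)).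
by congr lint; apply/funext => v; rewrite /mellin_integrand; ring.
Qed.

Lemma mellinD f1 f2 : adm f1 -> adm f2 ->
  mellin (fun x => f1 x + f2 x) = mellin f1 + mellin f2.
Proof.
move=> a1 a2; rewrite /mellin !lint_mellin_integrandD //; [|exact: trig_sin|exact: trig_cos].
by rewrite opprD.
Qed.

Lemma mellinZ (r : R) f : adm f -> mellin (fun x => r * f x) = r%:C%C * mellin f.
Proof.
move=> a1; rewrite /mellin !lint_mellin_integrandZ //; [|exact: trig_sin|exact: trig_cos].
by apply/eqP; rewrite eq_complex /=; apply/andP; split; apply/eqP; ring.
Qed.

Lemma mellin0 : mellin (fun=> 0) = 0.
Proof.
have := mellinZ 0 adm0; under eq_fun do rewrite mul0r.
by move=> ->; rewrite mul0r.
Qed.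

Lemma mellin_sum (r : nat -> R) (f : nat -> R -> R) m n :
  (forall k, (m <= k < n)%N -> adm (f k)) ->
  mellin (fun x => \sum_(m <= k < n) r k * f k x) =
  \sum_(m <= k < n) (r k)%:C%C * mellin (f k).
Proof.
elim: n => [|n IH] H.
  by rewrite big_geq //; under eq_fun do rewrite big_geq //; exact: mellin0.
have [mn|nm] := leqP m n; last first.
  by rewrite big_geq //; under eq_fun do rewrite big_geq //; exact: mellin0.
have an : adm (f n) by apply: H; rewrite mn ltnSn.
have H' k : (m <= k < n)%N -> adm (f k).
  by move=> /andP[mk kn]; apply: H; rewrite mk ltnW.
under eq_fun do rewrite big_nat_recr //=.
rewrite (mellinD (adm_sum r H') (admZ (r n) an)) mellinZ // IH //.
by rewrite big_nat_recr.
Qed.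

(** Dilation is translation by [ln l] in [v]; the addition formulas mix the cosine and sine
    integrals into one complex product by [l^{s+1}]. *)
Lemma mellin_dil l f : 0 < l -> adm f ->
  mellin (fun x => f (l * x)) = cpowR l (Complex (sg + 1) ga) * mellin f.
Proof.
move=> l0 af.
have dc := exp_dominated_mellin_integrand trig_cos af; have ds := exp_dominated_mellin_integrand trig_sin af.
pose E := expR ((sg + 1) * ln l).
have Ef v : f (l * expR v) * expR (- (sg + 1) * v) =
    E * (f (expR (v + ln l)) * expR (- (sg + 1) * (v + ln l))).
  rewrite expRD (lnK l0) [l * _]mulrC mulrCA /E -expRD; congr (_ * expR _); ring.
have gE v : ga * v = ga * (v + ln l) - ga * ln l by ring.
have sc := exp_dominated_shift (ln l) c0 dc; have ss := exp_dominated_shift (ln l) c0 ds.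
have C : lint (mellin_integrand cos (fun x => f (l * x))) =
    E * cos (ga * ln l) * lint (mellin_integrand cos f) + E * sin (ga * ln l) * lint (mellin_integrand sin f).
  rewrite -(lint_shift (ln l) c0 dc) -(lint_shift (ln l) c0 ds) -!(lintZ _ c0) //.
  rewrite -(lintD c0); [|exact: exp_dominatedZ|exact: exp_dominatedZ].
  by congr lint; apply/funext => v; rewrite {1}/mellin_integrand Ef gE cosB /mellin_integrand; ring.
have S : lint (mellin_integrand sin (fun x => f (l * x))) =
    E * cos (ga * ln l) * lint (mellin_integrand sin f) + (- (E * sin (ga * ln l))) * lint (mellin_integrand cos f).
  rewrite -(lint_shift (ln l) c0 dc) -(lint_shift (ln l) c0 ds) -!(lintZ _ c0) //.
  rewrite -(lintD c0); [|exact: exp_dominatedZ|exact: exp_dominatedZ].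
  by congr lint; apply/funext => v; rewrite {1}/mellin_integrand Ef gE sinB /mellin_integrand; ring.
rewrite /mellin C S /cpowR /= -/E.
by apply/eqP; rewrite eq_complex /=; apply/andP; split; apply/eqP; ring.
Qed.

Lemma mellin_cvg0 K (h : nat -> R -> R) : (forall n, continuous (h n)) ->
  (forall n x, 0 <= x -> `|h n x| <= K * x /\ `|h n x| <= K * x ^+ 2) ->
  (forall x, 0 <= x -> (fun n => h n x) @ \oo --> 0) ->
  clim (fun n => mellin (h n)) 0.
Proof.
move=> ch hK h0.
have H g : trig g -> (fun n => lint (mellin_integrand g (h n))) @ \oo --> (0 : R).
  move=> tg; apply: (lint_cvg0 c0 (K := K)).
  - by move=> n; exact: continuous_mellin_integrand.
  - by move=> n v; apply: mellin_integrand_le => //; exact: hK.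
  move=> v; rewrite /mellin_integrand -[X in _ --> X](mul0r (g (ga * v))); apply: cvgM; last exact: cvg_cst.
  rewrite -[X in _ --> X](mul0r (expR (- (sg + 1) * v))); apply: cvgM; last exact: cvg_cst.
  by apply: h0; exact: expR_ge0.
split; first exact: (H _ trig_cos).
by rewrite /= -[X in _ --> X]oppr0; apply: cvgN; exact: (H _ trig_sin).
Qed.

Definition ramp (n x : R) := Num.max 0 (x - n).

Lemma ramp_le0 n x : x <= n -> ramp n x = 0.
Proof. by rewrite /ramp => xn; apply/max_idPl; rewrite subr_le0. Qed.

Lemma ramp_ge n x : n <= x -> ramp n x = x - n.
Proof. by rewrite /ramp => xn; apply/max_idPr; rewrite subr_ge0. Qed.

Lemma ramp_ge0 n x : 0 <= ramp n x.
Proof. by rewrite /ramp le_max lexx. Qed.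

Lemma continuous_ramp n : continuous (ramp n).
Proof.
have -> : ramp n = fun x => (x - n + `|x - n|) * 2^-1.
  apply/funext => x; have [xn|/ltW nx] := leP x n.
    by rewrite ramp_le0 // ler0_norm ?subr_le0 //; lra.
  by rewrite ramp_ge // ger0_norm ?subr_ge0 //; lra.
have cB : continuous (fun x : R => x - n).
  by move=> x; apply: cvgB; [exact: cvg_id|exact: cvg_cst].
move=> x; apply: cvgM; last exact: cvg_cst.
by apply: cvgD; [exact: cB|apply: cvg_norm; exact: cB].
Qed.

Lemma adm_ramp n : 0 < n -> adm (ramp n).
Proof.
move=> n0; split; first exact: continuous_ramp.
exists (1 + n^-1) => x x0; rewrite ger0_norm ?ramp_ge0 //.
have n1 : 0 < n^-1 by rewrite invr_gt0.
have [xn|nx] := leP x n.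
  by rewrite ramp_le0 //; split; rewrite mulr_ge0 ?sqr_ge0 //; lra.
rewrite ramp_ge ?(ltW nx) // mulrDl mul1r; have H := mulr_ge0 (ltW n1) x0.
split; first lra.
have : 1 <= n^-1 * x by rewrite mulrC ler_pdivlMr // mul1r ltW.
by move=> H1; rewrite expr2; nra.
Qed.

(** Homogeneity: [ramp n x = n * ramp 1 (x / n)], and [n * n^{-(s+1)} = n^{-s}]. *)
Lemma mellin_ramp n : 0 < n -> mellin (ramp n) = cpowR n (- Complex sg ga) * mellin (ramp 1).
Proof.
move=> n0; have n1 : 0 < n^-1 by rewrite invr_gt0.
have -> : ramp n = fun x => n * ramp 1 (n^-1 * x).
  apply/funext => x; rewrite /ramp maxr_pMr ?(ltW n0) // mulr0 mulrBr mulr1 mulVKf // gt_eqF //.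
rewrite mellinZ; last by apply: adm_dil; [exact: ltW|exact: adm_ramp].
rewrite (mellin_dil n1 (adm_ramp ltr01)) mulrA; congr (_ * _).
rewrite /cpowR lnV ?posrE // /=.
have -> : expR ((sg + 1) * - ln n) = expR (- sg * ln n) * n^-1.
  have -> : n^-1 = expR (- ln n) by rewrite expRN lnK.
  by rewrite -expRD; congr expR; ring.
have -> : ga * - ln n = - ga * ln n by ring.
by apply/eqP; rewrite eq_complex /=; apply/andP; split; apply/eqP; field; rewrite gt_eqF.
Qed.

(* Second differences of ramps are tents, and a narrow tent at 1 only meets
   the part of the Mellin kernel where the cosine factor is positive. *)
Lemma mellin_ramp1_neq0 : mellin (ramp 1) != 0.
Proof.
apply/eqP => J0.
have J n : 0 < n -> mellin (ramp n) = 0 by move=> n0; rewrite mellin_ramp // J0 mulr0.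
(* The tent lives in [|v| <= eta], where [|ga v| <= 1 < pi / 2]. The choice of [de] puts its left
   foot exactly at [expR (- eta)], and [de <= eta] keeps the right foot in range. *)
pose eta := (`|ga| + 2)^-1; pose de := 1 - expR (- eta).
have eta0 : 0 < eta by rewrite invr_gt0 ltr_wpDl.
have de0 : 0 < de by rewrite /de subr_gt0 expR_lt1 oppr_lt0.
have de1 : de < 1 by rewrite /de gtrBl expR_gt0.
have deE : de <= eta by have := expR_ge1Dx (- eta); rewrite /de; lra.
pose tent x := ramp (1 - de) x + (-2) * ramp 1 x + ramp (1 + de) x.
have a1 := admZ (-2) (adm_ramp ltr01).
have a2 : adm (ramp (1 - de)) by apply: adm_ramp; rewrite subr_gt0.
have a3 : adm (ramp (1 + de)) by apply: adm_ramp; rewrite addr_gt0.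
have at_ : adm tent := admD (admD a2 a1) a3.
have t0 : mellin tent = 0.
  rewrite /tent (mellinD (admD a2 a1) a3) (mellinD a2 a1) mellinZ; last exact: adm_ramp.
  by rewrite !J ?mulr0 ?addr0 // ?subr_gt0 // addr_gt0.
have tent_ge0 x : 0 <= tent x.
  have g y : x - y <= ramp y x by rewrite /ramp le_max lexx orbT.
  rewrite /tent; have := ramp_ge0 (1 - de) x; have := ramp_ge0 (1 + de) x.
  have := g (1 - de); have := g (1 + de).
  by have [/ramp_le0 ->|/ltW/ramp_ge ->] := leP x 1; lra.
have tent_out x : x <= 1 - de \/ 1 + de <= x -> tent x = 0.
  rewrite /tent => -[H|H]; first by rewrite !ramp_le0; lra.
  by rewrite !ramp_ge; lra.
have tent1 : tent 1 = de.
  by rewrite /tent ramp_ge ?[ramp 1 _]ramp_ge ?ramp_le0; lra.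
suff : 0 < lint (mellin_integrand cos tent).
  by have -> : lint (mellin_integrand cos tent) = complex.Re (mellin tent) by []; rewrite t0 ltxx.
apply: (lint_gt0 c0 (exp_dominated_mellin_integrand trig_cos at_)); last first.
  by rewrite /mellin_integrand expR0 !mulr0 expR0 cos0 !mulr1 tent1.
move=> v; rewrite /mellin_integrand.
have [H|] := leP (expR v) (1 - de); first by rewrite tent_out ?mul0r //; left.
rewrite /de opprB addrC subrK ltr_expR => v1.
have [H|v2] := leP (1 + de) (expR v); first by rewrite tent_out ?mul0r //; right.
have v3 : v <= eta by have := expR_ge1Dx v; lra.
rewrite mulr_ge0 // ?mulr_ge0 ?expR_ge0 //; apply: cos_ge0_pihalf.
have gv : `|ga * v| <= 1.
  rewrite normrM; apply: (@le_trans _ _ (`|ga| * eta)).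
    by apply: ler_wpM2l => //; rewrite ler_norml v3 (ltW v1).
  by rewrite /eta ler_pdivrMr ?ltr_wpDl // mul1r lerDl.
have p2 := pi_ge2 R; move: gv; rewrite ler_norml => /andP[? ?].
apply/andP; split; lra.
Qed.

End Mellin.

(** * Transfer of zeros from w to 1 - w *)

Section Reflection.
Variable R : realType.
Local Notation Re := complex.Re.
Local Notation Im := complex.Im.
Implicit Types (x y : R) (N : nat).

(** The weight [1 - (k+1)/(N+1)] is the share of the partial sums of lengths 0 to [N] that contain
    [t k], so this is Cesaro's theorem with the empty sum included. *)
Lemma fejer_mean_cvg0 (t : nat -> R) : (fun N => \sum_(0 <= k < N) t k) @ \oo --> (0 : R) ->
  (fun N => \sum_(0 <= k < N.+1) fejer_weight R N.+1 k * t k) @ \oo --> (0 : R).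
Proof.
move=> /cesaro; rewrite (_ : arithmetic_mean _ = fun N => \sum_(0 <= k < N.+1) fejer_weight R N.+1 k * t k) //.
apply/funext => N; rewrite /arithmetic_mean /= seriesEnat /=.
have E M : \sum_(0 <= j < M) \sum_(0 <= k < j) t k = \sum_(0 <= k < M) (M%:R - k.+1%:R) * t k.
  elim: M => [|M IH]; first by rewrite !big_geq.
  rewrite big_nat_recr //= IH [RHS]big_nat_recr //= subrr mul0r addr0 -big_split /=.
  by apply: eq_bigr => k _; rewrite -(natr1 M); ring.
rewrite E mulr_sumr; apply: eq_bigr => k _; rewrite /fejer_weight.
by field; rewrite nat1r pnatr_eq0.
Qed.

Lemma cvgn_sum_lt (J : nat) (s : nat -> nat -> R) (f : nat -> R) :
  (forall j, (j < J)%N -> s ^~ j @ \oo --> f j) ->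
  (fun K => \sum_(0 <= j < J) s K j) @ \oo --> \sum_(0 <= j < J) f j.
Proof.
move=> H; have E (g : nat -> R) :
    \sum_(0 <= j < J) g j = \sum_(0 <= j < J) (if (j < J)%N then g j else 0).
  by rewrite !big_nat; apply: eq_bigr => j /andP[_ ->].
under eq_fun do rewrite E; rewrite E; apply: cvgn_sum => j.
by case: ltnP => [/H|_] //; exact: cvg_cst.
Qed.

(** Bounds a sum of [N] ramps uniformly in [N], since [ramp n x] decreases in [n]. *)
Lemma abel_mono_bound (a w : nat -> R) (B : R) N : 0 <= B ->
  (forall n, `|\sum_(0 <= k < n) a k| <= B) ->
  (forall k, 0 <= w k.+1 <= w k) -> `|\sum_(0 <= k < N) a k * w k| <= B * w 0%N.
Proof.
move=> B0 aB wm; rewrite abel_summation.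
have w0 k : 0 <= w k by have /andP[w1 w2] := wm k; exact: le_trans w2.
apply: le_trans (ler_normD _ _) _.
apply: (@le_trans _ _ (\sum_(0 <= k < N) B * (w k - w k.+1) + B * w N)).
  apply: lerD; last by rewrite normrM (ger0_norm (w0 N)) ler_wpM2r.
  apply: le_trans (ler_norm_sum _ _ _) _; apply: ler_sum => k _.
  have /andP[_ wk] := wm k; rewrite normrM [X in _ * X]ger0_norm ?subr_ge0 //.
  by rewrite ler_wpM2r // subr_ge0.
rewrite -mulr_sumr; suff -> : \sum_(0 <= k < N) (w k - w k.+1) = w 0%N - w N by lra.
elim: N => [|N IH]; first by rewrite big_geq // subrr.
by rewrite big_nat_recr //= IH; lra.
Qed.

Lemma sum_residues (V : nmodType) (F : nat -> V) J q :
  \sum_(0 <= n < J * q) F n = \sum_(0 <= b < q) \sum_(0 <= j < J) F (b + j * q)%N.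
Proof.
elim: J => [|J IH].
  by rewrite big_geq // big1 // => b _; rewrite big_geq.
rewrite mulSn addnC (big_cat_nat (n := (J * q)%N)) ?leq_addr //= IH.
under [RHS]eq_bigr do rewrite big_nat_recr //=.
rewrite big_split /=; congr (_ + _).
by rewrite -{1}[(J * q)%N]add0n big_addn addKn.
Qed.

Lemma cos_taylor x : 0 <= x -> `|cos x - 1| <= 2 * x /\ `|cos x - 1| <= 2 * x ^+ 2.
Proof.
move=> x0; have H1 := cos_lip x 0; rewrite cos0 subr0 (ger0_norm x0) in H1.
have H2 : `|cos x - cos 0 - - sin 0 * (x - 0)| <= 1 * (x - 0) ^+ 2.
  apply: (@taylor2 R cos (fun t => - sin t) (fun t => - cos t) 0 x) => //; rewrite ?lexx ?x0 //.
  - by move=> t _; rewrite normrN; exact: cos_max.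
move: H2; rewrite sin0 cos0 oppr0 mul0r !subr0 mul1r => H2.
by have := sqr_ge0 x; split; lra.
Qed.

Lemma sin_taylor x : 0 <= x -> `|sin x - x| <= 2 * x /\ `|sin x - x| <= 2 * x ^+ 2.
Proof.
move=> x0; have H1 := sin_lip x 0; rewrite sin0 !subr0 (ger0_norm x0) in H1.
have H2 : `|sin x - sin 0 - cos 0 * (x - 0)| <= 1 * (x - 0) ^+ 2.
  apply: (@taylor2 R sin cos (fun t => - sin t) 0 x) => //; rewrite ?lexx ?x0 //.
  by move=> t _; rewrite normrN; exact: sin_max.
move: H2; rewrite sin0 cos0 mul1r !subr0 mul1r => H2.
have := sqr_ge0 x; have := ler_normB (sin x) x; rewrite (ger0_norm x0).
by split; lra.
Qed.

(** Removing the affine Taylor parts at 0 makes cosine and sine [adm]; the affine correction in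
    [spline] does this for all frequencies at once. *)
Let cosB1 x := cos x - 1.
Let sinBid x := sin x - x.

Lemma adm_cosB1 : adm cosB1.
Proof.
split; last by exists 2 => x; exact: cos_taylor.
by move=> x; apply: cvgB; [exact: continuous_cos|exact: cvg_cst].
Qed.

Lemma adm_sinBid : adm sinBid.
Proof.
split; last by exists 2 => x; exact: sin_taylor.
by move=> x; apply: cvgB; [exact: continuous_sin|exact: cvg_id].
Qed.

Variable q : nat.
Hypothesis q1 : (1 < q)%N.
Let a : R := pi *+ 2 / q%:R.
Let q0 : 0 < q%:R :> R. Proof. by rewrite ltr0n ltnW. Qed.
Let a0 : 0 < a. Proof. by rewrite divr_gt0 // mulrn_wgt0 // pi_gt0. Qed.

Lemma spline_expand N x b : spline q N x b =
  \sum_(0 <= k < N) (fejer_weight R N k * cos (a * (b * k.+1)%N%:R) / k.+1%:R ^+ 2) * cosB1 (k.+1%:R * a * x)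
  + \sum_(0 <= k < N) (fejer_weight R N k * sin (a * (b * k.+1)%N%:R) / k.+1%:R ^+ 2) * sinBid (k.+1%:R * a * x).
Proof.
rewrite /spline /fejer_cos /fejer_sin -/a mulr_sumr -!sumrB -big_split /=; apply: eq_bigr => k _.
have -> : k.+1%:R * (a * (x - b%:R)) = k.+1%:R * a * x - a * (b * k.+1)%N%:R.
  by rewrite natrM; ring.
have -> : k.+1%:R * (a * b%:R) = a * (b * k.+1)%N%:R by rewrite natrM; ring.
by rewrite cosB /cosB1 /sinBid; field; rewrite nat1r pnatr_eq0.
Qed.

Variables sg ga : R.
Hypothesis sg01 : 0 < sg < 1.
Local Notation mellin := (mellin sg ga).

Let adm_cosB1_dil k : adm (fun x => cosB1 (k.+1%:R * a * x)).
Proof. by apply: (adm_dil _ adm_cosB1); rewrite mulr_ge0 // ltW. Qed.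
Let adm_sinBid_dil k : adm (fun x => sinBid (k.+1%:R * a * x)).
Proof. by apply: (adm_dil _ adm_sinBid); rewrite mulr_ge0 // ltW. Qed.

Lemma adm_spline N b : adm (fun x => spline q N x b).
Proof.
under eq_fun do rewrite spline_expand.
by apply: admD; apply: adm_sum => k _; [exact: adm_cosB1_dil|exact: adm_sinBid_dil].
Qed.

Let A : R[i] := cpowR a (Complex (sg + 1) ga).

(** Source of the reflection [s] to [1 - s]; the factor [k^2] cancels the coefficients [1 / k^2] in
    [spline_expand]. *)
Lemma cpowR_scaled k : cpowR (k.+1%:R * a) (Complex (sg + 1) ga) =
  (k.+1%:R ^+ 2)%:C%C * (A * npowc k.+1 (1 - Complex sg ga)).
Proof.
have k0 : 0 < k.+1%:R :> R by [].
have -> : (k.+1%:R ^+ 2 : R) = expR (2 * ln k.+1%:R).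
  by rewrite expRM_natl lnK.
rewrite /A /npowc /cpowR lnM ?posrE // Re_opp Im_opp.
have -> : Re (1 - Complex sg ga) = 1 - sg by [].
have -> : Im (1 - Complex sg ga) = - ga by rewrite /= add0r.
rewrite opprK !mulrDr expRD cosD sinD.
have -> : expR ((sg + 1) * ln k.+1%:R) = expR (2 * ln k.+1%:R) * expR (- (1 - sg) * ln k.+1%:R) :> R.
  by rewrite -expRD; congr expR; ring.
by apply/eqP; rewrite eq_complex /=; apply/andP; split; apply/eqP; ring.
Qed.

Lemma mellin_spline N b : mellin (fun x => spline q N x b) =
  \sum_(0 <= k < N) (fejer_weight R N k)%:C%C * (A * (npowc k.+1 (1 - Complex sg ga) *
     ((cos (a * (b * k.+1)%N%:R))%:C%C * mellin cosB1 + (sin (a * (b * k.+1)%N%:R))%:C%C * mellin sinBid))).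
Proof.
under eq_fun do rewrite spline_expand.
rewrite (mellinD ga sg01); [|by apply: adm_sum|by apply: adm_sum].
rewrite !(mellin_sum ga sg01) // -big_split /=; apply: eq_bigr => k _.
have ka : 0 < k.+1%:R * a by rewrite mulr_gt0.
rewrite (mellin_dil ga sg01 ka adm_cosB1) (mellin_dil ga sg01 ka adm_sinBid) cpowR_scaled.
have k0 : k.+1%:R != 0 :> R by rewrite pnatr_eq0.
rewrite [A * (_ * _)]mulrA; move: (A * _) (mellin cosB1) (mellin sinBid) => [z1 z2] [u1 u2] [v1 v2].
by apply/eqP; rewrite eq_complex /=; apply/andP; split; apply/eqP; field; rewrite nat1r.
Qed.

Section RealSequence.
Variable u : nat -> R.
Hypothesis uq : forall n, u (n + q)%N = u n.
Hypothesis u0 : u 0%N = 0.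
Hypothesis usum : \sum_(0 <= b < q) u b = 0.

(** Inverse of the ramp coefficient [2 pi^2 / q] in [spline_cvg]. *)
Let kappa : R := q%:R / (2 * pi ^+ 2).
Let pi0 : (pi : R) != 0. Proof. by rewrite gt_eqF // pi_gt0. Qed.
Let kappa0 : 0 <= kappa. Proof. by rewrite divr_ge0 // mulr_ge0 // sqr_ge0. Qed.

(** Pointwise the ramps cancel in the limit, and the quadratic part of the splines disappears by
    [usum]. *)
Let h N x := \sum_(1 <= n < N.+1) u n * ramp n%:R x
  + kappa * \sum_(0 <= b < q) u b * spline q N.+1 x b.

Let adm_h N : adm (h N).
Proof.
apply: admD; first by apply: adm_sum => k /andP[k1 _]; apply: adm_ramp; rewrite ltr0n.
by apply: admZ; apply: adm_sum => b _; exact: adm_spline.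
Qed.

(** Uniformity in [N] is what dominated convergence needs. The residue [b = 0], whose spline has a
    kink at 0 and escapes [spline_bound], is removed by [u0]. *)
Let h_bound : exists K, forall N x, 0 <= x -> `|h N x| <= K * x /\ `|h N x| <= K * x ^+ 2.
Proof.
have [B B0 HB] := periodic_bounded (ltnW q1) uq usum.
have [K K0 HK] := @spline_bound R q q1.
pose U := \sum_(0 <= b < q) `|u b|.
have U0 : 0 <= U by apply: sumr_ge0.
exists (B + kappa * (U * K)) => N x x0.
have S1 : `|\sum_(1 <= n < N.+1) u n * ramp n%:R x| <= B * ramp 1 x.
  rewrite big_add1 /=.
  apply: (@abel_mono_bound (fun k => u k.+1) (fun k => ramp k.+1%:R x)) => // k.
  rewrite ramp_ge0 /=; have kk : k.+1%:R <= k.+2%:R :> R by rewrite ler_nat.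
  rewrite /ramp ge_max le_max lexx /= le_max; apply/orP; right; lra.
have r1 : ramp 1 x <= x by rewrite /ramp ge_max x0 /=; lra.
have r2 : ramp 1 x <= x ^+ 2.
  rewrite /ramp ge_max sqr_ge0 /=; have := sqr_ge0 (x - 1); rewrite !expr2; nra.
have S2 y : (forall b, (0 < b < q)%N -> `|spline q N.+1 x b| <= K * y) ->
    `|kappa * \sum_(0 <= b < q) u b * spline q N.+1 x b| <= kappa * (U * K) * y.
  move=> H; rewrite normrM (ger0_norm kappa0) -mulrA; apply: ler_wpM2l => //.
  apply: le_trans (ler_norm_sum _ _ _) _; rewrite -mulrA mulr_suml !big_nat.
  apply: ler_sum => b /andP[_ bq]; rewrite normrM.
  have [->|b0] := posnP b; first by rewrite u0 normr0 !mul0r.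
  by apply: ler_wpM2l => //; apply: H; rewrite b0.
split; apply: le_trans (ler_normD _ _) _; rewrite [leRHS]mulrDl; apply: lerD.
- by apply: le_trans S1 _; rewrite ler_wpM2l.
- by apply: S2 => b bq; have [] := HK N b x bq x0.
- by apply: le_trans S1 _; rewrite ler_wpM2l.
- by apply: S2 => b bq; have [] := HK N b x bq x0.
Qed.

Let h_cvg0 x : 0 <= x -> (fun N => h N x) @ \oo --> 0.
Proof.
move=> x0; pose J := Num.bound x.
have xJ : x < J%:R * q%:R.
  apply: lt_le_trans (archi_boundP x0) _; rewrite ler_peMr // ler1n; exact: ltnW.
have C2 : (fun N => \sum_(0 <= b < q) u b * spline q N.+1 x b) @ \oo -->
   - (2 * pi ^+ 2 / q%:R * \sum_(0 <= n < J * q) u n * ramp n%:R x).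
  have -> : - (2 * pi ^+ 2 / q%:R * \sum_(0 <= n < J * q) u n * ramp n%:R x) =
     \sum_(0 <= b < q) u b * (pi ^+ 2 / q%:R ^+ 2 * x ^+ 2
    - 2 * pi ^+ 2 / q%:R * \sum_(0 <= j < J) Num.max 0 (x - (b + j * q)%N%:R)).
    under [RHS]eq_bigr do rewrite mulrBr.
    rewrite sumrB -mulr_suml usum mul0r sub0r; congr (- _).
    rewrite sum_residues mulr_sumr; apply: eq_bigr => b _.
    rewrite [RHS]mulrCA; congr (_ * _); rewrite mulr_sumr; apply: eq_bigr => j _.
    by rewrite /ramp (periodic_modn uq) [(b + _)%N]addnC modnMDl -(periodic_modn uq) [(j * q + b)%N]addnC.
  apply: cvgn_sum_lt => b bq; have [->|b0] := posnP b.
    by under eq_fun do rewrite u0 mul0r; rewrite u0 mul0r; exact: cvg_cst.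
  by apply: cvgM; [exact: cvg_cst|apply: spline_cvg => //; rewrite b0].
have C1 : (fun N => \sum_(1 <= n < N.+1) u n * ramp n%:R x) @ \oo -->
    \sum_(0 <= n < J * q) u n * ramp n%:R x.
  apply/cvgn_distP => e e0; exists (J * q)%N => N HN.
  have -> : \sum_(1 <= n < N.+1) u n * ramp n%:R x = \sum_(0 <= n < N.+1) u n * ramp n%:R x.
    by rewrite [RHS]big_ltn // u0 mul0r add0r.
  rewrite [X in X - _](big_cat_nat (n := (J * q)%N)) ?leqW //= [X in _ + X - _]big_nat.
  rewrite [X in _ + X - _]big1 ?addr0 ?subrr ?normr0 ?ltW // => n /andP[nJ _].
  rewrite ramp_le0 ?mulr0 //; apply: le_trans (ltW xJ) _.
  by rewrite -natrM ler_nat.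
set S := \sum_(0 <= n < J * q) _ in C1 C2.
rewrite (_ : 0 = S + kappa * - (2 * pi ^+ 2 / q%:R * S)); last first.
  by rewrite /kappa; move: (pi : R) pi0 => p p0; field; rewrite p0 gt_eqF.
by apply: cvgD => //; apply: cvgM => //; exact: cvg_cst.
Qed.

Lemma mellin_ramp_sum_cvg0 : clim (fun N =>
  \sum_(1 <= n < N.+1) (u n)%:C%C * (cpowR n%:R (- Complex sg ga) * mellin (ramp 1))
  + kappa%:C%C * \sum_(0 <= b < q) (u b)%:C%C * mellin (fun x => spline q N.+1 x b)) 0.
Proof.
have [K HK] := h_bound.
have := mellin_cvg0 ga sg01 (fun N => (adm_h N).1) HK h_cvg0.
rewrite (_ : (fun N => _) = fun N =>
  \sum_(1 <= n < N.+1) (u n)%:C%C * (cpowR n%:R (- Complex sg ga) * mellin (ramp 1))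
  + kappa%:C%C * \sum_(0 <= b < q) (u b)%:C%C * mellin (fun x => spline q N.+1 x b)) //.
apply/funext => N.
have ar k : (1 <= k < N.+1)%N -> adm (ramp (k%:R : R)).
  by move=> /andP[k1 _]; apply: adm_ramp; rewrite ltr0n.
have aG b : (0 <= b < q)%N -> adm (fun x => spline q N.+1 x b) by move=> _; exact: adm_spline.
rewrite /h (mellinD ga sg01 (adm_sum _ ar) (admZ _ (adm_sum _ aG))).
rewrite (mellinZ ga sg01 _ (adm_sum _ aG)) !(mellin_sum ga sg01) //; congr (_ + _).
by rewrite !big_nat; apply: eq_bigr => n /andP[n1 _]; rewrite (mellin_ramp ga sg01) // ltr0n.
Qed.

End RealSequence.

Variable chi : nat -> R[i].
Hypothesis chiP : is_dirichlet_character q chi.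
Hypothesis chiN : ~ principal_character q chi.

Lemma complex_split (z : R[i]) : z = (Re z)%:C%C + 'i%C * (Im z)%:C%C.
Proof.
by case: z => x y; apply/eqP; rewrite eq_complex /=; apply/andP; split; apply/eqP; ring.
Qed.

Let kappa : R := q%:R / (2 * pi ^+ 2).

(** Real and imaginary parts of [chi] are treated as two real sequences, as [mellin] acts on real
    functions. *)
Lemma mellin_chi_cvg0 : clim (fun N =>
  \sum_(1 <= n < N.+1) chi n * (cpowR n%:R (- Complex sg ga) * mellin (ramp 1))
  + kappa%:C%C * \sum_(0 <= b < q) chi b * mellin (fun x => spline q N.+1 x b)) 0.
Proof.
have chi0 : chi 0%N = 0.
  by apply/(chi_eq0 chiP); rewrite /coprime gcd0n gtn_eqF.
have chis := chi_sum_eq0 (ltnW q1) chiP chiN.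
have HR := @mellin_ramp_sum_cvg0 (fun n => Re (chi n)).
have HI := @mellin_ramp_sum_cvg0 (fun n => Im (chi n)).
have := climD (HR _ _ _) (climZ 'i%C (HI _ _ _)); rewrite mulr0 addr0.
rewrite (_ : (fun n => _) = fun N =>
  \sum_(1 <= n < N.+1) chi n * (cpowR n%:R (- Complex sg ga) * mellin (ramp 1))
  + kappa%:C%C * \sum_(0 <= b < q) chi b * mellin (fun x => spline q N.+1 x b)).
  apply.
  - by move=> n; rewrite (chi_period chiP).
  - by rewrite chi0.
  - by rewrite -Re_sum chis.
  - by move=> n; rewrite (chi_period chiP).
  - by rewrite chi0.
  - by rewrite -Im_sum chis.
apply/funext => N; rewrite mulrDr addrACA !mulr_sumr -!big_split /=; congr (_ + _).
  by apply: eq_bigr => n _; rewrite {3}(complex_split (chi n)); ring.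
by apply: eq_bigr => b _; rewrite -/kappa [in RHS](complex_split (chi b)); ring.
Qed.

Let gc n : R := cos (a * n%:R).
Let gs n : R := sin (a * n%:R).

Let aq n : a * (n + q)%N%:R = a * n%:R + pi *+ 2.
Proof. by rewrite natrD mulrDr [a * q%:R]mulfVK // gt_eqF. Qed.

Let gcq n : gc (n + q) = gc n. Proof. by rewrite /gc aq cosD2pi. Qed.
Let gsq n : gs (n + q) = gs n. Proof. by rewrite /gs aq sinD2pi. Qed.

(** Exchanging the sums over residues and frequencies exhibits a Fejer mean of the series of [T k],
    whose two halves converge to 0 by [char_transform_zero]. *)
Lemma mellin_chi_spline_cvg0 :
  clim (fun N => \sum_(1 <= m < N.+1) (chi m)^*%C * npowc m (1 - Complex sg ga)) 0 ->
  clim (fun N => \sum_(0 <= b < q) chi b * mellin (fun x => spline q N.+1 x b)) 0.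
Proof.
set w := 1 - _; move=> H.
have w0 : 0 < Re w by rewrite /w /= subr_gt0; case/andP: sg01.
have Zc := char_transform_zero (ltnW q1) chiP gcq w0 H.
have Zs := char_transform_zero (ltnW q1) chiP gsq w0 H.
pose T k := A * (npowc k.+1 w *
  (char_transform q chi gc k.+1 * mellin cosB1 + char_transform q chi gs k.+1 * mellin sinBid)).
have T0 : clim (fun N => \sum_(0 <= k < N) T k) 0.
  have := climZ A (climD (climM Zc (clim_cst (mellin cosB1))) (climM Zs (clim_cst (mellin sinBid)))).
  rewrite !mul0r addr0 mulr0.
  rewrite (_ : (fun n => _) = fun N => \sum_(0 <= k < N) T k) //.
  apply/funext => N; rewrite /T !mulr_suml -big_split mulr_sumr big_add1 /=.
  by apply: eq_bigr => k _; ring.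
have E N : \sum_(0 <= b < q) chi b * mellin (fun x => spline q N.+1 x b) =
    \sum_(0 <= k < N.+1) (fejer_weight R N.+1 k)%:C%C * T k.
  under eq_bigr do rewrite mellin_spline mulr_sumr.
  rewrite exchange_big /=; apply: eq_bigr => k _.
  rewrite /T /char_transform !mulr_suml -big_split !mulr_sumr /=; apply: eq_bigr => b _.
  by rewrite /gc /gs /w; ring.
under eq_fun do rewrite E.
have [TR TI] := T0; split.
  under eq_fun do rewrite Re_sum.
  under eq_fun do under eq_bigr do rewrite Re_scale.
  by apply: fejer_mean_cvg0; under eq_fun do rewrite -Re_sum.
under eq_fun do rewrite Im_sum.
under eq_fun do under eq_bigr do rewrite Im_scale.
by apply: fejer_mean_cvg0; under eq_fun do rewrite -Im_sum.
Qed.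

Lemma zero_reflection :
  clim (fun N => \sum_(1 <= m < N.+1) (chi m)^*%C * npowc m (1 - Complex sg ga)) 0 ->
  clim (fun N => \sum_(1 <= n < N.+1) chi n * cpowR n%:R (- Complex sg ga)) 0.
Proof.
move=> H; have := climB mellin_chi_cvg0 (climZ kappa%:C%C (mellin_chi_spline_cvg0 H)).
rewrite mulr0 subr0; under eq_fun do rewrite addrK.
move=> /(climZ (mellin (ramp 1))^-1); rewrite mulr0.
rewrite (_ : (fun n => _) = fun N => \sum_(1 <= n < N.+1) chi n * cpowR n%:R (- Complex sg ga)) //.
apply/funext => N; rewrite mulr_sumr; apply: eq_bigr => n _.
by rewrite mulrC [chi n * (_ * _)]mulrA mulfK // mellin_ramp1_neq0.
Qed.

End Reflection.

(** * Conclusion: conjugation, almost sure events, both halves of the strip *)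

Lemma L_zero_nonprincipal (R : realType) (q : nat) (chi : nat -> R[i]) (s : R[i]) :
  ~ principal_character q chi -> L_zero q chi s ->
  clim (fun N => \sum_(1 <= n < N.+1) chi n * cpowR n%:R (- s)) 0.
Proof.
move=> np; rewrite /L_zero.
have E N : L_approx q chi s N = \sum_(1 <= n < N.+1) chi n * cpowR n%:R (- s).
  by rewrite /L_approx asboolF // !mul0r subr0.
by under eq_fun do rewrite E; under [X in _ /\ (X @ _ --> _)]eq_fun do rewrite E.
Qed.

Lemma modulus1_principal (R : realType) (chi : nat -> R[i]) :
  is_dirichlet_character 1 chi -> principal_character 1 chi.
Proof.
move=> chiP n _; elim: n => [|n IH]; last by rewrite -addn1 (chi_period chiP).
by rewrite -(chi_period chiP) (chi1 chiP).
Qed.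

Lemma cpowR_conj (R : realType) (x : R) (w : R[i]) : (cpowR x w)^*%C = cpowR x (w^*%C).
Proof. by case: w => u v; rewrite /cpowR /= mulNr cosN sinN mulrN. Qed.

Lemma clim_conj (R : realType) (z : nat -> R[i]) (l : R[i]) :
  clim z l -> clim (fun N => (z N)^*%C) (l^*%C).
Proof.
have RC (w : R[i]) : complex.Re w^*%C = complex.Re w by case: w.
have IC (w : R[i]) : complex.Im w^*%C = - complex.Im w by case: w.
rewrite /clim RC IC => -[zr zi]; split; first by under eq_fun do rewrite RC.
by under eq_fun do rewrite IC; exact: cvgN.
Qed.

(** Conjugation moves the zero to [conj s] for the conjugate character, and
    [conj s = 1 - (1 - sg + i ga)]: conjugation and reflection together preserve the height. *)
Lemma zero_reflected (R : realType) (q : nat) (chi : nat -> R[i]) (sg ga : R) :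
  (1 < q)%N -> is_dirichlet_character q chi -> ~ principal_character q chi -> 0 < sg < 1 ->
  clim (fun N => \sum_(1 <= n < N.+1) chi n * cpowR n%:R (- Complex sg ga)) 0 ->
  clim (fun N => \sum_(1 <= n < N.+1) chi n * cpowR n%:R (- Complex (1 - sg) ga)) 0.
Proof.
move=> q1 chiP np /andP[s0 s1] /clim_conj; rewrite conjc0 => H.
have s2 : 0 < 1 - sg < 1 by apply/andP; split; lra.
apply: (zero_reflection q1 s2 chiP np).
rewrite (_ : (fun N => _) = fun N => (\sum_(1 <= n < N.+1) chi n * cpowR n%:R (- Complex sg ga))^*%C) //.
apply/funext => N; rewrite rmorph_sum; apply: eq_bigr => n _.
have -> : npowc n (1 - Complex (1 - sg) ga) = (cpowR n%:R (- Complex sg ga))^*%C.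
  rewrite cpowR_conj /npowc; congr cpowR.
  by apply/eqP; rewrite eq_complex /=; apply/andP; split; apply/eqP; ring.
exact/esym/rmorphM.
Qed.

Lemma ae_exists d (T : measurableType d) (R : realType) (P : probability T R) (Q : T -> Prop) :
  {ae P, forall w, Q w} -> exists w, Q w.
Proof.
move=> H; apply: contrapT => /forallNP nQ.
have : P.-negligible setT.
  by move: H; rewrite /almost_everywhere /=; apply: negligibleS => w _ /=; exact: nQ.
move=> /(negligibleP P measurableT) H0; have := probability_setT P; rewrite H0 => /eqP.
by rewrite eq_sym onee_eq0.
Qed.

Lemma uniform_ae_le d (T : measurableType d) (R : realType) (P : probability T R)
  (M : nat) (X : T -> nat) : uniform_0_M P M X -> {ae P, forall w, (X w <= M)%N}.
Proof.
move=> [mX PX].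
have : P.-negligible (\bigcup_k (if (k <= M)%N then set0 else X @^-1` [set k])).
  apply: negligible_bigcup => k; case: ifP => kM; first exact: negligible_set0.
  by apply/(negligibleP P (mX k)); rewrite /= PX kM.
apply: negligibleS => w /= /negP wM; exists (X w) => //.
by rewrite (negbTE wM).
Qed.

Unset Implicit Arguments.

Theorem theorem4 (R : realType) (q : nat) (chi : nat -> R[i])
  (theta : nat -> R) (M : nat)
  (d : measure_display) (T : measurableType d) (P : probability T R)
  (m : nat -> T -> nat) :
  (0 < q)%N ->
  is_dirichlet_character q chi ->
  (forall p : nat, prime p -> ~~ (p %| q)%N ->
     chi p = Complex (cos (theta p)) (sin (theta p))) ->
  (0 < M)%N ->
  (forall n : nat, uniform_0_M P M (m n)) ->
  independent_nat_rvs P m ->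
  (forall (eps t : R), 0 < eps ->
     {ae P, forall w : T, exists (C : R) (N0 : nat), forall N : nat,
        (N0 <= N)%N ->
        `|Bprime q theta (fun n => m n w) N t| <= C * (N%:R) `^ (1 / 2 + eps)}) ->
  GRH_for q chi.
Proof.
move=> q0 chiP chith _ mU _ HB.
have np : ~ principal_character q chi.
  move=> pr; have e0 : 0 < 1 / 4 :> R by lra.
  by have [w /(principal_contradiction q0 pr chith)] := ae_exists (HB _ 0 e0).
(* Modulus 1 carries only the principal character; [1 < q] ensures [chi 0 = 0], on which the
   reflection relies. *)
have q1 : (1 < q)%N.
  rewrite ltn_neqAle q0 andbT; apply/eqP => qE; apply: np.
  by move: chiP; rewrite -qE; exact: modulus1_principal.
have right be ga : 1 / 2 < be < 1 ->
    ~ clim (fun N => \sum_(1 <= n < N.+1) chi n * cpowR n%:R (- Complex be ga)) 0.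
  move=> be12; have e0 : 0 < (be - 1 / 2) / 2 by case/andP: be12 => ? _; lra.
  have mM : {ae P, forall w n, (m n w <= M)%N} by apply/ae_foralln => n; exact: uniform_ae_le.
  (* The sample point may depend on the candidate zero: two almost sure events are intersected for
     this height and this exponent only. *)
  have [w [wM wB]] : exists w, (forall n, (m n w <= M)%N) /\
      exists (C : R) (N0 : nat), forall N : nat, (N0 <= N)%N ->
        `|Bprime q theta (fun n => m n w) N ga| <= C * (N%:R) `^ (1 / 2 + (be - 1 / 2) / 2).
    by apply: (ae_exists (P := P)); apply: filterI mM (HB _ ga e0).
  exact: zero_free_right q0 chiP np chith wM _ be12 wB.
move=> [be ga] /= /andP[b0 b1] /(L_zero_nonprincipal np) L0.
case: (ltgtP be (1 / 2)) => // [b2|b2].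
  case: (right (1 - be) ga); first by apply/andP; split; lra.
  by apply: (zero_reflected q1 chiP np) => //; rewrite b0.
by case: (right be ga); first by rewrite b2.
Qed.
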